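(* There exists a unique surjective $\mathcal A$-algebra homomorphism $\phi_d^\imath:\mathbf K^{\imath}\to\mathbf S^{\imath}$ such that for all $R\ge0$, $i\in[1,n-1]$ and $\lambda\in{}^\imath\tilde\Xi^{\mathrm{diag}}$, and for $A$ equal to any of the matrices $\lambda+RE^\theta_{n,n+2}$, $\lambda+RE^\theta_{i,i+1}$, $\lambda+RE^\theta_{i+1,i}$, one has $\phi_d^\imath([A])=[A]$ if $A\in{}^\imath\Xi_d$, and $\phi_d^\imath([A])=0$ otherwise.
   Context: Let $\mathcal A=\mathbb Z[v,v^{-1}]$, $n,d\ge1$, $N=2n+1$; $\mathbb N=\{0,1,2,\dots\}$, $|U|=\dim U$. Put $D=2d+1$. For an odd prime power $q$ equip $\mathbb F_q^D$ with a nondegenerate symmetric bilinear form with isometry group $O(D)$, and let $X$ be the set of flags $V=(0=V_0\subseteq\cdots\subseteq V_N=\mathbb F_q^D)$ with $V_i=V_{N-i}^\perp$. Let $\Xi_d$ be the set of $N\times N$ matrices over $\mathbb N$ with $\sum a_{ij}=D$, $a_{ij}=a_{N+1-i,N+1-j}$. The $O(D)$-orbits $\mathcal O_A$ on $X\times X$ are indexed by $A\in\Xi_d$ via $a_{ij}=|(V_{i-1}+V_i\cap V'_j)/(V_{i-1}+V_i\cap V'_{j-1})|$. The Schur algebra $\mathbf S^{\jmath}$ (depending on $d$) is the free $\mathcal A$-module on the characteristic functions $e_A$, $A\in\Xi_d$, with convolution product $e_A*e_{A'}=\sum g_{A,A',A''}e_{A''}$, $g_{A,A',A''}\in\mathbb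 Z[v^2]$ giving at $v=\sqrt q$ (for all odd prime powers $q$) the number of $V\in X$ with $(V_1,V)\in\mathcal O_A$, $(V,V_2)\in\mathcal O_{A'}$ for fixed $(V_1,V_2)\in\mathcal O_{A''}$. Standard basis $[A]=v^{-d_A}e_A$, $$d_A=\sum_{i>k,\,j<l,\,i+k<N+1}a_{ij}a_{kl}+\sum_{j<l,\ (i<n+1\text{ or }j<N+1-l)}a_{ij}a_{il}+\sum_{i\ge n+1>j}\tfrac{a_{ij}(a_{ij}-1)}2 .$$ ${}^\imath\Xi_d$: those $A\in\Xi_d$ with $a_{n+1,n+1}=1$ and all other entries of row $n+1$ and column $n+1$ zero. $\mathbf S^{\imath}\subset\mathbf S^{\jmath}$: the subalgebra spanned over $\mathcal A$ by $[A]$, $A\in{}^\imath\Xi_d$ (functions supported on pairs of flags with $V_n$ maximal isotropic). ${}^\imath\tilde\Xi$: integer $N\times N$ matrices with $a_{ij}\ge0$ for $i\ne j$, $a_{ij}=a_{N+1-i,N+1-j}$, $a_{n+1,n+1}=1$ and all other entries of row $n+1$ and column $n+1$ zero; ${}^\imath\tilde\Xi^{\mathrm{diag}}$: its diagonal matrices. $E^\theta_{ij}=E_{ij}+E_{N+1-i,N+1-j}$. $\mathbf K^{\imath}$: free $\mathcal A$-module on $[A]$, $A\in{}^\imath\tilde\Xi$, with associative product (no unit) $[A_1]\cdots[A_f]=\sum_iG_i(v,1)[Z_i]$, where, with $\breve I=I-E_{n+1,n+1}$, $Z_i\in{}^\imath\tilde\Xi$ and $G_i(v,v')\in\mathbb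 Q(v)[v',v'^{-1}]$ satisfy $[A_1+p\breve I]*\cdots*[A_f+p\breve I]=\sum_iG_i(v,v^{-p})[Z_i+p\breve I]$ in the Schur algebras (for varying $d$) for all even $p\gg0$ (product zero if the column sums of some $A_i$ differ from the row sums of $A_{i+1}$). *)

(* Defs.v *)
From HB Require Import structures.
From mathcomp Require Import all_boot all_order all_algebra.
From mathcomp Require Import boolp.
From mathcomp.finmap Require Import finmap.
From mathcomp.multinomials Require Import monalg.

Set Implicit Arguments.
Unset Strict Implicit.
Unset Printing Implicit Defensive.

Import Order.TTheory GRing.Theory Num.Theory.
Local Open Scope ring_scope.

(* Throughout, N = n.*2.+1 and D = d.*2.+1.  The indices 1..N of the           *)
(* mathematics are 0..N-1 here, so that N+1-i becomes rev_ord i and the middle *)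
(* index n+1 becomes n.                                                        *)

(* Q(v), as the fraction field of Z[v]. *)
Notation Qv := {fraction {poly int}}.

Definition v : Qv := tofrac 'X.

(* Z[v, v^-1], as the subring of Q(v) of the x with x v^k in Z[v] for some k. *)
Definition laurent : {pred Qv} :=
  fun x => `[< exists (k : nat) (p : {poly int}), x * v ^+ k = tofrac p >].

Fact laurent_subring : subring_closed laurent.
Proof.
split.
- by apply/asboolP; exists 0%N, 1; rewrite expr0 mulr1 tofrac1.
- move=> x y /asboolP[k [p hp]] /asboolP[l [q hq]]; apply/asboolP.
  exists (k + l)%N, (p * 'X^l - q * 'X^k).
  rewrite tofracB !tofracM !tofracXn -hp -hq -/v mulrBl exprD.
  by rewrite mulrA [X in y * X]mulrC mulrA.
- move=> x y /asboolP[k [p hp]] /asboolP[l [q hq]]; apply/asboolP.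
  by exists (k + l)%N, (p * q); rewrite tofracM -hp -hq exprD mulrACA.
Qed.

HB.instance Definition _ :=
  GRing.isSubringClosed.Build Qv laurent laurent_subring.

Record Av := MkAv { aval :> Qv; _ : aval \in laurent }.

HB.instance Definition _ := [isSub for aval].
HB.instance Definition _ := [Choice of Av by <:].
HB.instance Definition _ := [SubChoice_isSubComNzRing of Av by <:].

Fact vexp_laurent (k : int) : v ^ k \in laurent.
Proof.
have v0 : v != 0 by rewrite tofrac_eq0 polyX_eq0.
apply/asboolP; case: k => k.
  by exists 0%N, 'X^k; rewrite mulr1 tofracXn.
by exists k.+1, 1; rewrite NegzE -exprnN mulVf ?expf_neq0 // tofrac1.
Qed.

Definition vexp (k : int) : Av := MkAv (vexp_laurent k).

(* An element of Z[v^2] is encoded by a polynomial in the variable v^2. *)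
Definition at_v2 (p : {poly int}) : Av := (map_poly intr p).[vexp 2].

(* Q(v)[v', v'^-1]: the coefficient of v'^k is G@_k, for k : int. *)
Notation laurent' := {malg Qv[int]}.

Definition laurent'_eval (G : laurent') (x : Qv) : Qv :=
  \sum_(k <- msupp G) G@_k * x ^ k.

Section IndexSets.

Variable n : nat.
Implicit Type M : 'M[int]_(n.*2.+1).

Definition centrosym M : bool :=
  [forall i, forall j, M i j == M (rev_ord i) (rev_ord j)].

Definition middle : 'I_(n.*2.+1) := inord n.

Definition middle_trivial M : bool :=
  [forall i, (M middle i == (i == middle)%:R) && (M i middle == (i == middle)%:R)].

Definition in_Xi (d : nat) M : bool :=
  [&& [forall i, forall j, 0 <= M i j],
      \sum_i \sum_j M i j == (d.*2.+1)%:Z & centrosym M].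

Definition in_iXi (d : nat) M : bool := in_Xi d M && middle_trivial M.

Definition in_iXit M : bool :=
  [&& [forall i, forall j, (i != j) ==> (0 <= M i j)],
      centrosym M & middle_trivial M].

Definition iXit := {M : 'M[int]_(n.*2.+1) | in_iXit M}.

(* Here i and j are counted from 1. *)
Definition Etheta (i j : nat) : 'M[int]_(n.*2.+1) :=
  delta_mx (inord i.-1) (inord j.-1)
  + delta_mx (inord (n.*2.+1 - i)) (inord (n.*2.+1 - j)).

Definition Ibreve : 'M[int]_(n.*2.+1) := 1%:M - delta_mx middle middle.

Definition composable (A B : iXit) : bool :=
  [forall j, \sum_i val A i j == \sum_k val B j k].

Definition dexp M : int :=
  \sum_(i < n.*2.+1) \sum_(j < n.*2.+1) \sum_(k < n.*2.+1 | (k < i)%N)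
     \sum_(l < n.*2.+1 | (j < l)%N && (i + k < n.*2)%N) M i j * M k l
  + \sum_(i < n.*2.+1) \sum_(j < n.*2.+1)
     \sum_(l < n.*2.+1 | (j < l)%N && ((i < n)%N || (j + l < n.*2)%N)) M i j * M i l
  + \sum_(i < n.*2.+1 | (n <= i)%N) \sum_(j < n.*2.+1 | (j < n)%N)
     ((M i j * (M i j - 1)) %/ 2)%Z.

Variable d : nat.

Record Xi := MkXi { xival :> 'M[int]_(n.*2.+1); _ : in_Xi d xival }.

HB.instance Definition _ := [isSub for xival].
HB.instance Definition _ := [Choice of Xi by <:].

(* Xi is finite: all entries of its members are at most D. *)
Definition Xi_bounded (A : Xi) : 'M['I_(d.*2.+2)]_(n.*2.+1) :=
  map_mx (fun a : int => inord `|a|%N) (val A).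

Definition Xi_unbounded (B : 'M['I_(d.*2.+2)]_(n.*2.+1)) : option Xi :=
  insub (map_mx (fun a : 'I_(d.*2.+2) => (a : nat)%:Z) B).

Fact Xi_boundedK : pcancel Xi_bounded Xi_unbounded.
Proof.
case=> M MXi; rewrite /Xi_unbounded /Xi_bounded /=.
have /and3P[/forallP M0 /eqP sM _] := MXi.
have M_ge0 i j : 0 <= M i j by have /forallP/(_ j) := M0 i.
rewrite (_ : map_mx _ _ = M); first by rewrite (insubT (in_Xi d) MXi).
apply/matrixP => i j; rewrite !mxE inordK ?gez0_abs //.
rewrite ltnS -lez_nat gez0_abs // -sM.
rewrite (bigD1 i) //= (bigD1 j) //= -addrA lerDl addr_ge0 ?sumr_ge0 // => k _.
by rewrite sumr_ge0.
Qed.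

HB.instance Definition _ := PCanIsCountable Xi_boundedK.
HB.instance Definition _ : isFinite Xi := PCanIsFinite Xi_boundedK.

End IndexSets.

Section Flags.

Variables (n d : nat) (F : finFieldType) (J : 'M[F]_(d.*2.+1)).

(* A subspace of F^D is represented by the unique matrix U with <<U>> = U     *)
(* whose rows span it; J is the Gram matrix of the bilinear form.             *)
Definition mxflag := {ffun 'I_(n.*2.+2) -> 'M[F]_(d.*2.+1)}.

Definition is_flag (V : mxflag) : bool :=
  [&& [forall i, <<V i>>%MS == V i],
      V ord0 == 0, (V ord_max == 1%:M :> 'M_(d.*2.+1))%MS,
      [forall i : 'I_(n.*2.+2), forall j : 'I_(n.*2.+2), (i <= j)%N ==> (V i <= V j)%MS] &
      [forall i, (V i == orthomx idfun J (V (rev_ord i)))%MS]].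

(* The indices i - 1 and i of the mathematics are i and i + 1 here. *)
Definition rel_pos (V V' : mxflag) : 'M[int]_(n.*2.+1) :=
  \matrix_(i, j)
    ((\rank (V (inord i) + V (inord i.+1) :&: V' (inord j.+1))%MS)%:Z
     - (\rank (V (inord i) + V (inord i.+1) :&: V' (inord j))%MS)%:Z).

Definition isometries : {set 'M[F]_(d.*2.+1)} := [set Q | Q *m J *m Q^T == J].

Definition flag_act (V : mxflag) (Q : 'M[F]_(d.*2.+1)) : mxflag :=
  [ffun i => <<V i *m Q>>%MS].

(* The O(D)-orbit on X x X of the pairs of flags with relative position A. *)
Definition orbit_of (A : Xi n d) : {set mxflag * mxflag} :=
  [set x | [exists Q in isometries, exists y : mxflag * mxflag,
     [&& is_flag y.1, is_flag y.2, rel_pos y.1 y.2 == val A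
       & x == (flag_act y.1 Q, flag_act y.2 Q)]]].

End Flags.

Section Algebras.

Variable n : nat.

Definition structure_constants :=
  forall d, Xi n d -> Xi n d -> Xi n d -> {poly int}.

(* Every orbit is nonempty over every F of odd order, so g d is unique for d > 0. *)
Definition is_schur_constants (g : structure_constants) : Prop :=
  forall (d : nat) (F : finFieldType) (J : 'M[F]_(d.*2.+1)),
    (0 < d)%N -> odd #|F| -> J \is symmetricmx -> J \in unitmx ->
  forall (A A' A'' : Xi n d) (V1 V2 : mxflag n d F),
    (V1, V2) \in orbit_of J A'' ->
    (#|[set V : mxflag n d F | is_flag J V
         & ((V1, V) \in orbit_of J A) && ((V, V2) \in orbit_of J A')]|)%:Z
    = (g d A A' A'').[(#|F|)%:Z].

(* e_A is << A >>. *)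
Definition Sj d := {malg Av[Xi n d]}.

Definition convolution (g : structure_constants) d (x y : Sj d) : Sj d :=
  \sum_(A : Xi n d) \sum_(A' : Xi n d) \sum_(A'' : Xi n d)
    (x@_A * y@_A' * at_v2 (g d A A' A'')) *: << A'' >>.

Definition stdXi d (A : Xi n d) : Sj d := vexp (- dexp (val A)) *: << A >>.

(* The standard basis element [M] of the Schur algebra when M is in Xi_d; the *)
(* value 0 for the other matrices is arbitrary.                               *)
Definition std d (M : 'M[int]_(n.*2.+1)) : Sj d :=
  if insub M is Some A then stdXi A else 0.

Definition in_Si d : {pred Sj d} :=
  fun x => `[< exists c : Xi n d -> Av,
                 x = \sum_(A | in_iXi d (val A)) c A *: stdXi A >].

Fact in_Si_submod d : submod_closed (@in_Si d).
Proof.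
split.
  apply/asboolP; exists (fun=> 0); rewrite big1 // => A _.
  by rewrite scale0r.
move=> a x y /asboolP[c ->] /asboolP[e ->]; apply/asboolP.
exists (fun A => a * c A + e A); rewrite scaler_sumr -big_split /=.
by apply: eq_bigr => A _; rewrite scalerDl scalerA.
Qed.

HB.instance Definition _ d :=
  GRing.isSubmodClosed.Build Av (Sj d) (@in_Si d) (in_Si_submod d).

Record Si d := MkSi { sival :> Sj d; _ : sival \in @in_Si d }.

HB.instance Definition _ d := [isSub for @sival d].
HB.instance Definition _ d := [Choice of Si d by <:].
HB.instance Definition _ d := [SubChoice_isSubLmodule of Si d by <:].

(* [A] is << A >>. *)
Definition Ki := {malg Av[iXit n]}.

(* The product of A :: s is [A_1] ... [A_f], and ZG lists the (Z_i, G_i).  The *)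
(* common sum of the entries of the A_i + p Ibreve determines d.  Elements of  *)
(* the Schur algebra are compared through their coefficients, in Q(v).         *)
(* mulK is unique: the v^-p are infinitely many, so they determine the G_i.    *)
Definition is_Kmul (g : structure_constants) (mulK : Ki -> Ki -> Ki) : Prop :=
  [/\ forall (a : Av) x y z, mulK (a *: x + y) z = a *: mulK x z + mulK y z,
      forall (a : Av) x y z, mulK z (a *: x + y) = a *: mulK z x + mulK z y,
      associative mulK,
      forall (A : iXit n) (s : seq (iXit n)), ~~ path (@composable n) A s ->
        foldl mulK << A >> [seq << B >> | B <- s] = 0 &
      forall (A : iXit n) (s : seq (iXit n)), path (@composable n) A s ->
        exists ZG : seq (iXit n * laurent'),
          (forall Z : iXit n,
             val (foldl mulK << A >> [seq << B >> | B <- s])@_Z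
             = \sum_(zg <- ZG | zg.1 == Z) laurent'_eval zg.2 1)
          /\
          exists p0 : nat, forall p d : nat, (p0 <= p)%N -> ~~ odd p ->
            let shift (B : iXit n) := val B + Ibreve n *+ p in
            all (fun B => in_Xi d (shift B)) (A :: s) ->
            all (fun zg => in_Xi d (shift zg.1)) ZG
            /\
            forall B : Xi n d,
              val (foldl (@convolution g d) (std d (shift A))
                     [seq std d (shift C) | C <- s])@_B
              = \sum_(zg <- ZG) laurent'_eval zg.2 (v ^ (- p%:Z))
                                * val (std d (shift zg.1))@_B].

End Algebras.

(* Main.v *)
(* The map phi is [A] |-> [A] if A lies in iXi_d and [A] |-> 0 otherwise.      *)
(* After base change to Q(v), K is generated by the [lambda] and the [lambda + *)
(* E^theta_(b,a)] (b = a + 1, or a = n and b = n + 2), by induction on the sum *)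
(* of the a_ij (i - j)^2. S is torsion free, so this gives uniqueness, and it  *)
(* is enough to check that phi is multiplicative when the left factor is one   *)
(* of these generators. There the structure constants are obtained by counting *)
(* the lines added to one step of an isotropic flag; in the coefficient of [Z  *)
(* + p I] they are Laurent polynomials in v^p, so K has the same constants,    *)
(* read at p = 0. If Z is in iXi_d and such a constant does not vanish, both   *)
(* factors are in iXi_d, since their entries are nonnegative.                  *)

Require Import Defs.
From HB Require Import structures.
From mathcomp Require Import all_boot all_order all_algebra.
From mathcomp Require Import zify ring lra.
From mathcomp Require Import boolp.
From mathcomp.finmap Require Import finmap.
From mathcomp.multinomials Require Import monalg.

Set Implicit Arguments.
Unset Strict Implicit.
Unset Printing Implicit Defensive.

Import Order.TTheory GRing.Theory Num.Theory.
Local Open Scope ring_scope.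

(** * Orthogonal complements and counting *)

(** The candidate [transfer d] keeps the coordinates of an element of K indexed by [in_iXi d] and
    drops the others. Linearity, surjectivity and the prescribed values are then easy, and the
    substance is multiplicativity and uniqueness. In both, the elements for which the claim holds
    are closed under linear combinations, products and division by nonzero scalars ([Sj_scaleI]), so
    by [K_generated] it suffices to treat diagonal matrices and the steps [lam + dth n b.-1 a.-1].
    For multiplicativity these occur as left factors.

    For such a left factor the structure constant is a count of flags V between two given flags V1
    and V2. V differs from V1 at one step and at the dual step, and is encoded by a line added to
    V1_a inside V1_b; the index k at which this line enters the flag V2 determines the position of V
    and V2. Counting the lines for each k gives [card_stepF]. In the middle of the flag, where a
    maximal isotropic subspace is exchanged for one meeting it in a hyperplane, the geometry of a
    hyperbolic plane gives [card_stepT]. Every position occurs ([rel_pos_coord_flags]) and an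
    integer polynomial is determined by its values at the odd primes, so the counts become the
    polynomial identity [schur_step].

    Normalised, this constant is [cstep], a formula in the matrix entries that still makes sense
    when diagonal entries are negative. After a shift by p [Ibreve] it is a Laurent polynomial in
    v^p ([cstep_laurent]), and so is the power of v in front of it ([dexp_shift]). The definition of
    K provides another such function with the same values at all large even p, so the two agree at p
    = 0 ([laurent_in_at0], [Kmul_coef]), and K has the constants given by [Kmul_step].

    It remains to compare supports: a nonzero constant at a nonnegative Z forces both factors to be
    nonnegative ([in_Xi_step]), so dropping coordinates respects products, and [schur_middle] keeps
    products inside the span of the [in_iXi d] part. *)

Section Perp.

Variables (F : fieldType) (D : nat) (J : 'M[F]_D).
Hypothesis Jsym : J \is symmetricmx.
Hypothesis Junit : J \in unitmx.

Local Notation perp := (orthomx idfun J).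

Lemma trmx_gram : J^T = J.
Proof. by move: Jsym => /is_hermitianmxP; rewrite expr0 scale1r map_mx_id. Qed.

Lemma sub_perp m1 m2 (A : 'M_(m1, D)) (B : 'M_(m2, D)) :
  (A <= perp B)%MS = (A *m J *m B^T == 0).
Proof. by rewrite /orthomx sub_kermx mulmxA map_mx_id. Qed.

Lemma sub_perpC m1 m2 (A : 'M_(m1, D)) (B : 'M_(m2, D)) :
  (A <= perp B)%MS = (B <= perp A)%MS.
Proof.
rewrite !sub_perp -(inj_eq (@trmx_inj _ _ _)) trmx0.
by rewrite !trmx_mul trmxK trmx_gram mulmxA.
Qed.

Lemma mxrank_perp m (B : 'M_(m, D)) : \rank (perp B) = (D - \rank B)%N.
Proof.
rewrite /orthomx mxrank_ker map_mx_id // -mxrank_tr trmx_mul trmxK mxrankMfree //.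
by rewrite row_free_unit unitmx_tr.
Qed.

Lemma perpS m1 m2 (A : 'M_(m1, D)) (B : 'M_(m2, D)) :
  (A <= B)%MS -> (perp B <= perp A)%MS.
Proof. by move=> AB; rewrite sub_perpC (submx_trans AB) // sub_perpC. Qed.

Lemma perpK m (B : 'M_(m, D)) : (perp (perp B) :=: B)%MS.
Proof.
have sB : (B <= perp (perp B))%MS by rewrite sub_perpC.
apply/eqmxP; rewrite andbC sB -(geq_leqif (mxrank_leqif_sup sB)).
by rewrite !mxrank_perp subKn ?rank_leq_col ?leqnn.
Qed.

Lemma perp_sub m1 m2 (A : 'M_(m1, D)) (B : 'M_(m2, D)) :
  (perp B <= perp A)%MS = (A <= B)%MS.
Proof.
apply/idP/idP; last exact: perpS.
by move=> h; rewrite -(perpK B) sub_perpC.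
Qed.

Lemma perp_eqmx m1 m2 (A : 'M_(m1, D)) (B : 'M_(m2, D)) :
  (A :=: B)%MS -> (perp A :=: perp B)%MS.
Proof. by move=> AB; apply/eqmxP; rewrite !perp_sub !AB submx_refl. Qed.

Lemma perp_adds m1 m2 (A : 'M_(m1, D)) (B : 'M_(m2, D)) :
  (perp (A + B)%MS :=: perp A :&: perp B)%MS.
Proof.
apply/eqmxP; rewrite sub_capmx !perp_sub addsmxSl addsmxSr /=.
by rewrite sub_perpC addsmx_sub -!(sub_perpC (_ :&: _)%MS) capmxSl capmxSr.
Qed.

Lemma mxrank_perp_cap m1 m2 (A : 'M_(m1, D)) (B : 'M_(m2, D)) :
  \rank (perp A :&: perp B)%MS = (D - \rank (A + B)%MS)%N.
Proof. by rewrite -(perp_adds A B) mxrank_perp. Qed.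

End Perp.

Section AddRow.

Variables (F : fieldType) (D : nat).

Lemma mxrank_adds_row m (P : 'M[F]_(m, D)) (w : 'rV[F]_D) :
  ~~ (w <= P)%MS -> \rank (P + w)%MS = (\rank P).+1.
Proof.
move=> wP; apply/eqP; rewrite eqn_leq; apply/andP; split.
  apply: leq_trans (leq_of_leqif (mxrank_adds_leqif P w)) _.
  by rewrite -[X in (_ <= X)%N]addn1 leq_add2l rank_leq_row.
apply: rank_ltmx; rewrite ltmxE addsmxSl addsmx_sub submx_refl /=.
by [].
Qed.

Lemma adds_row_full m1 m2 (P : 'M[F]_(m1, D)) (W : 'M[F]_(m2, D)) (w : 'rV[F]_D) :
    (P <= W)%MS -> \rank W = (\rank P).+1 -> (w <= W)%MS -> ~~ (w <= P)%MS ->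
  (P + w :=: W)%MS.
Proof.
move=> PW rW wW wP; have s : (P + w <= W)%MS by rewrite addsmx_sub PW.
by apply/eqmxP; rewrite -(mxrank_leqif_eq s) rW mxrank_adds_row.
Qed.

Lemma ex_row_diff m1 m2 (P : 'M[F]_(m1, D)) (W : 'M[F]_(m2, D)) :
  ~~ (W <= P)%MS -> exists2 w : 'rV_D, (w <= W)%MS & ~~ (w <= P)%MS.
Proof.
by move=> /row_subPn[i wi]; exists (row i W); rewrite ?row_sub.
Qed.

End AddRow.

Section Counting.

Variables (F : finFieldType) (D : nat).

Lemma card_row_space m (A : 'M[F]_(m, D)) :
  #|[set w : 'rV[F]_D | (w <= A)%MS]| = (#|F| ^ \rank A)%N.
Proof.
have -> : [set w : 'rV[F]_D | (w <= A)%MS]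
    = (fun u : 'rV_(\rank A) => u *m row_base A) @: setT.
  apply/setP=> w; rewrite inE; apply/idP/imsetP.
    by rewrite -(eq_row_base A) => /submxP[u ->]; exists u.
  by case=> u _ ->; rewrite (submx_trans (submxMl _ _)) // eq_row_base.
rewrite card_imset; last exact: (row_free_inj (row_base_free A)).
by rewrite cardsT card_mx mul1n.
Qed.

Lemma card_row_space_diff m1 m2 (A : 'M[F]_(m1, D)) (B : 'M[F]_(m2, D)) :
    (B <= A)%MS ->
  #|[set w : 'rV[F]_D | (w <= A)%MS && ~~ (w <= B)%MS]|
  = (#|F| ^ \rank A - #|F| ^ \rank B)%N.
Proof.
move=> BA; rewrite -!card_row_space.
have -> : [set w : 'rV[F]_D | (w <= A)%MS && ~~ (w <= B)%MS]
    = [set w : 'rV_D | (w <= A)%MS] :\: [set w : 'rV_D | (w <= B)%MS].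
  by apply/setP=> w; rewrite !inE andbC.
rewrite cardsD; congr (_ - #|pred_of_set _|)%N; apply/setP=> w; rewrite !inE.
by apply: andb_idl => /submx_trans; apply.
Qed.

(* A cover W of P inside Q1 is hit by the q^(r+1) - q^r vectors of W \ P.      *)
Lemma card_covers (P Q0 Q1 : 'M[F]_D) : (P <= Q0)%MS -> (Q0 <= Q1)%MS ->
  (#|[set W : 'M[F]_D | [&& <<W>>%MS == W, (P <= W)%MS, \rank W == (\rank P).+1,
        (W <= Q1)%MS & ~~ (W <= Q0)%MS]]|
   * (#|F| ^ (\rank P).+1 - #|F| ^ \rank P) = #|F| ^ \rank Q1 - #|F| ^ \rank Q0)%N.
Proof.
move=> PQ QQ; rewrite -card_row_space_diff //.
set T := [set W | _]; set S := [set w | _].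
rewrite -[RHS]sum1_card (partition_big (fun w : 'rV_D => <<(P + w)%MS>>%MS) (mem T)) /=.
  rewrite -sum_nat_const; apply: eq_bigr => W.
  rewrite inE => /and5P[/eqP gW PW /eqP rW WQ1 WQ0].
  rewrite sum1dep_card -rW -card_row_space_diff //.
  apply: eq_card => w; rewrite !inE.
  apply/idP/idP.
    move=> /andP[wW wP]; have e := adds_row_full PW rW wW wP.
    rewrite (submx_trans wW WQ1) /=; apply/andP; split.
      by apply: contra WQ0 => wQ0; rewrite -e addsmx_sub PQ.
    by apply/eqP; rewrite -gW; apply/eq_genmx.
  move=> /andP[/andP[wQ1 wQ0] /eqP e].
  rewrite -e genmxE addsmxSr /=; apply: contra wQ0 => /submx_trans; exact.
move=> w; rewrite !inE => /andP[wQ1 wQ0].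
have wP : ~~ (w <= P)%MS by apply: contra wQ0 => /submx_trans; exact.
rewrite genmx_id eqxx !genmxE addsmxSl mxrank_adds_row // eqxx /=.
rewrite !addsmx_sub (submx_trans PQ QQ) wQ1 /= negb_and wQ0 orbT.
by [].
Qed.

End Counting.

(** * Flags and relative positions *)

Section Dth.

Variable n : nat.
Local Notation N := (n.*2.+1).

(* E^theta, with indices counted from 0. *)
Definition dth (a b : nat) : 'M[int]_N :=
  delta_mx (inord a) (inord b) + delta_mx (inord (n.*2 - a)) (inord (n.*2 - b)).

Lemma dthE a b (i j : 'I_N) : (a < N)%N -> (b < N)%N ->
  dth a b i j = (((i : nat) == a) && ((j : nat) == b))%:Z
     + (((i : nat) == n.*2 - a)%N && ((j : nat) == n.*2 - b)%N)%:Z.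
Proof.
move=> aN bN; rewrite !mxE -!val_eqE /= !inordK; lia.
Qed.

(** The index n is its own mirror image, so the two terms are merely exchanged. This is why moving
    an entry in the middle column changes nothing in [move_mid]. *)
Lemma dth_mid : (0 < n)%N -> dth n.+1 n = dth n.-1 n.
Proof.
move=> n0; rewrite /dth addrC.
have -> : (n.*2 - n.+1 = n.-1)%N by lia.
have -> : (n.*2 - n.-1 = n.+1)%N by lia.
by have -> : (n.*2 - n = n)%N by lia.
Qed.

Lemma tr_dth a b : (dth a b)^T = dth b a.
Proof. by rewrite /dth linearD /= !trmx_delta. Qed.

Lemma dth_diag a (i j : 'I_N) : i != j -> dth a a i j = 0.
Proof.
move=> ij; rewrite !mxE.
have neq c : (i == c) && (j == c) = false.
  by apply: contraNF ij => /andP[/eqP-> /eqP->].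
by rewrite !neq addr0.
Qed.

End Dth.

Section FlagGeometry.

Variables (n d : nat) (F : finFieldType) (J : 'M[F]_(d.*2.+1)).

Local Notation N := (n.*2.+1).
Local Notation D := (d.*2.+1).
Local Notation perp := (orthomx idfun J).
Implicit Types V : mxflag n d F.

Definition fv V (i : nat) : 'M[F]_D := V (inord i).

(** These dimensions are the partial sums of the relative position ([psum_rel_pos]), and they are
    easier to follow than its entries when a flag is modified. *)
Definition rk V V' (i j : nat) : nat := \rank (fv V i :&: fv V' j)%MS.

Definition mkflag (f : nat -> 'M[F]_D) : mxflag n d F := [ffun i : 'I_N.+1 => <<f i>>%MS].

Lemma fv_mkflag f i : (i <= N)%N -> fv (mkflag f) i = <<f i>>%MS.
Proof. by move=> iN; rewrite /fv ffunE inordK. Qed.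

Lemma mxflagP V V' : (forall i, (i <= N)%N -> fv V i = fv V' i) -> V = V'.
Proof. by move=> h; apply/ffunP => i; have := h i; rewrite /fv inord_val -ltnS; apply. Qed.

Section OneFlag.
Variable V : mxflag n d F.
Hypothesis flV : is_flag J V.

Lemma fv_gen i : (<<fv V i>> = fv V i)%MS.
Proof. by case/and5P: flV => /forallP/(_ (inord i))/eqP. Qed.

Lemma fv0 : fv V 0 = 0.
Proof.
case/and5P: flV => _ /eqP h _ _ _; rewrite /fv -h; congr (V _).
by apply: val_inj; rewrite /= inordK.
Qed.

Lemma fvN : fv V N = 1%:M.
Proof.
case/and5P: flV => _ _ /eqP h _ _; rewrite /fv (_ : inord N = ord_max) //.
by apply: val_inj; rewrite /= inordK.
Qed.

Lemma fvS i j : (i <= j <= N)%N -> (fv V i <= fv V j)%MS.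
Proof.
move=> /andP[ij jN]; case/and5P: flV => _ _ _ /forallP/(_ (inord i))/forallP/(_ (inord j)) h _.
by apply: (implyP h); rewrite !inordK // ltnS // (leq_trans ij).
Qed.

Lemma fv_perp i : (i <= N)%N -> (fv V i :=: perp (fv V (N - i)))%MS.
Proof.
move=> iN; case/and5P: flV => _ _ _ _ /forallP/(_ (inord i))/eqmxP.
rewrite /fv (_ : rev_ord (inord i) = inord (N - i)) //.
by apply: val_inj; rewrite /= !inordK ?subSS // ltnS leq_subr.
Qed.

End OneFlag.

Lemma rkC V V' i j : rk V V' i j = rk V' V j i.
Proof. by rewrite /rk capmxC. Qed.

Lemma rk_full V V' i : is_flag J V' -> rk V V' i N = \rank (fv V i).
Proof.
by move=> fl'; rewrite /rk fvN // capmx1.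
Qed.

Lemma rk0 V V' i : is_flag J V' -> rk V V' i 0 = 0%N.
Proof. by move=> fl'; rewrite /rk fv0 // capmx0 mxrank0. Qed.

Lemma rank_adds_cap m1 m2 m3 (P : 'M[F]_(m1, D)) (Q : 'M_(m2, D)) (R : 'M_(m3, D)) :
  (P <= Q)%MS ->
  (\rank (P + Q :&: R)%MS + \rank (P :&: R)%MS = \rank P + \rank (Q :&: R)%MS)%N.
Proof.
move=> PQ; rewrite -(mxrank_sum_cap P (Q :&: R)%MS); congr addn.
apply/eqmx_rank; rewrite !sub_capmx.
rewrite capmxSl capmxSr (submx_trans (capmxSl P R)) // capmxSl /=.
by rewrite (submx_trans (capmxSr _ _)) // capmxSr.
Qed.

(** Modularity ([rank_adds_cap]) turns the dimensions of V_i + V_(i+1) :&: V'_j into intersection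
    dimensions, so the relative position is a mixed second difference. *)
Lemma rel_posE V V' (i j : 'I_N) : is_flag J V ->
  rel_pos V V' i j = (rk V V' i.+1 j.+1)%:Z - (rk V V' i.+1 j)%:Z
                     - (rk V V' i j.+1)%:Z + (rk V V' i j)%:Z.
Proof.
move=> fl; rewrite !mxE.
have PQ : (fv V i <= fv V i.+1)%MS by apply: fvS => //; rewrite leqnSn /=.
have := rank_adds_cap (fv V' j.+1) PQ; have := rank_adds_cap (fv V' j) PQ.
rewrite /rk /fv; lia.
Qed.

Definition psum (A : 'M[int]_N) (i j : nat) : int :=
  \sum_(0 <= a < i) \sum_(0 <= b < j) A (inord a) (inord b).

Lemma psum_rel_pos V V' i j : is_flag J V -> is_flag J V' -> (i <= N)%N -> (j <= N)%N ->
  psum (rel_pos V V') i j = (rk V V' i j)%:Z.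
Proof.
move=> fl fl' iN jN; rewrite /psum.
have rowE a : (a < N)%N -> \sum_(0 <= b < j) rel_pos V V' (inord a) (inord b)
    = (rk V V' a.+1 j)%:Z - (rk V V' a j)%:Z.
  move=> aN; elim: j jN => [|j IH] jN.
    by rewrite big_geq // !rk0 // subrr.
  rewrite big_nat_recr //= IH; last exact: ltnW.
  rewrite rel_posE //.
  rewrite (inordK aN) (inordK jN).
  ring.
elim: i iN => [|i IH] iN; first by rewrite big_geq // rkC rk0.
rewrite big_nat_recr //= IH; last exact: ltnW.
by rewrite rowE //; ring.
Qed.

Hypothesis Jsym : J \is symmetricmx.
Hypothesis Junit : J \in unitmx.

Lemma rank_fv_perp V i : is_flag J V -> (i <= N)%N -> (\rank (fv V i) + \rank (fv V (N - i)) = D)%N.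
Proof. by move=> flV iN; rewrite fv_perp // mxrank_perp // subnK // rank_leq_col. Qed.

(** The intersection of V_(N-i) and V'_(N-j) is the orthogonal complement of V_i + V'_j. *)
Lemma rkN V V' i j : is_flag J V -> is_flag J V' -> (i <= N)%N -> (j <= N)%N ->
  (rk V V' (N - i) (N - j) + \rank (fv V i) + \rank (fv V' j) = D + rk V V' i j)%N.
Proof.
move=> fl fl' iN jN; rewrite /rk.
have -> : \rank (fv V (N - i) :&: fv V' (N - j))%MS = (D - \rank (fv V i + fv V' j)%MS)%N.
  rewrite -(mxrank_perp_cap Jsym Junit); apply/eqmx_rank/eqmxP; apply: cap_eqmx.
    by apply: eqmx_trans (fv_perp fl _) _; rewrite ?leq_subr // subKn.
  by apply: eqmx_trans (fv_perp fl' _) _; rewrite ?leq_subr // subKn.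
have := mxrank_sum_cap (fv V i) (fv V' j).
have := rank_leq_col (fv V i + fv V' j)%MS; lia.
Qed.

(** Changing step h forces the change at step N - h; as N is odd, the two indices are distinct. *)
Definition modflag V h (X : 'M[F]_D) : mxflag n d F :=
  mkflag (fun i => if i == h then X else if i == (N - h)%N then perp X else fv V i).

Lemma fv_modflag V h X i : is_flag J V -> (i <= N)%N -> i != h -> i != (N - h)%N ->
  fv (modflag V h X) i = fv V i.
Proof.
by move=> fl iN ih iNh; rewrite fv_mkflag // (negbTE ih) (negbTE iNh) fv_gen.
Qed.

Lemma fv_modflag_self V h X : (h <= N)%N -> (fv (modflag V h X) h = <<X>>)%MS.
Proof. by move=> hN; rewrite fv_mkflag // eqxx. Qed.

(** The inclusions involving [perp X] are dual to those involving X. The last two premises compare X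
    with [perp X], in the order in which the two occur in the flag. *)
Lemma is_flag_modflag V h X : is_flag J V -> (0 < h < N)%N ->
    (forall i, (i < h)%N -> i != (N - h)%N -> (fv V i <= X)%MS) ->
    (forall j, (h < j <= N)%N -> j != (N - h)%N -> (X <= fv V j)%MS) ->
    ((h < N - h)%N -> (X <= perp X)%MS) -> ((N - h < h)%N -> (perp X <= X)%MS) ->
  is_flag J (modflag V h X).
Proof.
move=> fl /andP[h0 hN] lowX uppX iso coiso.
have hN' := ltnW hN.
have lowP i : (i < N - h)%N -> i != h -> (fv V i <= perp X)%MS.
  move=> iNh ih; rewrite sub_perpC //.
  have -> : (perp (fv V i) :=: fv V (N - i))%MS.
    apply: eqmx_sym; apply: eqmx_trans (fv_perp fl _) _; rewrite ?leq_subr //.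
    by rewrite subKn //; lia.
  by apply: uppX; lia.
have uppP j : (N - h < j <= N)%N -> j != h -> (perp X <= fv V j)%MS.
  move=> jN jh; rewrite fv_perp //; last by lia.
  by apply: perpS => //; apply: lowX; lia.
apply/and5P; split.
- by apply/forallP=> i; rewrite ffunE genmx_id.
- rewrite ffunE /= ifN; last by lia.
  by rewrite ifN ?fv0 ?genmx0 //; lia.
- rewrite ffunE /= ifN; last by lia.
  by rewrite ifN ?fvN ?genmx1 //; lia.
- apply/forallP=> i; apply/forallP=> j; apply/implyP=> ij.
  have jN : (j <= N)%N by rewrite -ltnS.
  rewrite !ffunE !genmxE.
  case: (eqVneq (i : nat) h) => [ih|ih]; case: (eqVneq (j : nat) h) => [jh|jh] //.
  + case: (eqVneq (j : nat) (N - h)%N) => [jNh|jNh]; first by apply: iso; lia.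
    by apply: uppX => //; lia.
  + case: (eqVneq (i : nat) (N - h)%N) => [iNh|iNh]; first by apply: coiso; lia.
    by apply: lowX => //; lia.
  + case: (eqVneq (i : nat) (N - h)%N) => [iNh|iNh];
      case: (eqVneq (j : nat) (N - h)%N) => [jNh|jNh] //.
    * by apply: uppP => //; lia.
    * by apply: lowP => //; lia.
    * by apply: fvS => //; rewrite ij.
apply/forallP=> i; rewrite !ffunE; apply/eqmxP.
have iN : (i <= N)%N by rewrite -ltnS.
have e : rev_ord i = (N - i)%N :> nat by rewrite /= subSS.
apply: (eqmx_trans (genmxE _)); apply: eqmx_sym.
apply: (eqmx_trans (perp_eqmx Jsym Junit (genmxE _))); rewrite e.
case: (eqVneq (i : nat) h) => [ih|ih].
  rewrite ih eqxx ifN; last by lia.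
  exact: perpK.
case: (eqVneq (i : nat) (N - h)%N) => [iNh|iNh].
  by rewrite iNh subKn // eqxx.
rewrite !ifN; try lia.
by apply: eqmx_sym; apply: fv_perp.
Qed.

(** If intersections with step h gain a dimension exactly from k + 1 on, taking second differences
    moves one unit of column k from row h to row h - 1, and its mirror image likewise. *)
Lemma rel_pos_modF V V' V2 h k :
    is_flag J V -> is_flag J V' -> is_flag J V2 -> (0 < h < N)%N -> (k < N)%N ->
    (forall i, (i <= N)%N -> i != h -> i != (N - h)%N -> fv V' i = fv V i) ->
    (forall j, (j <= N)%N -> rk V' V2 h j = rk V V2 h j + (k < j))%N ->
  rel_pos V' V2 = rel_pos V V2 - dth n h k + dth n h.-1 k.
Proof.
move=> fl fl' fl2 hN kN eqV rkh.
have rkall i j : (i <= N)%N -> (j <= N)%N -> (rk V' V2 i j)%:Z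
    = (rk V V2 i j)%:Z + (i == h)%:Z * (k < j)%N%:Z
      - (i == N - h)%N%:Z * (N - j <= k)%N%:Z.
  move=> iN jN; case: (eqVneq i h) => [->|ih].
    rewrite rkh //; have -> : (h == (N - h)%N) = false by lia.
    by rewrite PoszD mul1r mul0r subr0.
  case: (eqVneq i (N - h)%N) => [->|iNh]; last by rewrite /rk eqV //; lia.
  have hN' : (h <= N)%N by lia.
  have jN' : (N - j <= N)%N by lia.
  have := rkN fl fl2 hN' jN'; have := rkN fl' fl2 hN' jN'.
  rewrite subKn // rkh // -(rk_full V' h fl2) rkh // rk_full //.
  by case: leqP => ?; lia.
case/andP: hN => h0 hN.
apply/matrixP=> i j.
have addE (A B C : 'M[int]_N) : (A - B + C) i j = A i j - B i j + C i j by rewrite !mxE.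
rewrite addE.
have iN := ltn_ord i; have jN := ltn_ord j.
have hpN : (h.-1 < N)%N by apply: leq_ltn_trans (leq_pred h) hN.
rewrite !dthE // !rel_posE //.
rewrite !rkall //; try exact: ltnW.
rewrite {rkall rkh eqV}.
have -> : (k < j.+1)%N%:Z = (k < j)%N%:Z + ((j : nat) == k)%:Z.
  by rewrite ltnS leq_eqVlt eq_sym; case: ltngtP.
have -> : (N - j.+1 <= k)%N%:Z = (N - j <= k)%N%:Z + ((j : nat) == n.*2 - k)%N%:Z.
  by clear -jN kN; lia.
have -> : (i.+1 == h) = ((i : nat) == h.-1) by case: (h) h0.
have -> : (i.+1 == N - h)%N = ((i : nat) == n.*2 - h)%N by rewrite subSn.
have -> : ((i : nat) == N - h)%N = ((i : nat) == n.*2 - h.-1)%N.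
  by case: (h) h0 => // h' _; rewrite subSS.
have andZ (b c : bool) : (b && c)%:Z = b%:Z * c%:Z by case: b; case: c.
rewrite !andZ; ring.
Qed.

End FlagGeometry.

(** * Where an added line enters a second flag *)

Section Jumps.

Variables (n d : nat) (F : finFieldType) (J : 'M[F]_(d.*2.+1)).

Local Notation N := (n.*2.+1).
Local Notation D := (d.*2.+1).
Local Notation perp := (orthomx idfun J).
Implicit Types V : mxflag n d F.

(** By modularity P + W :&: R equals W :&: (P + R), which lies between P and its cover W and hence
    is one of the two. *)
Lemma mxrank_cap_cover m1 m2 m3 (P : 'M[F]_(m1, D)) (W : 'M_(m2, D)) (R : 'M_(m3, D)) :
  (P <= W)%MS -> \rank W = (\rank P).+1 ->
  (\rank (W :&: R) = \rank (P :&: R) + (W <= P + R)%MS)%N.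
Proof.
move=> PW rW; have := rank_adds_cap R PW.
have e : (P + W :&: R :=: W :&: (P + R))%MS.
  rewrite (capmxC W R); apply: eqmx_trans (matrix_modl R PW) _.
  by rewrite capmxC.
rewrite e; case: (boolP (W <= P + R)%MS) => [WPR|WPR].
  have -> : \rank (W :&: (P + R))%MS = \rank W by apply/eqmx_rank/eqmxP/capmx_idPl.
  by rewrite rW; lia.
have ltr : (\rank (W :&: (P + R)) < \rank W)%N.
  by apply: rank_ltmx; rewrite ltmxE capmxSl sub_capmx submx_refl.
have ler : (\rank P <= \rank (W :&: (P + R)))%N.
  by apply: mxrankS; rewrite sub_capmx PW addsmxSl.
rewrite rW in ltr; lia.
Qed.

(** This locates the step at which the line W / P enters the image of the flag V modulo P; it exists
    and is unique when W is not inside P ([sum_jump]). *)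
Definition jump m1 m2 (P : 'M[F]_(m1, D)) (W : 'M_(m2, D)) V (k : nat) : bool :=
  (W <= P + fv V k.+1)%MS && ~~ (W <= P + fv V k)%MS.

Lemma jumpE m1 m2 (P : 'M[F]_(m1, D)) (W : 'M_(m2, D)) V k j :
    is_flag J V -> (k < N)%N -> (j <= N)%N -> jump P W V k ->
  (W <= P + fv V j)%MS = (k < j)%N.
Proof.
move=> fl kN jN /andP[W1 W0]; case: (ltnP k j) => kj.
  by apply: submx_trans W1 _; apply: addsmxS => //; apply: (fvS fl); rewrite kj.
apply: contraNF W0 => /submx_trans; apply; apply: addsmxS => //.
by apply: (fvS fl); rewrite kj ltnW.
Qed.

Lemma ex_jump m1 m2 (P : 'M[F]_(m1, D)) (W : 'M_(m2, D)) V :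
    is_flag J V -> ~~ (W <= P)%MS -> exists2 k, (k < N)%N & jump P W V k.
Proof.
move=> fl WP.
have ex : exists j, (j <= N)%N && (W <= P + fv V j)%MS.
  exists N; rewrite leqnn (fvN fl) (submx_trans _ (addsmxSr _ _)) //.
  exact: submx1.
case: (ex_minnP ex) => -[|k] /andP[kN Wk] kmin.
  by case/negP: WP; move: Wk; rewrite (fv0 fl) addsmx0.
exists k => //; rewrite /jump Wk /=; apply/negP => Wk'.
by have := kmin k; rewrite ltnn ltnW // Wk' => /(_ isT).
Qed.

Lemma sum_jump m1 m2 (P : 'M[F]_(m1, D)) (W : 'M_(m2, D)) V :
    is_flag J V -> ~~ (W <= P)%MS -> (\sum_(k < N) jump P W V k = 1)%N.
Proof.
move=> fl WP; have [k kN jk] := ex_jump fl WP.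
rewrite (bigD1 (Ordinal kN)) //= jk big1 ?addn0 // => i ik.
case: (boolP (jump P W V i)) => // ji; case/eqP: ik; apply: val_inj => /=.
have iN := ltn_ord i.
have := jumpE fl kN (kN : (k.+1 <= N)%N) jk; rewrite (jumpE fl iN) // leqnn ltnS.
have := jumpE fl iN (iN : (i.+1 <= N)%N) ji; rewrite (jumpE fl kN) // leqnn ltnS.
by move=> h1 h2; apply/eqP; rewrite eqn_leq h1 h2.
Qed.

Definition covers (P Q : 'M[F]_D) V (k : nat) : {set 'M[F]_D} :=
  [set W : 'M[F]_D | [&& <<W>>%MS == W, (P <= W)%MS, \rank W == (\rank P).+1,
        (W <= Q)%MS & jump P W V k]].

(** With Q_j the sum of V_a and V_b :&: V2_j, the covers counted are those inside Q_(k+1) but not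
    inside Q_k. So [card_covers] applies, and the common factor q^(dim V_a) cancels. *)
Lemma card_covers_jump V V2 a b k : is_flag J V -> is_flag J V2 ->
    (a <= b <= N)%N -> (k < N)%N ->
  #|covers (fv V a) (fv V b) V2 k|%:Z * (#|F|%:Z - 1)
  = #|F|%:Z ^+ (rk V V2 b k.+1 - rk V V2 a k.+1)
    - #|F|%:Z ^+ (rk V V2 b k - rk V V2 a k).
Proof.
move=> fl fl2 ab kN; set P := fv V a; set Q := fv V b.
have PQ : (P <= Q)%MS by apply: (fvS fl).
pose Qj j := (P + Q :&: fv V2 j)%MS.
have QjE (W : 'M_D) j : (W <= Q)%MS -> (W <= Qj j)%MS = (W <= P + fv V2 j)%MS.
  move=> WQ; rewrite /Qj capmxC (matrix_modl (fv V2 j) PQ) sub_capmx WQ andbT.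
  by [].
have rQj j : \rank (Qj j) = (\rank P + (rk V V2 b j - rk V V2 a j))%N.
  have := rank_adds_cap (fv V2 j) PQ.
  have : (rk V V2 a j <= rk V V2 b j)%N by apply: mxrankS; apply: capmxS.
  by rewrite -/(Qj j) /rk -/P -/Q; lia.
have s0 : (P <= Qj k)%MS by exact: addsmxSl.
have s1 : (Qj k <= Qj k.+1)%MS.
  by apply: addsmxS => //; apply: capmxS => //; apply: (fvS fl2); rewrite leqnSn.
have := card_covers s0 s1.
have -> : [set W : 'M_D | [&& <<W>>%MS == W, (P <= W)%MS, \rank W == (\rank P).+1,
        (W <= Qj k.+1)%MS & ~~ (W <= Qj k)%MS]] = covers P Q V2 k.
  apply/setP=> W; rewrite !inE; do 3 congr (_ && _); rewrite /jump.
  case: (boolP (W <= Q)%MS) => WQ /=; first by rewrite !QjE.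
  apply/negbTE; apply: contra WQ => /andP[/submx_trans h _]; apply: h.
  by rewrite addsmx_sub PQ capmxSl.
rewrite !rQj !expnD expnS.
have q0 : (0 < #|F|)%N by rewrite (cardD1 0).
have := leq_pexp2l q0 (mxrankS s1); rewrite !rQj !expnD.
move: q0; set q := #|F|; set c := #|_|; set r := (_ ^ \rank P)%N.
set x := (_ ^ _)%N; set y := (_ ^ _)%N => q0.
have r0 : (0 < r)%N by rewrite expn_gt0 q0.
rewrite leq_pmul2l // => xy.
rewrite (_ : (q * r - r = r * (q - 1))%N); last by rewrite mulnBr muln1 mulnC.
rewrite -mulnBr mulnCA => /eqP; rewrite eqn_pmul2l // => /eqP.
move/(congr1 Posz); rewrite PoszM -!subzn // => ->.
by rewrite -!natz !natrX.
Qed.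

Lemma sum_row_rel_pos V V' (i : 'I_N) : is_flag J V -> is_flag J V' ->
  \sum_j rel_pos V V' i j = (\rank (fv V i.+1))%:Z - (\rank (fv V i))%:Z.
Proof.
move=> fl fl'; rewrite -(rk_full V i fl') -(rk_full V i.+1 fl').
pose f j := (rk V V' i.+1 j)%:Z - (rk V V' i j)%:Z.
transitivity (\sum_(0 <= j < N) (f j.+1 - f j)).
  by rewrite big_mkord; apply: eq_bigr => j _; rewrite (rel_posE V' i j fl) /f; ring.
by rewrite telescope_sumr // /f !(rk0 _ _ fl') subrr subr0.
Qed.

Lemma rel_posC V V' : is_flag J V -> is_flag J V' -> rel_pos V' V = (rel_pos V V')^T.
Proof.
move=> fl fl'; apply/matrixP=> i j.
rewrite [RHS]mxE (rel_posE V i j fl') (rel_posE V' j i fl) !(rkC V' V); ring.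
Qed.

Lemma sum_col_rel_pos V V' (j : 'I_N) : is_flag J V -> is_flag J V' ->
  \sum_i rel_pos V V' i j = (\rank (fv V' j.+1))%:Z - (\rank (fv V' j))%:Z.
Proof.
move=> fl fl'; rewrite -(sum_row_rel_pos j fl' fl) (rel_posC fl fl').
by apply: eq_bigr => i _; rewrite [RHS]mxE.
Qed.

Lemma rel_pos_self V (i j : 'I_N) : is_flag J V -> i != j -> rel_pos V V i j = 0.
Proof.
move=> fl ij; rewrite (rel_posE V i j fl).
have rkE a b : (a <= N)%N -> (b <= N)%N -> rk V V a b = \rank (fv V (minn a b)).
  move=> aN bN; rewrite /rk; apply/eqmx_rank/eqmxP.
  case: (leqP a b) => ab; first by apply/capmx_idPl; apply: (fvS fl); rewrite ab.
  by apply/capmx_idPr; apply: (fvS fl); rewrite ltnW.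
have iN := ltn_ord i; have jN := ltn_ord j.
rewrite !rkE //; try exact: ltnW.
have /orP[ij'|ij'] : (i < j)%N || (j < i)%N by rewrite -neq_ltn.
  rewrite (_ : minn i.+1 j.+1 = i.+1) 1?(_ : minn i.+1 j = i.+1)
    1?(_ : minn i j.+1 = i) 1?(_ : minn i j = i); try lia.
rewrite (_ : minn i.+1 j.+1 = j.+1) 1?(_ : minn i.+1 j = j)
    1?(_ : minn i j.+1 = j.+1) 1?(_ : minn i j = j); try lia.
Qed.

(** For the modified flags it is the off-diagonal part of the position that can be computed; the
    dimensions of the steps then supply the diagonal. *)
Lemma eq_mx_row_sums (X Y : 'M[int]_N) :
  (forall i j, i != j -> X i j = Y i j) ->
  (forall i, \sum_j X i j = \sum_j Y i j) -> X = Y.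
Proof.
move=> off sums; apply/matrixP=> i j; case: (eqVneq i j) => [<-|]; last exact: off.
have := sums i; rewrite (bigD1 i) // [X in _ = X -> _](bigD1 i) //=.
rewrite (eq_bigr (Y i)); first by move/addIr.
by move=> k ki; apply: off; rewrite eq_sym.
Qed.

Hypothesis Jsym : J \is symmetricmx.
Hypothesis Junit : J \in unitmx.

(** Here the isotropic step n is exchanged for another of the same dimension: it gains a dimension
    after k and loses one after 2n - k. By duality step n + 1 changes in the same way, and the
    middle row stays put. *)
Lemma rel_pos_modT V V' V2 k :
    is_flag J V -> is_flag J V' -> is_flag J V2 -> (0 < n)%N -> (k < N)%N ->
    (forall i, (i <= N)%N -> i != n -> i != n.+1 -> fv V' i = fv V i) ->
    (forall j, (j <= N)%N ->
       rk V' V2 n j + (n.*2 - k < j) = rk V V2 n j + (k < j))%N ->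
  rel_pos V' V2 = rel_pos V V2 - dth n n.+1 k + dth n n.-1 k.
Proof.
move=> fl fl' fl2 n0 kN eqV rkn.
have rkall i j : (i <= N)%N -> (j <= N)%N -> (rk V' V2 i j)%:Z
    = (rk V V2 i j)%:Z
      + ((i == n)%:Z + (i == n.+1)%:Z) * ((k < j)%N%:Z - (n.*2 - k < j)%N%:Z).
  move=> iN jN; case: (eqVneq i n) => [->|ih].
    rewrite (_ : n == n.+1 = false) ?(_ : (n == n) = true) ?eqxx; try lia.
    by rewrite addr0 mul1r; have := rkn j jN; clear; lia.
  case: (eqVneq i n.+1) => [->|iNh]; last by rewrite /rk eqV //; lia.
  have hN' : (n <= N)%N by lia.
  have jN' : (N - j <= N)%N by lia.
  have eN : (N - n)%N = n.+1 by lia.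
  have := rkN Jsym Junit fl fl2 hN' jN'; have := rkN Jsym Junit fl' fl2 hN' jN'.
  rewrite eN subKn //.
  rewrite -(rk_full V' n fl2) -(rk_full V n fl2).
  have := rkn _ (leqnn N); have := rkn _ jN'.
  rewrite add0r mul1r; clear -jN kN; lia.
apply/matrixP=> i j.
have addE (A B C : 'M[int]_N) : (A - B + C) i j = A i j - B i j + C i j by rewrite !mxE.
rewrite addE.
have iN := ltn_ord i; have jN := ltn_ord j.
rewrite !dthE // ?(rel_posE _ i j fl') ?(rel_posE _ i j fl); try by (clear -n0; lia).
rewrite !rkall //; try exact: ltnW.
rewrite {rkall rkn eqV}.
have -> : (k < j.+1)%N%:Z = (k < j)%N%:Z + ((j : nat) == k)%:Z.
  by rewrite ltnS leq_eqVlt eq_sym; case: ltngtP.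
have -> : (n.*2 - k < j.+1)%N%:Z = (n.*2 - k < j)%N%:Z + ((j : nat) == n.*2 - k)%N%:Z.
  by rewrite ltnS leq_eqVlt eq_sym; case: ltngtP.
rewrite eqSS.
have -> : (i.+1 == n) = ((i : nat) == n.-1) by clear -n0; lia.
have -> : (n.*2 - n.+1 = n.-1)%N by clear; lia.
have -> : (n.*2 - n.-1 = n.+1)%N by clear -n0; lia.
have andZ (b c : bool) : (b && c)%:Z = b%:Z * c%:Z by case: b; case: c.
rewrite !andZ; ring.
Qed.

End Jumps.

(** * Isotropic subspaces of dimension d in dimension 2d + 1 *)

Section MaximalIsotropic.

Variables (d : nat) (F : fieldType) (J : 'M[F]_(d.*2.+1)).
Hypothesis Jsym : J \is symmetricmx.
Hypothesis Junit : J \in unitmx.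
Local Notation D := (d.*2.+1).
Local Notation perp := (orthomx idfun J).

Lemma isotropic_rank m (W : 'M[F]_(m, D)) : (W <= perp W)%MS -> (\rank W <= d)%N.
Proof. by move/mxrankS; rewrite (mxrank_perp Junit); have := rank_leq_col W; lia. Qed.

Lemma isotropic_adds m1 m2 (A : 'M[F]_(m1, D)) (B : 'M[F]_(m2, D)) :
  (A <= perp A)%MS -> (B <= perp A)%MS -> (B <= perp B)%MS ->
  (A + B <= perp (A + B)%MS)%MS.
Proof.
move=> AA BA BB; rewrite (perp_adds Jsym Junit A B) sub_capmx !addsmx_sub AA BA BB.
by rewrite (sub_perpC Jsym) BA.
Qed.

Lemma maximal_isotropic m (P : 'M[F]_(m, D)) (w : 'rV[F]_D) :
  (P <= perp P)%MS -> \rank P = d -> (w <= perp P)%MS -> (w <= perp w)%MS ->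
  (w <= P)%MS.
Proof.
move=> PP rP wP ww; apply/negPn/negP => wnP.
by have := isotropic_rank (isotropic_adds PP wP ww); rewrite mxrank_adds_row // rP ltnn.
Qed.

(** Write w = p + x. Since p and x are isotropic, so is w only if twice their product vanishes,
    hence p is orthogonal to x. As x lies outside P, P + x is all of P + X; so p is orthogonal to X,
    and maximality puts it in X. *)
Lemma isotropic_split m1 m2 (P : 'M[F]_(m1, D)) (X : 'M[F]_(m2, D)) (w : 'rV[F]_D) :
    2%:R != 0 :> F ->
    (P <= perp P)%MS -> \rank P = d -> (X <= perp X)%MS -> \rank X = d ->
    \rank (P + X)%MS = d.+1 -> (w <= P + X)%MS -> (w <= perp w)%MS -> ~~ (w <= P)%MS ->
  (w <= X)%MS.
Proof.
move=> F2 PP rP XX rX rPX /sub_addsmxP[[u1 u2] /= ->].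
set p := u1 *m P; set x := u2 *m X => ww wP.
have pP : (p <= P)%MS by exact: submxMl.
have xX : (x <= X)%MS by exact: submxMl.
have xP : ~~ (x <= P)%MS by apply: contra wP => xP; rewrite addmx_sub.
have pp : (p <= perp p)%MS.
  by apply: (submx_trans pP); apply: (submx_trans PP); apply: perpS.
have xx : (x <= perp x)%MS.
  by apply: (submx_trans xX); apply: (submx_trans XX); apply: perpS.
have px : (p <= perp x)%MS.
  move: ww; have := sub_perpC Jsym p x; move: pp xx; rewrite !sub_perp.
  move=> /eqP pp /eqP xx pxx; rewrite linearD /= !mulmxDl !mulmxDr pp xx add0r addr0.
  have -> : x *m J *m p^T = p *m J *m x^T.
    have tr1 (M : 'M[F]_1) : M^T = M by apply/matrixP=> i j; rewrite mxE !ord1.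
    by rewrite -[LHS]tr1 trmx_mul [(_ *m J)^T]trmx_mul trmxK (trmx_gram Jsym) mulmxA.
  by rewrite -mulr2n -scaler_nat scaler_eq0 (negbTE F2).
have pY : (p <= perp (P + X)%MS)%MS.
  have PxY : (P + x :=: P + X)%MS.
    apply: adds_row_full => //; rewrite ?addsmxSl ?rPX ?rP //.
    by apply: (submx_trans xX); apply: addsmxSr.
  rewrite -(perp_eqmx Jsym Junit PxY) (perp_adds Jsym Junit P x) sub_capmx px andbT.
  exact: submx_trans pP PP.
apply: addmx_sub => //; apply: maximal_isotropic => //.
by apply: (submx_trans pY); apply: perpS => //; apply: addsmxSr.
Qed.

End MaximalIsotropic.

(** * Flags at one step from a given flag *)

Section Generators.

Variables (n d : nat) (F : finFieldType) (J : 'M[F]_(d.*2.+1)).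
Local Notation N := (n.*2.+1).
Local Notation D := (d.*2.+1).
Local Notation perp := (orthomx idfun J).
Implicit Types V : mxflag n d F.

Lemma psum_block0 (B : 'M[int]_N) i j : (i <= N)%N -> (j <= N)%N ->
  (forall a b : 'I_N, (a < i)%N -> (j <= b)%N -> B a b = 0) ->
  psum B i j = psum B i N.
Proof.
move=> iN jN B0; rewrite /psum; apply: eq_big_nat => a /andP[_ ai].
rewrite [RHS](big_cat_nat (n := j)) //= [X in _ + X](_ : _ = 0) ?addr0 //.
rewrite big_nat_cond big1 // => b /andP[/andP[jb bN] _]; apply: B0; rewrite inordK //.
exact: leq_trans ai iN.
Qed.

(** The entries beyond column i in the first i rows measure the part of V_i outside V'_i. The zero
    pattern of a step matrix thus translates into inclusions of flags. *)
Lemma rel_pos_block V V' i : is_flag J V -> is_flag J V' -> (i <= N)%N ->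
    (forall a b : 'I_N, (a < i)%N -> (i <= b)%N -> rel_pos V V' a b = 0) ->
  (fv V i <= fv V' i)%MS.
Proof.
move=> fl fl' iN B0; have := psum_block0 iN iN B0.
rewrite !(psum_rel_pos fl fl') // (rk_full V i fl') => -[] e.
apply: submx_trans (capmxSr (fv V i) (fv V' i)).
by rewrite -(geq_leqif (mxrank_leqif_sup (capmxSl _ _))) -/(rk V V' i i) e.
Qed.

Lemma rank_rk V V' i j : is_flag J V -> is_flag J V' -> (i <= N)%N ->
  (fv V i <= fv V' j)%MS -> rk V V' i j = \rank (fv V i).
Proof. by move=> fl fl' iN s; rewrite /rk; apply/eqmx_rank/eqmxP/capmx_idPl. Qed.

Lemma rank_rk' V V' i j : is_flag J V -> is_flag J V' -> (j <= N)%N ->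
  (fv V' j <= fv V i)%MS -> rk V V' i j = \rank (fv V' j).
Proof. by move=> fl fl' iN s; rewrite rkC rank_rk. Qed.

Lemma fv_eqmx V V' i j : is_flag J V -> is_flag J V' ->
  (fv V i <= fv V' j)%MS -> (fv V' j <= fv V i)%MS -> fv V i = fv V' j.
Proof.
move=> fl fl' s1 s2; rewrite -(fv_gen fl i) -(fv_gen fl' j).
by apply/eq_genmx/eqmxP; rewrite s1.
Qed.

Hypothesis Jsym : J \is symmetricmx.
Hypothesis Junit : J \in unitmx.

Section StepF.

Variables (V1 : mxflag n d F) (h : nat) (lam B : 'M[int]_N).
Hypotheses (fl1 : is_flag J V1) (h0 : (0 < h < N)%N) (hn : h != n) (hn1 : h != n.+1).
Hypotheses (diagl : is_diag_mx lam) (defB : B = lam + dth n h h.-1).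

Lemma stepB_off (a b : 'I_N) : a != b -> B a b = dth n h h.-1 a b.
Proof.
by move=> ab; rewrite defB mxE; have /is_diag_mxP -> := diagl; rewrite ?add0r.
Qed.

(** Off the diagonal B has only two nonzero entries. Its zero blocks give the inclusions between the
    two flags away from the critical steps. *)
Lemma stepF_struct V : is_flag J V -> rel_pos V1 V = B ->
  [/\ forall i, (i <= N)%N -> i != h -> i != (N - h)%N -> fv V i = fv V1 i,
      (fv V1 h <= fv V h)%MS, (fv V h <= fv V1 h.+1)%MS &
      \rank (fv V h) = (\rank (fv V1 h)).+1].
Proof.
move=> fl eB.
have up i : (i <= N)%N -> i != (N - h)%N -> (fv V1 i <= fv V i)%MS.
  move=> iN iNh; apply: rel_pos_block => // a b ai ib; rewrite eB.
  rewrite stepB_off; last by apply/eqP=> e; move: ai; rewrite e ltnNge ib.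
  by rewrite dthE; clear -ai ib iNh h0 hn hn1; lia.
have down i : (i <= N)%N -> i != h -> (fv V i <= fv V1 i)%MS.
  move=> iN ih; apply: rel_pos_block => // a b ai ib; rewrite (rel_posC fl1 fl) mxE eB.
  rewrite stepB_off; last by apply/eqP=> e; move: ai; rewrite -e ltnNge ib.
  by rewrite dthE; clear -ai ib ih h0 hn hn1; lia.
have same i : (i <= N)%N -> i != h -> i != (N - h)%N -> fv V i = fv V1 i.
  by move=> iN ih iNh; apply: fv_eqmx => //; [apply: down | apply: up].
case/andP: (h0) => hgt0 hN.
have s1 : (fv V1 h <= fv V h)%MS by apply: up; [exact: ltnW | clear -h0; lia].
have s2 : (fv V h <= fv V1 h.+1)%MS.
  rewrite -same; [apply: (fvS fl); rewrite leqnSn // | by [] | by clear; lia |].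
  by clear -hn; lia.
split=> //.
have hN' : (h.-1 < N)%N by apply: leq_ltn_trans (leq_pred h) hN.
(* The entry of B in row h and column h - 1 is 1; by the inclusions just found it equals the
   dimension of V_h minus that of V1_h. *)
have := rel_posE V (Ordinal hN) (Ordinal hN') fl1; rewrite eB stepB_off; last first.
  by rewrite -val_eqE /=; clear -hgt0; lia.
rewrite dthE //= !eqxx prednK //=.
have e1 : fv V h.-1 = fv V1 h.-1.
  by apply: same; [exact: ltnW | clear -hgt0; lia | clear -hn1; lia].
have -> : rk V1 V h.+1 h = \rank (fv V h) by apply: rank_rk' => //; exact: ltnW.
have -> : rk V1 V h h = \rank (fv V1 h) by apply: rank_rk => //; exact: ltnW.
rewrite /rk e1 -!/(rk V1 V1 _ _).
rewrite (rank_rk' (V := V1) (V' := V1)) //; try exact: ltnW; last first.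
  by apply: (fvS fl1); clear -hN; lia.
rewrite (rank_rk' (V := V1) (V' := V1)) //; try exact: ltnW; last first.
  by apply: (fvS fl1); clear -hN; lia.
rewrite (_ : _ && _ = false); last by clear -hn hn1 hgt0; lia.
clear; lia.
Qed.

Hypothesis rowB : forall i : 'I_N,
  \sum_j B i j = (\rank (fv V1 i.+1))%:Z - (\rank (fv V1 i))%:Z.

(* Off the diagonal, B is the transpose of the relative position of V and V1, *)
(* which rel_pos_modF computes with V2 = V1.                                  *)
Lemma stepF_modflag (W : 'M[F]_D) (V := modflag J V1 h W) : (<<W>> = W)%MS ->
    (fv V1 h <= W)%MS -> (W <= fv V1 h.+1)%MS -> \rank W = (\rank (fv V1 h)).+1 ->
  [/\ is_flag J V, fv V h = W, rel_pos V1 V = B &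
    forall i, (i <= N)%N -> i != h -> i != (N - h)%N -> fv V i = fv V1 i].
Proof.
move=> gW lowW uppW rW; case/andP: (h0) => hgt0 hN.
have fl : is_flag J V.
  apply: is_flag_modflag => //.
  - move=> i ih _; apply: (submx_trans _ lowW); apply: (fvS fl1).
    by clear -ih hN; lia.
  - move=> j /andP[hj jN] _; apply: (submx_trans uppW); apply: (fvS fl1).
    by rewrite hj.
  - move=> hNh; apply: (submx_trans uppW).
    rewrite (fv_perp fl1) //; apply: perpS => //; apply: (submx_trans uppW).
    by apply: (fvS fl1); clear -hNh hn hN; lia.
  - move=> hNh; apply: (submx_trans _ lowW).
    rewrite (fv_perp fl1); last exact: ltnW.
    apply: perpS => //; apply: (submx_trans _ lowW).
    by apply: (fvS fl1); clear -hNh hN; lia.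
have same i : (i <= N)%N -> i != h -> i != (N - h)%N -> fv V i = fv V1 i.
  by move=> iN ih iNh; apply: fv_modflag.
have Vh : fv V h = W by rewrite /V fv_modflag_self // ltnW.
split=> //.
have jW : jump (fv V1 h) W V1 h.
  rewrite /jump (submx_trans uppW (addsmxSr _ _)) /=.
  apply/negP => /mxrankS; rewrite rW.
  have /addsmx_idPr -> : (fv V1 h <= fv V1 h)%MS by [].
  by rewrite ltnn.
have rkh j : (j <= N)%N -> (rk V V1 h j = rk V1 V1 h j + (h < j))%N.
  move=> jN; rewrite /rk Vh (mxrank_cap_cover _ lowW rW).
  by rewrite (jumpE fl1 hN jN jW).
have e := rel_pos_modF Jsym Junit fl1 fl fl1 h0 hN same rkh.
apply: eq_mx_row_sums => [i j ij|i]; last first.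
  by rewrite rowB (sum_row_rel_pos i fl1 fl).
have trE (X Y Z : 'M[int]_N) : (X - Y + Z)^T i j = X j i - Y^T i j + Z^T i j.
  by rewrite !mxE.
rewrite (rel_posC fl fl1) e stepB_off // trE !tr_dth (rel_pos_self fl1) 1?eq_sym //.
by rewrite dth_diag // subrr add0r.
Qed.

(** Sort the flags V by the index k at which V_h / V1_h enters V2. This k determines the position of
    V and V2 ([rel_pos_modF]), and V is determined by V_h, which runs through the covers of V1_h
    inside V1_(h+1) with that jump. *)
Lemma card_stepF V2 (A : 'M[int]_N) : is_flag J V2 ->
  #|[set V | is_flag J V & (rel_pos V1 V == B) && (rel_pos V V2 == A)]|%:Z * (#|F|%:Z - 1)
  = \sum_(k < N) (A == rel_pos V1 V2 - dth n h k + dth n h.-1 k)%:Z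
      * (#|F|%:Z ^+ (rk V1 V2 h.+1 k.+1 - rk V1 V2 h k.+1)
         - #|F|%:Z ^+ (rk V1 V2 h.+1 k - rk V1 V2 h k)).
Proof.
move=> fl2; set S := [set V | _]; case/andP: (h0) => hgt0 hN.
have posk V k : is_flag J V -> rel_pos V1 V = B -> (k < N)%N ->
    jump (fv V1 h) (fv V h) V2 k ->
    rel_pos V V2 = rel_pos V1 V2 - dth n h k + dth n h.-1 k.
  move=> fl eB kN jk; have [same s1 s2 r] := stepF_struct fl eB.
  apply: (rel_pos_modF Jsym Junit) => // j jN.
  by rewrite /rk (mxrank_cap_cover _ s1 r) (jumpE fl2 kN jN jk).
have -> : #|S| = (\sum_(k < N) #|[set V in S | jump (fv V1 h) (fv V h) V2 k]|)%N.
  rewrite -sum1_card; under [RHS]eq_bigr do rewrite -sum1dep_card.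
  rewrite (exchange_big_dep (mem S)) /=; last by move=> k V _ /andP[].
  apply: eq_bigr => V VS; rewrite big_mkcond /=.
  rewrite (eq_bigr (fun k : 'I_N => jump (fv V1 h) (fv V h) V2 k : nat)); last first.
    by move=> k _; move: VS => /=; rewrite inE => ->; case: jump.
  symmetry; apply: (sum_jump fl2).
  move: VS; rewrite inE => /andP[fl /andP[/eqP eB _]].
  have [_ s1 _ r] := stepF_struct fl eB.
  by apply/negP => /mxrankS; rewrite r ltnn.
rewrite (big_morph Posz PoszD (erefl 0%:Z)) mulr_suml; apply: eq_bigr => k _.
have kN := ltn_ord k.
rewrite -(card_covers_jump fl1 fl2 _ kN); last by rewrite leqnSn.
rewrite mulrA; congr (_ * _); case: eqVneq => [eA|nA]; last first.
  rewrite mul0r (_ : [set V in S | _] = set0) ?cards0 //.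
  apply/setP=> V; rewrite !inE; apply/negbTE; apply: contra nA.
  by case/andP=> /andP[fl /andP[/eqP eB /eqP <-]] jk; apply/eqP/posk.
rewrite mul1r -(card_in_imset (f := fun V => fv V h)).
  congr (Posz #|pred_of_set _|); apply/setP=> W; apply/imsetP/idP.
    case=> V; rewrite !inE => /andP[/andP[fl /andP[/eqP eB _]] jk ->].
    have [_ s1 s2 r] := stepF_struct fl eB.
    by rewrite (fv_gen fl) eqxx s1 r eqxx s2.
  rewrite inE => /and5P[/eqP gW s1 /eqP r s2 jk].
  have [fl Vh eB _] := stepF_modflag gW s1 s2 r.
  exists (modflag J V1 h W) => //; rewrite !inE fl eB Vh eqxx jk andbT /= eA.
  by apply/eqP; apply: posk; rewrite ?Vh.
move=> V V'; rewrite !inE => /andP[/andP[fl /andP[/eqP eB _]] _].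
move=> /andP[/andP[fl' /andP[/eqP eB' _]] _] eh.
have [same _ _ _] := stepF_struct fl eB; have [same' _ _ _] := stepF_struct fl' eB'.
apply: mxflagP => i iN; case: (eqVneq i h) => [->|ih] //.
case: (eqVneq i (N - h)%N) => [->|iNh]; last by rewrite same // same'.
rewrite -(fv_gen fl) -(fv_gen fl'); apply/eq_genmx.
apply: (eqmx_trans (fv_perp fl (leq_subr _ _))).
apply: eqmx_sym; apply: (eqmx_trans (fv_perp fl' (leq_subr _ _))).
by rewrite subKn ?eh // ltnW.
Qed.

End StepF.

End Generators.

(** * Exchanging the maximal isotropic step *)

Section StepT.

Variables (n d : nat) (F : finFieldType) (J : 'M[F]_(d.*2.+1)).
Hypothesis F2 : 2%:R != 0 :> F.
Hypothesis Jsym : J \is symmetricmx.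
Hypothesis Junit : J \in unitmx.
Hypothesis n0 : (0 < n)%N.
Local Notation N := (n.*2.+1).
Local Notation D := (d.*2.+1).
Local Notation perp := (orthomx idfun J).
Implicit Types V : mxflag n d F.

Let subNn : (N - n)%N = n.+1. Proof. by lia. Qed.
Let subNn1 : (N - n.+1)%N = n. Proof. by lia. Qed.

Lemma fv_half V : is_flag J V -> (fv V n.+1 :=: perp (fv V n))%MS.
Proof.
have nN : (n.+1 <= N)%N by lia.
by move=> fl; apply: (eqmx_trans (fv_perp fl nN)); rewrite subNn1.
Qed.

Lemma fv_isotropic V i : is_flag J V -> (i <= n)%N -> (fv V i <= perp (fv V i))%MS.
Proof.
move=> fl i_n; have sN : (fv V i <= fv V (N - i))%MS by apply: (fvS fl); lia.
apply: (submx_trans sN); rewrite (fv_perp fl (leq_subr _ _)) subKn //; lia.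
Qed.

(** A vector of V_(n+1) lying in V2_j with j <= n is isotropic and orthogonal to V_n, so it lies in
    V_n by maximality. *)
Lemma rk_half_low V V2 j : is_flag J V -> is_flag J V2 -> \rank (fv V n) = d ->
  (j <= n)%N -> rk V V2 n.+1 j = rk V V2 n j.
Proof.
move=> fl fl2 rV jn; apply/eqP; rewrite eqn_leq; apply/andP; split; last first.
  by apply: mxrankS; apply: capmxS => //; apply: (fvS fl); lia.
apply: mxrankS; apply/rV_subP => w; rewrite !sub_capmx => /andP[w1 w2].
rewrite w2 andbT; apply: (maximal_isotropic Jsym Junit (fv_isotropic fl (leqnn n)) rV).
  by rewrite -(fv_half fl).
apply: (submx_trans w2); apply: (submx_trans (fv_isotropic fl2 jn)).
exact: perpS.
Qed.

Lemma rk_half_dual V V2 j : is_flag J V -> is_flag J V2 -> \rank (fv V n) = d ->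
  (j <= n)%N -> (rk V V2 n j + \rank (fv V2 (N - j)) = d.+1 + rk V V2 n (N - j))%N.
Proof.
move=> fl fl2 rV jn; rewrite -(rk_half_low fl fl2 rV jn).
have nN : (n <= N)%N by lia.
have := rkN Jsym Junit fl fl2 nN (leq_subr j N).
rewrite subNn rV subKn; [clear; lia | clear -jn; lia].
Qed.

(** The hypothesis says that the interval of the j with k2 < j <= k is symmetric under j -> N - j,
    so its end points satisfy k2 + 1 + k = N. *)
Lemma reflected_steps k k2 : (k2 < k)%N -> (k < N)%N ->
    (forall j, (j <= n)%N -> (k2 < j) + (k < N - j) = (k2 < N - j) + (k < j))%N ->
  (k + k2 = n.*2)%N.
Proof.
move=> k2k kN h; case: (ltnP k2 n) => k2n.
  have := h k2.+1 k2n; case: (leqP k n) => kn; first by clear -k2k kn k2n; lia.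
  have jn : (N - k <= n)%N by clear -kn kN; lia.
  by have := h _ jn; rewrite subKn ?(ltnW kN) //; clear -k2k kn k2n kN; lia.
have jn : (N - k <= n)%N by clear -k2k k2n kN; lia.
by have := h _ jn; rewrite subKn ?(ltnW kN) //; clear -k2k k2n kN; lia.
Qed.

Section TwoHalves.

Variables V1 V V2 : mxflag n d F.
Hypotheses (fl1 : is_flag J V1) (fl : is_flag J V) (fl2 : is_flag J V2).
Hypotheses (r1 : \rank (fv V1 n) = d) (r : \rank (fv V n) = d).
Local Notation P := (fv V1 n).
Local Notation X := (fv V n).
Local Notation Y := (P + X)%MS.
Hypothesis rY : \rank Y = d.+1.

Let PP : (P <= perp P)%MS. Proof. exact: fv_isotropic. Qed.
Let XX : (X <= perp X)%MS. Proof. exact: fv_isotropic. Qed.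
Let rYP : \rank Y = (\rank P).+1. Proof. by rewrite rY r1. Qed.
Let rYX : \rank Y = (\rank X).+1. Proof. by rewrite rY r. Qed.

(** If both jumps occurred at k < n, then Y :&: V2_n would contain a vector w outside P and a vector
    w' outside X. By [isotropic_split] w is in X and w' in P. Both lie in the isotropic V2_n, so w'
    is orthogonal to P + w = Y, and maximality puts it in X, a contradiction. *)
Lemma jump_dual_lt k : (k < n)%N -> jump P Y V2 k -> jump X Y V2 k -> False.
Proof.
move=> kn jP jX; have kN : (k < N)%N by clear -kn; lia.
have nN : (n <= N)%N by clear; lia.
have ex (Z : 'M[F]_D) : (Z <= Y)%MS -> \rank Y = (\rank Z).+1 -> jump Z Y V2 k ->
    exists2 w : 'rV_D, (w <= Y :&: fv V2 n)%MS & ~~ (w <= Z)%MS.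
  move=> ZY rZ jZ; have e := mxrank_cap_cover (fv V2 n) ZY rZ.
  rewrite (jumpE fl2 kN nN jZ) kn in e.
  have : ~~ (Y :&: fv V2 n <= Z)%MS.
    apply/negP => s; suff : (\rank (Y :&: fv V2 n) <= \rank (Z :&: fv V2 n))%N.
      by rewrite e addn1 ltnn.
    by apply: mxrankS; rewrite sub_capmx s capmxSr.
  by move/ex_row_diff.
have [w wYR wP] := ex P (addsmxSl _ _) rYP jP.
have [w' wYR' wX] := ex X (addsmxSr _ _) rYX jX.
move: wYR wYR'; rewrite !sub_capmx => /andP[wY wR] /andP[wY' wR'].
have RR (u1 u2 : 'rV_D) : (u1 <= fv V2 n)%MS -> (u2 <= fv V2 n)%MS -> (u1 <= perp u2)%MS.
  move=> h1 h2; apply: (submx_trans h1).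
  by apply: (submx_trans (fv_isotropic fl2 (leqnn n))); apply: perpS.
have wXin : (w <= X)%MS.
  by apply: (isotropic_split Jsym Junit F2 PP r1 XX r rY) => //; apply: RR.
have wPin : (w' <= P)%MS.
  apply: (isotropic_split Jsym Junit F2 XX r PP r1); rewrite 1?addsmxC //.
  exact: RR.
case/negP: wX; apply: (maximal_isotropic Jsym Junit XX r); last exact: RR.
have PwY : (P + w :=: Y)%MS by apply: adds_row_full => //; rewrite addsmxSl.
have : (w' <= perp (P + w)%MS)%MS.
  rewrite (perp_adds Jsym Junit P w) sub_capmx RR // andbT.
  exact: (submx_trans wPin).
rewrite (perp_eqmx Jsym Junit PwY) => /submx_trans; apply.
by apply: perpS => //; apply: addsmxSr.
Qed.

(** If both jumps occurred at k > n, then P :&: V2_n would also lie in X, hence be orthogonal to Y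
    and to V2_(n+1). By [rk_half_dual] its dimension exceeds that of the complement of Y + V2_(n+1)
    by one. *)
Lemma jump_dual_gt k : (k < N)%N -> (n < k)%N -> jump P Y V2 k -> jump X Y V2 k -> False.
Proof.
move=> kN nk jP jX; have nN : (n.+1 <= N)%N by clear; lia.
have sub (Z : 'M[F]_D) : (Z <= Y)%MS -> \rank Y = (\rank Z).+1 -> jump Z Y V2 k ->
    \rank (Y :&: fv V2 n.+1)%MS = \rank (Z :&: fv V2 n.+1)%MS
    /\ (Y :&: fv V2 n.+1 <= Z)%MS.
  move=> ZY rZ jZ; have := mxrank_cap_cover (fv V2 n.+1) ZY rZ.
  rewrite (jumpE fl2 kN nN jZ) ltnS leqNgt nk /= addn0 => e; split=> //.
  have s : (Z :&: fv V2 n.+1 <= Y :&: fv V2 n.+1)%MS by apply: capmxS.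
  apply: (submx_trans _ (capmxSl Z (fv V2 n.+1))).
  by rewrite -(geq_leqif (mxrank_leqif_sup s)) e.
have [eP _] := sub P (addsmxSl _ _) rYP jP.
have [_ sX] := sub X (addsmxSr _ _) rYX jX.
have a := rk_half_dual fl1 fl2 r1 (leqnn n); rewrite subNn in a.
have s : (P :&: fv V2 n <= perp Y :&: perp (fv V2 n.+1))%MS.
  apply/rV_subP=> w; rewrite !sub_capmx => /andP[wP wR].
  have wX : (w <= X)%MS.
    apply: submx_trans sX; rewrite sub_capmx (submx_trans wP (addsmxSl _ _)) /=.
    by apply: (submx_trans wR); apply: (fvS fl2); rewrite leqnSn.
  apply/andP; split.
    rewrite (perp_adds Jsym Junit P X) sub_capmx.
    by rewrite (submx_trans wP PP) (submx_trans wX XX).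
  have nN' : (n <= N)%N by clear; lia.
  by apply: (submx_trans wR); rewrite (fv_perp fl2 nN') subNn.
have := mxrankS s; rewrite (mxrank_perp_cap Jsym Junit).
have := mxrank_sum_cap Y (fv V2 n.+1); rewrite eP rY -/(rk V1 V2 n n.+1) -/(rk V1 V2 n n).
have := rank_leq_col (Y + fv V2 n.+1)%MS.
move: a; clear; lia.
Qed.

(* In the hyperbolic plane Y / (P :&: X) the lines of P and of X are the only *)
(* isotropic ones, and the flag induced by V2 is self-dual.                   *)
Lemma jump_dual k k2 : (k < N)%N -> (k2 < N)%N -> jump P Y V2 k -> jump X Y V2 k2 ->
  (k + k2 = n.*2)%N.
Proof.
move=> kN k2N jP jX.
have ya j : (j <= N)%N -> (rk V1 V2 n j + (k < j) = rk V V2 n j + (k2 < j))%N.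
  move=> jN; have := mxrank_cap_cover (fv V2 j) (addsmxSl P X) rYP.
  rewrite (mxrank_cap_cover (fv V2 j) (addsmxSr P X) rYX).
  by rewrite (jumpE fl2 kN jN jP) (jumpE fl2 k2N jN jX).
have steps j : (j <= n)%N ->
    ((k2 < j) + (k < N - j) = (k2 < N - j) + (k < j))%N.
  move=> jn; have jN : (j <= N)%N by clear -jn; lia.
  have := ya _ jN; have := ya _ (leq_subr j N).
  have := rk_half_dual fl1 fl2 r1 jn; have := rk_half_dual fl fl2 r jn.
  clear; lia.
case: (ltngtP k k2) => kk.
- rewrite addnC; apply: reflected_steps => // j jn.
  by have := steps j jn; clear; lia.
- exact: reflected_steps.
- subst k2; case: (ltngtP k n) => kn.
  + by case: (jump_dual_lt kn jP jX).
  + by case: (jump_dual_gt kN kn jP jX).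
  + by rewrite kn addnn.
Qed.

Lemma rk_swap_half k j : (k < N)%N -> jump P Y V2 k -> (j <= N)%N ->
  (rk V V2 n j + (n.*2 - k < j) = rk V1 V2 n j + (k < j))%N.
Proof.
move=> kN jP jN.
have YX : ~~ (Y <= X)%MS by apply/negP => /mxrankS; rewrite rY r ltnn.
have [k2 k2N jX] := ex_jump fl2 YX.
have <- : k2 = (n.*2 - k)%N by have := jump_dual kN k2N jP jX; clear; lia.
have := mxrank_cap_cover (fv V2 j) (addsmxSl P X) rYP.
rewrite (mxrank_cap_cover (fv V2 j) (addsmxSr P X) rYX).
by rewrite (jumpE fl2 kN jN jP) (jumpE fl2 k2N jN jX).
Qed.

End TwoHalves.

Variables (V1 : mxflag n d F) (lam B : 'M[int]_N).
Hypotheses (fl1 : is_flag J V1) (r1 : \rank (fv V1 n) = d).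
Hypotheses (diagl : is_diag_mx lam) (defB : B = lam + dth n n.+1 n.-1).

Let n1N : (n.+1 < N)%N. Proof. by clear -n0; lia. Qed.
Let nm1N : (n.-1 < N)%N. Proof. by clear -n0; lia. Qed.
Let n2N : (n.+2 <= N)%N. Proof. by clear -n0; lia. Qed.
Let nN : (n <= N)%N. Proof. by clear; lia. Qed.

Lemma stepT_off (a b : 'I_N) : a != b -> B a b = dth n n.+1 n.-1 a b.
Proof.
by move=> ab; rewrite defB mxE; have /is_diag_mxP -> := diagl; rewrite ?add0r.
Qed.

(** The flags agree except at n and n + 1, and V_n is another maximal isotropic subspace meeting
    V1_n in a hyperplane. Their sum is not contained in V1_(n+1), since it would then be isotropic
    of dimension d + 1. *)
Lemma stepT_struct V : is_flag J V -> rel_pos V1 V = B ->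
  [/\ forall i, (i <= N)%N -> i != n -> i != n.+1 -> fv V i = fv V1 i,
      \rank (fv V n) = d, \rank (fv V1 n + fv V n)%MS = d.+1,
      (fv V1 n + fv V n <= fv V1 n.+2)%MS & ~~ (fv V1 n + fv V n <= fv V1 n.+1)%MS].
Proof.
move=> fl eB.
have up i : (i <= N)%N -> i != n -> i != n.+1 -> (fv V1 i <= fv V i)%MS.
  move=> iN ih iNh; apply: (rel_pos_block fl1 fl iN) => a b ai ib; rewrite eB.
  rewrite stepT_off; last by apply/eqP=> e; move: ai; rewrite e ltnNge ib.
  by rewrite dthE //; clear -ai ib ih iNh n0; lia.
have down i : (i <= N)%N -> i != n -> i != n.+1 -> (fv V i <= fv V1 i)%MS.
  move=> iN ih iNh; apply: (rel_pos_block fl fl1 iN) => a b ai ib; rewrite (rel_posC fl1 fl) mxE eB.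
  rewrite stepT_off; last by apply/eqP=> e; move: ai; rewrite -e ltnNge ib.
  by rewrite dthE //; clear -ai ib ih iNh n0; lia.
have same i : (i <= N)%N -> i != n -> i != n.+1 -> fv V i = fv V1 i.
  by move=> iN ih iNh; apply: (fv_eqmx fl fl1); [apply: down | apply: up].
have n2E : fv V n.+2 = fv V1 n.+2 by apply: same => //; clear; lia.
have nm1E : fv V n.-1 = fv V1 n.-1.
  by apply: same; [exact: ltnW | clear -n0; lia | clear; lia].
have sub (U : mxflag n d F) i j : is_flag J U -> (i <= j <= N)%N -> (fv U i <= fv U j)%MS.
  by move=> flU; exact: (fvS flU).
have s2 : (fv V n <= fv V1 n.+2)%MS 
  by rewrite -n2E; apply: sub => //; rewrite n2N andbT; clear; lia.
have oN : (n < N)%N by clear; lia.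
(* These four entries around the middle are 1, 0, 1, 0; together they give dim V_n = d and dim (V1_n
   :&: V_n) = d - 1. *)
have e1 := rel_posE V (Ordinal n1N) (Ordinal nm1N) fl1.
have e2 := rel_posE V (Ordinal oN) (Ordinal nm1N) fl1.
have e3 := rel_posE V (Ordinal nm1N) (Ordinal n1N) fl1.
have e4 := rel_posE V (Ordinal nm1N) (Ordinal oN) fl1.
rewrite eB stepT_off ?dthE //= ?prednK // in e1; last by rewrite -val_eqE /=; clear; lia.
rewrite eB stepT_off ?dthE //= ?prednK // in e2; last by rewrite -val_eqE /=; clear -n0; lia.
rewrite eB stepT_off ?dthE //= ?prednK // in e3; last by rewrite -val_eqE /=; clear; lia.
rewrite eB stepT_off ?dthE //= ?prednK // in e4; last by rewrite -val_eqE /=; clear -n0; lia.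
have low i : (n.-1 <= i <= N)%N -> rk V1 V n.-1 i = \rank (fv V1 n.-1).
  move=> iN; apply: (rank_rk fl1 fl (ltnW nm1N)).
  by rewrite -nm1E; apply: sub.
have low' i : (n.-1 <= i <= N)%N -> rk V1 V i n.-1 = \rank (fv V n.-1).
  move=> iN; apply: (rank_rk' fl1 fl (ltnW nm1N)).
  by rewrite nm1E; apply: sub.
have f1 : rk V1 V n.+2 n = \rank (fv V n) by apply: (rank_rk' fl1 fl).
have f2 : rk V1 V n n.+2 = d.
  rewrite (rank_rk fl1 fl) // n2E; apply: sub => //; rewrite n2N andbT; clear; lia.
rewrite !low' ?f1 in e1 e2; try by (clear -n0; lia).
rewrite !low ?f2 in e3 e4; try by (clear -n0; lia).
have rV : \rank (fv V n) = d by move: e1 e2 e3 e4; clear -n0; lia.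
have rY : \rank (fv V1 n + fv V n)%MS = d.+1.
  have := mxrank_sum_cap (fv V1 n) (fv V n); rewrite -/(rk V1 V n n) r1 rV.
  by move: e1 e2 e3 e4; clear -n0; lia.
split=> //.
  rewrite addsmx_sub s2 andbT; apply: sub => //; rewrite n2N andbT; clear; lia.
apply/negP; rewrite addsmx_sub => /andP[_]; rewrite (fv_half fl1) => VP.
have := isotropic_adds Jsym Junit (fv_isotropic fl1 (leqnn n)) VP (fv_isotropic fl (leqnn n)).
by move/(isotropic_rank Jsym Junit); rewrite rY ltnn.
Qed.

(** With Y the common sum, a vector of V_n is isotropic in Y. Outside V1_n it lies in V'_n by
    [isotropic_split]; inside V1_n it is orthogonal to Y, and maximality of V'_n applies. *)
Lemma stepT_inj V V' : is_flag J V -> is_flag J V' -> rel_pos V1 V = B -> rel_pos V1 V' = B ->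
  (fv V1 n + fv V n :=: fv V1 n + fv V' n)%MS -> V = V'.
Proof.
move=> fl fl' eB eB' eY.
have [same r rY _ _] := stepT_struct fl eB; have [same' r' rY' _ _] := stepT_struct fl' eB'.
have key (U U' : mxflag n d F) : is_flag J U -> is_flag J U' -> \rank (fv U n) = d ->
    \rank (fv U' n) = d -> \rank (fv V1 n + fv U' n)%MS = d.+1 ->
    (fv V1 n + fv U n :=: fv V1 n + fv U' n)%MS -> (fv U n <= fv U' n)%MS.
  move=> flU flU' rU rU' rYU e; apply/rV_subP => w wU.
  have ww : (w <= perp w)%MS.
    apply: (submx_trans wU); apply: (submx_trans (fv_isotropic flU (leqnn n))).
    exact: perpS.
  have wY : (w <= fv V1 n + fv U n)%MS by apply: (submx_trans wU); apply: addsmxSr.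
  case: (boolP (w <= fv V1 n)%MS) => wP; last first.
    have PP := fv_isotropic fl1 (leqnn n); have UU := fv_isotropic flU' (leqnn n).
    by apply: (isotropic_split Jsym Junit F2 PP r1 UU rU' rYU) => //; rewrite -e.
  apply: (maximal_isotropic Jsym Junit (fv_isotropic flU' (leqnn n)) rU') => //.
  have : (w <= perp (fv V1 n + fv U n)%MS)%MS.
    rewrite (perp_adds Jsym Junit) sub_capmx.
    rewrite (submx_trans wP (fv_isotropic fl1 (leqnn n))).
    by rewrite (submx_trans wU (fv_isotropic flU (leqnn n))).
  rewrite (perp_eqmx Jsym Junit e) => /submx_trans; apply.
  by apply: perpS => //; apply: addsmxSr.
have eX : fv V n = fv V' n.
  by apply: (fv_eqmx fl fl'); apply: key => //; apply: eqmx_sym.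
apply: mxflagP => i iN; case: (eqVneq i n) => [->|ih] //.
case: (eqVneq i n.+1) => [->|iNh]; last by rewrite same // same'.
rewrite -(fv_gen fl) -(fv_gen fl'); apply/eq_genmx.
apply: (eqmx_trans (fv_half fl)); apply: eqmx_sym; apply: (eqmx_trans (fv_half fl')).
by rewrite eX.
Qed.

Hypothesis rowB : forall i : 'I_N,
  \sum_j B i j = (\rank (fv V1 i.+1))%:Z - (\rank (fv V1 i))%:Z.

(** Since Y is not orthogonal to P, a vector of Y outside P can be corrected by an element of P to
    an isotropic w, and X is spanned by w and the part of P orthogonal to w. The last clause yields
    the inclusions of the lower steps of V1 in X. *)
Lemma hyperbolic_line (Y : 'M[F]_D) : (fv V1 n <= Y)%MS -> \rank Y = d.+1 ->
    ~~ (Y <= fv V1 n.+1)%MS ->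
  exists X : 'M[F]_D, [/\ (X <= perp X)%MS, \rank X = d, (fv V1 n + X :=: Y)%MS
    & (forall m (U : 'M_(m, D)), (U <= fv V1 n)%MS -> (U <= perp Y)%MS -> (U <= X)%MS)].
Proof.
move=> PY rY Yn1; set P := fv V1 n in PY *.
have rYP : \rank Y = (\rank P).+1 by rewrite rY r1.
have [w0 w0Y w0P] : exists2 w : 'rV_D, (w <= Y)%MS & ~~ (w <= P)%MS.
  by apply: ex_row_diff; apply/negP => /mxrankS; rewrite rYP ltnn.
have eY := adds_row_full PY rYP w0Y w0P.
have w0perp : ~~ (w0 <= perp P)%MS.
  apply: contra Yn1 => w0P'; rewrite -eY addsmx_sub !(fv_half fl1) w0P' andbT.
  exact: fv_isotropic.
have [p pP pw0] : exists2 p : 'rV_D, (p <= P)%MS & p *m J *m w0^T != 0.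
  have : ~~ (P <= perp w0)%MS by rewrite (sub_perpC Jsym).
  case/row_subPn=> i; rewrite sub_perp => h; exists (row i P) => //; exact: row_sub.
pose q (a b : 'rV[F]_D) := (a *m J *m b^T) 0 0.
have qE a b : (a <= perp b)%MS = (q a b == 0).
  rewrite sub_perp /q; apply/eqP/eqP => [->|h]; first by rewrite mxE.
  by apply/matrixP=> i j; rewrite !ord1 h mxE.
have qC a b : q a b = q b a.
  rewrite /q; have tr1 (M : 'M[F]_1) : M^T = M by apply/matrixP=> i j; rewrite mxE !ord1.
  by rewrite -[in LHS](tr1 (_ *m _)) trmx_mul [(_ *m J)^T]trmx_mul trmxK (trmx_gram Jsym) mulmxA.
have qDl a b c : q (a + b) c = q a c + q b c by rewrite /q !mulmxDl mxE.
have qDr a b c : q c (a + b) = q c a + q c b by rewrite qC qDl !(qC c).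
have qZl t a b : q (t *: a) b = t * q a b by rewrite /q -!scalemxAl mxE.
have qp0 : q p w0 != 0 by rewrite -qE sub_perp.
have qpp : q p p = 0.
  apply/eqP; rewrite -qE; apply: (submx_trans pP).
  by apply: (submx_trans (fv_isotropic fl1 (leqnn n))); apply: perpS.
(* The solution of q(w0, w0) + 2 c q(p, w0) = 0, which makes w0 + c p isotropic because p is. *)
pose c := - q w0 w0 / (2%:R * q p w0); pose w := w0 + c *: p.
have qw : q w w = 0.
  rewrite /w !(qDl, qDr, qZl) (qC w0 (c *: p)) (qC p (c *: p)) !qZl qpp !mulr0 addr0.
  rewrite /c; field; rewrite qp0 ?F2 //.
have wY : (w <= Y)%MS.
  by rewrite addmx_sub // scalemx_sub // (submx_trans pP).
have wP : ~~ (w <= P)%MS.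
  apply: contra w0P => wP; rewrite -(addrK (c *: p) w0) -/w addmx_sub //.
  by rewrite eqmx_opp scalemx_sub.
have ww : (w <= perp w)%MS by rewrite qE qw.
have PP := fv_isotropic fl1 (leqnn n); rewrite -/P in PP.
pose X := (P :&: perp w + w)%MS.
have XX : (X <= perp X)%MS.
  apply: isotropic_adds => //.
    apply: (submx_trans (capmxSl _ _)); apply: (submx_trans PP).
    by apply: perpS => //; exact: capmxSl.
  by rewrite (sub_perpC Jsym) capmxSr.
have rX : \rank X = d.
  apply/eqP; rewrite eqn_leq (isotropic_rank Jsym Junit XX) /=.
  rewrite mxrank_adds_row; last by rewrite sub_capmx negb_and wP.
  have := mxrank_sum_cap P (perp w); have := rank_leq_col (P + perp w)%MS.
  rewrite (mxrank_perp Junit) r1; have := rank_leq_row w.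
  by clear; lia.
have ePw := adds_row_full PY rYP wY wP.
exists X; split=> //.
  apply/eqmxP; rewrite addsmx_sub PY addsmx_sub wY (submx_trans (capmxSl _ _) PY) /=.
  by rewrite -ePw; apply: addsmxS => //; apply: addsmxSr.
move=> m U UP UY; apply: (submx_trans _ (addsmxSl _ _)).
by rewrite sub_capmx UP (submx_trans UY) //; apply: perpS.
Qed.

Lemma stepT_modflag (Y : 'M[F]_D) : (fv V1 n <= Y)%MS -> \rank Y = d.+1 ->
    (Y <= fv V1 n.+2)%MS -> ~~ (Y <= fv V1 n.+1)%MS ->
  exists V, [/\ is_flag J V, rel_pos V1 V = B & (fv V1 n + fv V n :=: Y)%MS].
Proof.
move=> PY rY Yn2 Yn1; have [X [XX rX eY lowX]] := hyperbolic_line PY rY Yn1.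
pose V := modflag J V1 n X.
have XY : (X <= Y)%MS by rewrite -eY addsmxSr.
have fl : is_flag J V.
  apply: is_flag_modflag => //; rewrite ?subNn.
  - by rewrite n0 /=; clear; lia.
  - move=> i i_n _; apply: lowX; first by apply: (fvS fl1); rewrite ltnW.
    rewrite (sub_perpC Jsym); apply: (submx_trans Yn2).
    have iN : (i <= N)%N by clear -i_n; lia.
    have e : (perp (fv V1 i) :=: fv V1 (N - i))%MS.
      apply: eqmx_sym; apply: (eqmx_trans (fv_perp fl1 (leq_subr _ _))).
      by rewrite subKn.
    by rewrite e; apply: (fvS fl1); clear -i_n; lia.
  - move=> j jn jn1; apply: (submx_trans XY); apply: (submx_trans Yn2).
    by apply: (fvS fl1); clear -jn jn1; lia.
  - by rewrite ltnNge leqnSn.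
have same i : (i <= N)%N -> i != n -> i != n.+1 -> fv V i = fv V1 i.
  by move=> iN i1 i2; apply: fv_modflag; rewrite ?subNn.
have eX : (fv V n :=: X)%MS by rewrite /V fv_modflag_self //; exact: genmxE.
have eYV : (fv V1 n + fv V n :=: Y)%MS.
  by apply: eqmx_trans eY; apply: adds_eqmx.
have rYV : \rank (fv V1 n + fv V n)%MS = d.+1 by rewrite eYV.
have rV : \rank (fv V n) = d by rewrite eX.
have jY : jump (fv V1 n) (fv V1 n + fv V n)%MS V1 n.+1.
  rewrite /jump !eYV (submx_trans Yn2 (addsmxSr _ _)) /=.
  apply: contra Yn1 => /submx_trans; apply; rewrite addsmx_sub submx_refl andbT.
  by apply: (fvS fl1); rewrite leqnSn ltnW.
have swap j : (j <= N)%N -> (rk V V1 n j + (n.*2 - n.+1 < j) = rk V1 V1 n j + (n.+1 < j))%N.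
  by move=> jN; apply: rk_swap_half.
have e := rel_pos_modT Jsym Junit fl1 fl fl1 n0 n1N same swap.
exists V; split=> //.
apply: eq_mx_row_sums => [i j ij|i]; last first.
  by rewrite rowB (sum_row_rel_pos i fl1 fl).
have trE (A C E : 'M[int]_N) : (A - C + E)^T i j = A j i - C^T i j + E^T i j.
  by rewrite !mxE.
rewrite (rel_posC fl fl1) e stepT_off // trE !tr_dth (rel_pos_self fl1) 1?eq_sym //.
by rewrite dth_diag // subrr add0r.
Qed.

(** As in [card_stepF], with Y = V1_n + V_n in the role of the cover. Now Y runs through the covers
    of V1_n inside V1_(n+2) other than V1_(n+1), and this excluded cover accounts for the subtracted
    term. *)
Lemma card_stepT V2 (A : 'M[int]_N) : is_flag J V2 ->
  #|[set V | is_flag J V & (rel_pos V1 V == B) && (rel_pos V V2 == A)]|%:Z * (#|F|%:Z - 1)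
  = \sum_(k < N) (A == rel_pos V1 V2 - dth n n.+1 k + dth n n.-1 k)%:Z
      * (#|F|%:Z ^+ (rk V1 V2 n.+2 k.+1 - rk V1 V2 n k.+1)
         - #|F|%:Z ^+ (rk V1 V2 n.+2 k - rk V1 V2 n k))
    - (A == rel_pos V1 V2)%:Z * (#|F|%:Z - 1).
Proof.
move=> fl2; set S := [set V | _].
pose Yf V := (fv V1 n + fv V n)%MS.
have posk V k : is_flag J V -> rel_pos V1 V = B -> (k < N)%N -> jump (fv V1 n) (Yf V) V2 k ->
    rel_pos V V2 = rel_pos V1 V2 - dth n n.+1 k + dth n n.-1 k.
  move=> fl eB kN jk; have [same r rY _ _] := stepT_struct fl eB.
  apply: (rel_pos_modT Jsym Junit) => // j jN.
  exact: rk_swap_half.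
have -> : #|S| = (\sum_(k < N) #|[set V in S | jump (fv V1 n) (Yf V) V2 k]|)%N.
  rewrite -sum1_card; under [RHS]eq_bigr do rewrite -sum1dep_card.
  rewrite (exchange_big_dep (mem S)) /=; last by move=> k V _ /andP[].
  apply: eq_bigr => V VS; rewrite big_mkcond /=.
  rewrite (eq_bigr (fun k : 'I_N => jump (fv V1 n) (Yf V) V2 k : nat)); last first.
    by move=> k _; move: VS => /=; rewrite inE => ->; case: jump.
  symmetry; apply: (sum_jump fl2).
  move: VS; rewrite inE => /andP[fl /andP[/eqP eB _]].
  have [_ _ r _ _] := stepT_struct fl eB.
  by apply/negP => /mxrankS; rewrite r r1 ltnn.
rewrite (big_morph Posz PoszD (erefl 0%:Z)) mulr_suml.
have rn1 : \rank (fv V1 n.+1) = d.+1.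
  by have := rank_fv_perp Junit fl1 nN; rewrite subNn r1; clear; lia.
(* The excluded cover V1_(n+1) enters V2 at the middle index: by [rk_half_low] it adds nothing to
   the intersection with V2_n, and by duality it does add to that with V2_(n+1). *)
have jmid k : (k < N)%N -> jump (fv V1 n) (fv V1 n.+1) V2 k = (k == n).
  move=> kN; have s : (fv V1 n <= fv V1 n.+1)%MS by apply: (fvS fl1); rewrite leqnSn ltnW.
  have rs : \rank (fv V1 n.+1) = (\rank (fv V1 n)).+1 by rewrite rn1 r1.
  have [k' k'N jk'] : exists2 k', (k' < N)%N & jump (fv V1 n) (fv V1 n.+1) V2 k'.
    by apply: (ex_jump fl2); apply/negP => /mxrankS; rewrite rs ltnn.
  have c1 := mxrank_cap_cover (fv V2 n) s rs.
  have c2 := mxrank_cap_cover (fv V2 n.+1) s rs.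
  rewrite (jumpE fl2 k'N nN jk') -/(rk V1 V2 n.+1 n) (rk_half_low fl1 fl2 r1 (leqnn n)) in c1.
  have n1N' := ltnW n1N.
  rewrite (jumpE fl2 k'N n1N' jk') -/(rk V1 V2 n.+1 n.+1) -/(rk V1 V2 n n.+1) in c2.
  have d1 := rk_half_dual fl1 fl2 r1 (leqnn n).
  have d2 := rkN Jsym Junit fl1 fl2 nN nN; rewrite subNn r1 in d1 d2.
  have d3 := rank_fv_perp Junit fl2 nN; rewrite subNn in d3.
  have enk : n = k' by move: c1 c2 d1 d2 d3; rewrite /rk; clear -k'N; lia.
  rewrite [X in k == X]enk; case: (eqVneq k k') => [->|kk']; first exact: jk'.
  apply/negbTE/negP => jk; case/eqP: kk'.
  have := jumpE fl2 kN (kN : (k.+1 <= N)%N) jk.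
  have := jumpE fl2 k'N (k'N : (k'.+1 <= N)%N) jk'.
  rewrite (jumpE fl2 k'N kN jk') (jumpE fl2 kN k'N jk) !leqnn !ltnS => h1 h2.
  by apply/eqP; rewrite eqn_leq h1 h2.
have midE : rel_pos V1 V2 - dth n n.+1 n + dth n n.-1 n = rel_pos V1 V2.
  by rewrite dth_mid // subrK.
(* As [move] at the middle column is trivial, the correction is absorbed into the summand k = n and
   the identity can be checked for each k. *)
have -> : (A == rel_pos V1 V2)%:Z * (#|F|%:Z - 1)
   = \sum_(k < N) (A == rel_pos V1 V2 - dth n n.+1 k + dth n n.-1 k)%:Z
        * ((k : nat) == n)%:Z * (#|F|%:Z - 1).
  have oN : (n < N)%N by clear; lia.
  rewrite (bigD1 (Ordinal oN)) //= midE eqxx mulr1 big1 ?addr0 // => k kn.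
  rewrite (_ : (k : nat) == n = false) ?mulr0 ?mul0r //.
  by apply/negbTE; apply: contra kn => /eqP e; apply/eqP/val_inj.
rewrite -sumrB; apply: eq_bigr => k _.
have kN := ltn_ord k.
have nn2 : (n <= n.+2 <= N)%N by rewrite n2N andbT; clear; lia.
rewrite -(card_covers_jump fl1 fl2 nn2 kN) -mulrA -mulrBr -mulrBl.
case: eqVneq => [eA|nA]; last first.
  rewrite mul0r (_ : [set V in S | _] = set0) ?cards0 ?mul0r //.
  apply/setP=> V; rewrite !inE; apply/negbTE; apply: contra nA.
  by case/andP=> /andP[fl /andP[/eqP eB /eqP <-]] jk; apply/eqP/posk.
rewrite mul1r; congr (_ * _).
rewrite -(card_in_imset (f := fun V => <<Yf V>>%MS)); last first.
  move=> V V'; rewrite !inE => /andP[/andP[fl /andP[/eqP eB _]] _].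
  move=> /andP[/andP[fl' /andP[/eqP eB' _]] _] /genmxP/eqmxP.
  exact: stepT_inj.
have cE : (#|covers (fv V1 n) (fv V1 n.+2) V2 k|%:Z - ((k : nat) == n)%:Z)
    = #|[set Y in covers (fv V1 n) (fv V1 n.+2) V2 k | ~~ (Y <= fv V1 n.+1)%MS]|%:Z.
  set C := covers _ _ _ _.
  have -> : #|C| = (#|[set Y in C | (Y <= fv V1 n.+1)%MS]|
      + #|[set Y in C | ~~ (Y <= fv V1 n.+1)%MS]|)%N.
    rewrite -(cardsID [set Y : 'M_D | (Y <= fv V1 n.+1)%MS] C); congr (_ + _)%N.
      by apply: eq_card => Y; rewrite !inE.
    by apply: eq_card => Y; rewrite !inE andbC.
  have -> : #|[set Y in C | (Y <= fv V1 n.+1)%MS]| = (((k : nat) == n) : nat).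
    have eY Y : <<Y>>%MS = Y -> \rank Y = d.+1 -> (Y <= fv V1 n.+1)%MS -> Y = fv V1 n.+1.
      move=> gY rY s; rewrite -gY -(fv_gen fl1); apply/eq_genmx/eqmxP.
      by rewrite -(mxrank_leqif_eq s) rY rn1.
    case: eqVneq => [kn|kn].
      rewrite /= -(cards1 (fv V1 n.+1)); apply: eq_card => Y; rewrite !inE.
      apply/idP/eqP => [/andP[/and5P[/eqP gY _ /eqP rY _ _] s]|->].
        by apply: eY; rewrite ?rY ?r1.
      rewrite (fv_gen fl1) eqxx rn1 r1 eqxx submx_refl andbT /= jmid // kn eqxx andbT.
      by apply/andP; split; apply: (fvS fl1); clear -n0; lia.
    apply/eqP; rewrite cards_eq0; apply/eqP/setP => Y; rewrite !inE.
    apply/negbTE; apply: contra kn => /andP[/and5P[/eqP gY _ /eqP rY _ jk] s].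
    have e : Y = fv V1 n.+1 by apply: eY; rewrite ?rY ?r1.
    by rewrite -jmid // -e.
  by rewrite PoszD addrC addKr.
rewrite cE; congr (Posz #|pred_of_set _|); apply/setP=> W; apply/imsetP/idP.
  case=> V; rewrite !inE => /andP[/andP[fl /andP[/eqP eB _]] jk ->].
  have [_ _ rY s2 s3] := stepT_struct fl eB.
  rewrite genmx_id eqxx !genmxE addsmxSl rY r1 eqxx s2 s3 andbT /=.
  by move: jk; rewrite /jump !genmxE.
rewrite !inE => /andP[/and5P[/eqP gW s1 /eqP r s2 jk] s3].
have rW : \rank W = d.+1 by rewrite r r1.
have [V [fl eB eY]] := stepT_modflag s1 rW s2 s3.
have jV : jump (fv V1 n) (Yf V) V2 k by move: jk; rewrite /jump !eY.
exists V; last by rewrite -gW; apply/eq_genmx/eqmx_sym.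
by rewrite !inE fl eB eqxx jV andbT /= eA; apply/eqP; apply: posk.
Qed.

End StepT.

(** * Nonempty orbits *)

Section CoordinateSubspaces.

Variables (F : fieldType) (D : nat).

Definition coord_mx (S : {set 'I_D}) : 'M[F]_D := diag_mx (\row_s (s \in S)%:R).

Lemma sub_coord_mx (S : {set 'I_D}) (w : 'rV[F]_D) :
  reflect (forall s, s \notin S -> w 0 s = 0) (w <= coord_mx S)%MS.
Proof.
have mulE s : (w *m coord_mx S) 0 s = w 0 s * (s \in S)%:R by rewrite mul_mx_diag !mxE.
apply: (iffP idP) => [/submxP[u ->] s sS|w0].
  by rewrite mul_mx_diag !mxE (negbTE sS) mulr0.
suff <- : w *m coord_mx S = w by exact: submxMl.
apply/rowP => s; rewrite mulE; case: (boolP (s \in S)) => sS; first by rewrite mulr1.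
by rewrite w0 // mul0r.
Qed.

Lemma mxrank_coord_mx (S : {set 'I_D}) : \rank (coord_mx S) = #|S|.
Proof.
have le (T : {set 'I_D}) : (\rank (coord_mx T) <= #|T|)%N.
  rewrite /coord_mx diag_mx_sum_delta.
  rewrite (bigID (mem T)) /= [X in (_ + X)%R]big1 ?addr0; last first.
    by move=> s sT; rewrite mxE (negbTE sT) scale0r.
  rewrite -sum1_card; elim/big_rec2: _ => [|s x y _ IH]; first by rewrite mxrank0.
  apply: leq_trans (mxrank_add _ _) (leq_add _ IH).
  by apply: leq_trans (mxrank_scale _ _) _; rewrite mxrank_delta.
apply/eqP; rewrite eqn_leq le /=.
have : (\rank (coord_mx S + coord_mx (~: S))%R <= \rank (coord_mx S) + #|~: S|)%N.
  by apply: leq_trans (mxrank_add _ _) _; rewrite leq_add2l.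
have -> : coord_mx S + coord_mx (~: S) = 1%:M.
  apply/matrixP=> i j; rewrite !mxE inE.
  by case: (i == j); case: (i \in S); rewrite ?mulr1n ?mulr0n ?addr0 ?add0r.
by rewrite mxrank1 -[X in (X <= _)%N](card_ord D) -(cardsC S) leq_add2r.
Qed.

Lemma cap_coord_mx (S T : {set 'I_D}) :
  (coord_mx S :&: coord_mx T :=: coord_mx (S :&: T))%MS.
Proof.
apply/eqmxP/rV_eqP => w; rewrite sub_capmx.
apply/andP/sub_coord_mx => [[/sub_coord_mx wS /sub_coord_mx wT] s|w0].
  by rewrite inE negb_and => /orP[/wS|/wT].
by split; apply/sub_coord_mx => s sN; apply: w0; rewrite inE (negbTE sN) ?andbF.
Qed.

Lemma coord_mxS (S T : {set 'I_D}) : S \subset T -> (coord_mx S <= coord_mx T)%MS.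
Proof.
move=> ST; apply/rV_subP => w /sub_coord_mx w0; apply/sub_coord_mx => s sT.
by apply: w0; apply: contra sT; apply: (subsetP ST).
Qed.

Variable sg : 'I_D -> 'I_D.
Hypothesis sgK : involutive sg.

(** Pairing basis vectors by an involution makes the complement of a coordinate subspace a
    coordinate subspace again ([perp_coord_mx]). *)
Definition invol_mx : 'M[F]_D := \matrix_(s, t) (t == sg s)%:R.

Lemma mul_invol_mx (w : 'rV[F]_D) t : (w *m invol_mx) 0 t = w 0 (sg t).
Proof.
rewrite mxE (bigD1 (sg t)) //= mxE sgK eqxx mulr1 big1 ?addr0 // => s st.
rewrite mxE (_ : t == sg s = false) ?mulr0 //.
by apply/negbTE; apply: contra st => /eqP->; rewrite sgK.
Qed.

Lemma invol_mx_sym : invol_mx \is symmetricmx.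
Proof.
apply/is_hermitianmxP; rewrite expr0 scale1r map_mx_id //.
by apply/matrixP=> s t; rewrite !mxE -(inj_eq (inv_inj sgK)) sgK eq_sym.
Qed.

Lemma invol_mx_unit : invol_mx \in unitmx.
Proof.
suff : invol_mx *m invol_mx = 1%:M by case/mulmx1_unit.
apply/row_matrixP => s; apply/rowP=> t.
rewrite row_mul mul_invol_mx !mxE -(inj_eq (inv_inj sgK)) !sgK.
by rewrite eq_sym.
Qed.

Lemma perp_coord_mx (S : {set 'I_D}) :
  (orthomx idfun invol_mx (coord_mx S) :=: coord_mx [set s | sg s \notin S])%MS.
Proof.
apply/eqmxP/rV_eqP => w; rewrite sub_perp tr_diag_mx mul_mx_diag.
apply/eqP/sub_coord_mx => [w0 s|w0].
  rewrite inE negbK => sS; have /rowP/(_ (sg s)) := w0.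
  by rewrite mxE mul_invol_mx sgK !mxE sS mulr1.
apply/rowP=> s; rewrite mxE mul_invol_mx !mxE.
case: (boolP (s \in S)) => sS; last by rewrite mulr0.
by rewrite w0 ?mul0r // inE negbK sgK.
Qed.

End CoordinateSubspaces.

Section NonemptyOrbits.

Variables (n d : nat) (F : finFieldType) (A : Xi n d).
Local Notation N := (n.*2.+1).
Local Notation D := (d.*2.+1).
Local Notation cell := ('I_N * 'I_N)%type.
Local Notation T := {c : cell & 'I_(`|val A c.1 c.2|%N)}.

Lemma Xi_ge0 i j : 0 <= val A i j.
Proof. by case/and3P: (valP A) => /forallP/(_ i)/forallP/(_ j). Qed.

Lemma Xi_sum : \sum_i \sum_j val A i j = D%:Z.
Proof. by case/and3P: (valP A) => _ /eqP. Qed.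

Lemma Xi_rev i j : val A (rev_ord i) (rev_ord j) = val A i j.
Proof. by case/and3P: (valP A) => _ _ /forallP/(_ i)/forallP/(_ j)/eqP. Qed.

Definition rev_cell (c : cell) : cell := (rev_ord c.1, rev_ord c.2).

Lemma rev_cellK : involutive rev_cell.
Proof. by case=> i j; rewrite /rev_cell /= !rev_ordK. Qed.

Lemma card_cells : #|{: T}| = D.
Proof.
rewrite card_tagged sumnE big_map big_enum /=.
apply/eqP; rewrite -eqz_nat (big_morph Posz PoszD (erefl 0%:Z)) -Xi_sum pair_bigA /=.
by apply/eqP; apply: eq_bigr => c _; rewrite card_ord gez0_abs // Xi_ge0.
Qed.

Lemma rev_cell_mult c : `|val A c.1 c.2|%N = `|val A (rev_cell c).1 (rev_cell c).2|%N.
Proof. by rewrite Xi_rev. Qed.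

(** The basis of F^D is indexed by pairs of a cell (i, j) and a number below a_ij. The half turn of
    A acts on this set, by central symmetry, and defines the form. *)
Definition rev_pt (t : T) : T :=
  Tagged (fun c : cell => 'I_(`|val A c.1 c.2|%N))
    (cast_ord (rev_cell_mult (tag t)) (tagged t)).

Lemma rev_ptK : involutive rev_pt.
Proof.
case=> c k; rewrite /rev_pt /=.
have eqT (c1 c2 : cell) (k1 : 'I_(`|val A c1.1 c1.2|%N)) (k2 : 'I_(`|val A c2.1 c2.2|%N)) :
    c1 = c2 -> k1 = k2 :> nat ->
    existT (fun c : cell => 'I_(`|val A c.1 c.2|%N)) c1 k1
    = existT (fun c : cell => 'I_(`|val A c.1 c.2|%N)) c2 k2.
  by move=> e; case: _ / e k2 => k2 e; congr existT; apply: val_inj.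
by apply: eqT => //; rewrite rev_cellK.
Qed.

Definition pt (s : 'I_D) : T := enum_val (cast_ord (esym card_cells) s).
Definition pt_rank (t : T) : 'I_D := cast_ord card_cells (enum_rank t).

Lemma ptK : cancel pt pt_rank.
Proof. by move=> s; rewrite /pt /pt_rank enum_valK cast_ordKV. Qed.

Lemma pt_rankK : cancel pt_rank pt.
Proof. by move=> t; rewrite /pt /pt_rank cast_ordK enum_rankK. Qed.

Definition sg s := pt_rank (rev_pt (pt s)).
Definition lab s : cell := tag (pt s).

Lemma sgK : involutive sg.
Proof. by move=> s; rewrite /sg pt_rankK rev_ptK ptK. Qed.

Lemma lab_sg s : lab (sg s) = rev_cell (lab s).
Proof. by rewrite /lab /sg pt_rankK. Qed.

Lemma card_lab (c : cell) : #|[set s | lab s == c]| = `|val A c.1 c.2|%N.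
Proof.
rewrite -[RHS]card_ord.
rewrite -(card_imset predT (f := fun k : 'I_(`|val A c.1 c.2|%N) =>
   pt_rank (Tagged (fun c : cell => 'I_(`|val A c.1 c.2|%N)) k))); last first.
  move=> k1 k2 /(can_inj pt_rankK) /eqP.
  by rewrite eq_Tagged /= => /eqP.
apply: eq_card => s; rewrite inE; apply/eqP/imsetP.
  rewrite /lab => e; case: (pt s) (ptK s) e => c' k /= <- e.
  by case: _ / e; exists k.
by case=> k _ ->; rewrite /lab pt_rankK.
Qed.

Definition gramA : 'M[F]_D := invol_mx F sg.

(** The flag filters the basis by one label of its cells. Using row labels for one flag and column
    labels for the other, the pair has position A. *)
Definition coord_flag (pr : cell -> 'I_N) : mxflag n d F :=
  mkflag n (fun i => coord_mx F [set s | (pr (lab s) < i)%N]).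

Lemma is_flag_coord_flag (pr : cell -> 'I_N) :
  (forall c, pr (rev_cell c) = rev_ord (pr c)) -> is_flag gramA (coord_flag pr).
Proof.
move=> prr; apply/and5P; split.
- by apply/forallP=> i; rewrite ffunE genmx_id.
- rewrite ffunE /=; apply/eqP; rewrite (_ : coord_mx _ _ = 0) ?genmx0 //.
  by apply/matrixP=> s t; rewrite !mxE inE mul0rn.
- rewrite ffunE /=; apply/eqP; rewrite (_ : coord_mx _ _ = 1%:M) ?genmx1 //.
  by apply/matrixP=> s t; rewrite !mxE inE ltn_ord.
- apply/forallP=> i; apply/forallP=> j; apply/implyP=> ij.
  rewrite !ffunE !genmxE; apply: coord_mxS; apply/subsetP=> s; rewrite !inE => si.
  exact: leq_trans si ij.
apply/forallP=> i; rewrite !ffunE; apply/eqmxP; apply: (eqmx_trans (genmxE _)).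
apply: eqmx_sym.
apply: (eqmx_trans (perp_eqmx (invol_mx_sym F sgK) (invol_mx_unit F sgK) (genmxE _))).
apply: (eqmx_trans (perp_coord_mx F sgK _)).
rewrite (_ : [set s | _] = [set s | (pr (lab s) < i)%N]) //.
apply/setP=> s; rewrite !inE lab_sg prr /= -leqNgt.
have := ltn_ord (pr (lab s)); have := ltn_ord i.
move: (nat_of_ord i) (nat_of_ord (pr (lab s))) => i' s'; rewrite !subSS; clear; lia.
Qed.

Lemma rk_coord_flag i j : (i <= N)%N -> (j <= N)%N ->
  rk (coord_flag fst) (coord_flag snd) i j
  = (\sum_s ((lab s).1 < i) * ((lab s).2 < j))%N.
Proof.
move=> iN jN; rewrite /rk !fv_mkflag //.
transitivity (\rank (coord_mx F ([set s | (lab s).1 < i] :&: [set s | (lab s).2 < j])%N)).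
  apply/eqmx_rank/eqmxP; apply: eqmx_trans _ (cap_coord_mx _ _ _).
  by apply: cap_eqmx; apply: genmxE.
rewrite mxrank_coord_mx -sum1_card big_mkcond /=; apply: eq_bigr => s _.
by rewrite !inE; case: (_ < i)%N; case: (_ < j)%N.
Qed.

Lemma rel_pos_coord_flags : rel_pos (coord_flag fst) (coord_flag snd) = val A.
Proof.
apply/matrixP=> i j.
have fl : is_flag gramA (coord_flag fst) by apply: is_flag_coord_flag.
have iN := ltn_ord i; have jN := ltn_ord j.
rewrite (rel_posE _ i j fl) !rk_coord_flag //; try exact: ltnW.
rewrite -[RHS]gez0_abs ?Xi_ge0 // -(card_lab (i, j)) -sum1_card [in RHS]big_mkcond /=.
rewrite !(big_morph Posz PoszD (erefl 0%:Z)) -!sumrB -big_split /=.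
apply: eq_bigr => s _; rewrite inE; case: (lab s) => a b /=.
rewrite xpair_eqE -!val_eqE /=.
move: (nat_of_ord a) (nat_of_ord b) (nat_of_ord i) (nat_of_ord j) => a' b' i' j'.
rewrite !ltnS; case: (ltngtP a' i'); case: (ltngtP b' j') => /= _ _; lia.
Qed.

End NonemptyOrbits.

(** * Structure constants of the Schur algebra *)

Section Orbits.

Variables (n d : nat) (F : finFieldType) (J : 'M[F]_(d.*2.+1)).
Hypothesis Junit : J \in unitmx.
Local Notation N := (n.*2.+1).
Local Notation D := (d.*2.+1).
Local Notation perp := (orthomx idfun J).
Implicit Types V : mxflag n d F.

Section Action.
Variable Q : 'M[F]_D.
Hypothesis isoQ : Q \in isometries J.

Lemma isometry_free : row_free Q.
Proof.
move: isoQ; rewrite inE => /eqP e; rewrite row_free_unit.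
suff : Q *m (J *m Q^T *m invmx J) = 1%:M by case/mulmx1_unit.
by rewrite !mulmxA e mulmxV.
Qed.

Lemma perp_isometry m (A : 'M[F]_(m, D)) : (perp (A *m Q) :=: perp A *m Q)%MS.
Proof.
have s : (perp A *m Q <= perp (A *m Q))%MS.
  have /eqP e : perp A *m J *m A^T == 0 by rewrite -sub_perp.
  move: isoQ; rewrite inE => /eqP eQ; rewrite sub_perp trmx_mul.
  by rewrite !mulmxA -(mulmxA (perp A)) -(mulmxA (perp A)) eQ e.
apply: eqmx_sym; apply/eqmxP; rewrite -(mxrank_leqif_eq s).
by rewrite mxrankMfree ?isometry_free // !(mxrank_perp Junit) mxrankMfree // isometry_free.
Qed.

Lemma is_flag_act V : is_flag J V -> is_flag J (flag_act V Q).
Proof.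
case/and5P=> /forallP gV /eqP V0 /eqP VN /forallP mV /forallP pV; apply/and5P; split.
- by apply/forallP=> i; rewrite ffunE genmx_id.
- by rewrite ffunE V0 mul0mx genmx0.
- rewrite ffunE VN mul1mx -genmx1; apply/eqP/eq_genmx/eqmxP.
  by rewrite submx1 sub1mx row_full_unit -row_free_unit isometry_free.
- apply/forallP=> i; apply/forallP=> j; apply/implyP=> ij.
  rewrite !ffunE !genmxE submxMr //.
  by have /forallP/(_ j)/implyP := mV i; apply.
apply/forallP=> i; rewrite !ffunE; apply/eqmxP.
apply: (eqmx_trans (genmxE _)); apply: eqmx_sym.
have pgen (B : 'M[F]_D) : (perp <<B>>%MS :=: perp B)%MS.
  have h m1 m2 (X : 'M_(m1, D)) (Y : 'M_(m2, D)) : (X <= Y)%MS -> (perp Y <= perp X)%MS.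
    move=> /submxP[M ->]; rewrite sub_perp trmx_mul mulmxA.
    have /eqP -> : perp Y *m J *m Y^T == 0 by rewrite -sub_perp.
    by rewrite mul0mx.
  by apply/eqmxP; rewrite !h ?genmxE ?submx_refl.
apply: (eqmx_trans (pgen _)); apply: (eqmx_trans (perp_isometry _)).
by apply: eqmxMr; apply: eqmx_sym; apply/eqmxP; exact: pV.
Qed.

Lemma rel_pos_act V V' : is_flag J V -> rel_pos (flag_act V Q) (flag_act V' Q) = rel_pos V V'.
Proof.
move=> fl; apply/matrixP=> i j.
rewrite (rel_posE _ i j fl) (rel_posE _ i j (is_flag_act fl)).
have rkE a b : rk (flag_act V Q) (flag_act V' Q) a b = rk V V' a b.
  rewrite /rk /fv !ffunE; set X := V _; set Y := V' _.
  have -> : \rank (<<X *m Q>> :&: <<Y *m Q>>)%MS = \rank (X *m Q :&: Y *m Q)%MS.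
    by apply/eqmx_rank/eqmxP/cap_eqmx; exact: genmxE.
  have := mxrank_sum_cap X Y; have := mxrank_sum_cap (X *m Q) (Y *m Q).
  by rewrite -addsmxMr !(mxrankMfree _ isometry_free); lia.
by rewrite !rkE.
Qed.

End Action.

(** Isometries preserve flags and relative positions, and the identity is one, so membership in
    [orbit_of] can be tested on the position alone. *)
Lemma orbitP (A : Xi n d) V1 V2 :
  ((V1, V2) \in orbit_of J A)
  = [&& is_flag J V1, is_flag J V2 & rel_pos V1 V2 == val A].
Proof.
rewrite inE; apply/exists_inP/and3P.
  case=> Q isoQ /existsP[[W1 W2] /and4P[/= f1 f2 r /eqP[-> ->]]].
  by rewrite !is_flag_act // rel_pos_act.
case=> f1 f2 r; exists 1%:M; first by rewrite inE mul1mx trmx1 mulmx1.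
apply/existsP; exists (V1, V2); rewrite /= f1 f2 r /=.
have actE V : is_flag J V -> flag_act V 1%:M = V.
  by case/and5P=> /forallP gV _ _ _ _; apply/ffunP=> i; rewrite ffunE mulmx1; apply/eqP.
by rewrite !actE.
Qed.

End Orbits.

Section RelPosXi.

Variables (n d : nat) (F : finFieldType) (J : 'M[F]_(d.*2.+1)).
Hypothesis Jsym : J \is symmetricmx.
Hypothesis Junit : J \in unitmx.
Local Notation N := (n.*2.+1).
Implicit Types V : mxflag n d F.

Lemma rel_pos_in_Xi V V' : is_flag J V -> is_flag J V' -> in_Xi d (rel_pos V V').
Proof.
move=> fl fl'; apply/and3P; split.
- apply/forallP=> i; apply/forallP=> j; rewrite mxE subr_ge0 lez_nat.
  apply: mxrankS; apply: addsmxS => //; apply: capmxS => //.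
  by rewrite -!/(fv V' _); apply: (fvS fl'); rewrite leqnSn /=.
- rewrite (eq_bigr _ (fun i _ => sum_row_rel_pos i fl fl')).
  rewrite -(big_mkord xpredT (fun i => (\rank (fv V i.+1))%:Z - (\rank (fv V i))%:Z)).
  by rewrite telescope_sumr // (fvN fl) (fv0 fl) mxrank1 mxrank0 subr0.
apply/forallP=> i; apply/forallP=> j; apply/eqP.
rewrite (rel_posE V' i j fl) (rel_posE V' (rev_ord i) (rev_ord j) fl).
have revE (k : 'I_N) : (rev_ord k).+1 = (N - k)%N /\ rev_ord k = (N - k.+1)%N :> nat.
  by split=> //; rewrite /= -subSn // ltn_ord.
have [-> ->] := revE i; have [-> ->] := revE j.
have dual a b : (a <= N)%N -> (b <= N)%N -> (rk V V' (N - a) (N - b))%:Z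
    = (d.*2.+1)%:Z + (rk V V' a b)%:Z - (\rank (fv V a))%:Z - (\rank (fv V' b))%:Z.
  by move=> aN bN; have := rkN Jsym Junit fl fl' aN bN; lia.
have iN := ltn_ord i; have jN := ltn_ord j.
by rewrite !dual //; try exact: ltnW; ring.
Qed.

End RelPosXi.

Lemma odd_primes_seq k : exists s : seq nat,
  [/\ uniq s, size s = k & all (fun p => prime p && odd p) s].
Proof.
elim: k => [|k [s [us ss ps]]]; first by exists [::].
have [p] := prime_above (maxn 2 (\max_(i <- s) i)).
rewrite gtn_max => /andP[p2 ps'] pp; exists (p :: s); split=> /=.
- rewrite us andbT; apply/negP => /(@leq_bigmax_seq _ s xpredT id p) /(_ isT).
  by rewrite leqNgt ps'.
- by rewrite ss.
by rewrite pp ps andbT; case: (even_prime pp) => [e|//]; rewrite e in p2.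
Qed.

(** The difference would have infinitely many roots. Identities between structure constants can
    therefore be proved by counting flags over prime fields. *)
Lemma eq_poly_odd_primes (P Q : {poly int}) :
  (forall p, prime p -> odd p -> P.[p%:Z] = Q.[p%:Z]) -> P = Q.
Proof.
move=> PQ; apply/eqP; rewrite -subr_eq0; apply/negPn/negP => nz.
have [s [us ss ps]] := odd_primes_seq (size (P - Q)).
have := max_poly_roots (rs := map Posz s) nz.
rewrite size_map ss ltnn => h; suff : false by [].
apply: h; last by rewrite map_inj_uniq // => x y [].
apply/allP=> _ /mapP[p ps' ->]; have /andP[pp po] := allP ps _ ps'.
by rewrite rootE hornerD hornerN PQ // subrr.
Qed.

Section StructureConstants.

Variables (n d : nat) (g : structure_constants n).
Hypotheses (n0 : (0 < n)%N) (d0 : (0 < d)%N) (schur : is_schur_constants g).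
Local Notation N := (n.*2.+1).
Implicit Types A B C Z : Xi n d.

Record witness Z (p : nat) : Type := Witness {
  gram : 'M['F_p]_(d.*2.+1);
  wit1 : mxflag n d 'F_p;
  wit2 : mxflag n d 'F_p;
  gram_sym : gram \is symmetricmx;
  gram_unit : gram \in unitmx;
  wit1_flag : is_flag gram wit1;
  wit2_flag : is_flag gram wit2;
  wit_rel_pos : rel_pos wit1 wit2 = val Z }.

Lemma ex_witness Z p : witness Z p.
Proof.
apply: (@Witness Z p (gramA 'F_p Z) (coord_flag 'F_p Z fst) (coord_flag 'F_p Z snd)).
- exact: invol_mx_sym (@sgK n d Z).
- exact: invol_mx_unit (@sgK n d Z).
- exact: is_flag_coord_flag.
- exact: is_flag_coord_flag.
- exact: rel_pos_coord_flags.
Qed.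

Definition paths p (J : 'M['F_p]_(d.*2.+1)) (V1 V2 : mxflag n d 'F_p) (A B : 'M[int]_N) :=
  [set V | is_flag J V & (rel_pos V1 V == A) && (rel_pos V V2 == B)].

Lemma schur_paths p (J : 'M['F_p]_(d.*2.+1)) V1 V2 A B Z : prime p -> odd p ->
    J \is symmetricmx -> J \in unitmx -> is_flag J V1 -> is_flag J V2 ->
    rel_pos V1 V2 = val Z ->
  #|paths J V1 V2 (val A) (val B)|%:Z = (g A B Z).[p%:Z].
Proof.
move=> pp po Js Ju f1 f2 r.
have := schur (F := 'F_p) (J := J) d0; rewrite card_Fp // => /(_ po Js Ju A B Z V1 V2).
rewrite (orbitP Ju) f1 f2 r eqxx => /(_ isT) <-.
congr (Posz _); apply: eq_card => V; rewrite [in LHS]in_set [in RHS]in_set !(orbitP Ju) f1 f2.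
by case: (is_flag J V).
Qed.

(* Both sides count the pairs (V, V') with (V1, V), (V, V'), (V', V2) in the  *)
(* relative positions A, B, C.                                                *)
Lemma schur_assoc A B C Z :
  \sum_(E : Xi n d) g A B E * g E C Z = \sum_(E : Xi n d) g B C E * g A E Z.
Proof.
apply: eq_poly_odd_primes => p pp po; have [J V1 V2 Js Ju f1 f2 r] := ex_witness Z p.
have xiE (V V' : mxflag n d 'F_p) : is_flag J V -> is_flag J V' ->
    val (insubd Z (rel_pos V V')) = rel_pos V V'.
  by move=> f f'; rewrite val_insubd (rel_pos_in_Xi Js Ju).
transitivity (\sum_(V' | is_flag J V' && (rel_pos V' V2 == val C))
    #|paths J V1 V' (val A) (val B)|%:Z).
  (* Sort the V' by the position E of V1 and V'. The default Z of [insubd] is never reached, since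
     positions of flags lie in Xi. *)
  rewrite (partition_big (fun V' => insubd Z (rel_pos V1 V')) xpredT) //=.
  rewrite horner_sum; apply: eq_bigr => E _; rewrite hornerM.
  rewrite -(schur_paths E C pp po Js Ju f1 f2 r).
  transitivity (\sum_(V' in paths J V1 V2 (val E) (val C)) (g A B E).[p%:Z]).
    by rewrite sumr_const -mulr_natr natz.
  apply: eq_big => [V'|V']; rewrite inE.
    case: (boolP (is_flag J V')) => //= f'; rewrite andbC; congr (_ && _).
    by rewrite -[insubd _ _ == E]val_eqE /= xiE.
  case/andP=> f' /andP[/eqP rE _]; apply: esym; exact: schur_paths.
transitivity (\sum_(V | is_flag J V && (rel_pos V1 V == val A))
    #|paths J V V2 (val B) (val C)|%:Z); last first.
  rewrite (partition_big (fun V => insubd Z (rel_pos V V2)) xpredT) //=.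
  rewrite horner_sum; apply: eq_bigr => E _; rewrite hornerM.
  rewrite -(schur_paths A E pp po Js Ju f1 f2 r).
  transitivity (\sum_(V in paths J V1 V2 (val A) (val E)) (g B C E).[p%:Z]); last first.
    by rewrite sumr_const -mulr_natl natz mulrC.
  apply: eq_big => [V|V]; rewrite ?inE.
    case: (boolP (is_flag J V)) => //= f'; congr (_ && _).
    by rewrite -[insubd _ _ == E]val_eqE /= xiE.
  case/andP=> /andP[f' _] /eqP e; apply: schur_paths => //.
  by rewrite -e xiE.
rewrite -!(big_morph Posz PoszD (erefl 0%:Z)); congr Posz.
under eq_bigr do rewrite -sum1_card; under [RHS]eq_bigr do rewrite -sum1_card.
rewrite (exchange_big_dep (fun V => is_flag J V && (rel_pos V1 V == val A))) /=.
  apply: eq_bigr => V /andP[f r1]; apply: eq_bigl => V'; rewrite !inE f r1 /=.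
  by case: (is_flag J V') => //=; rewrite andbC.
by move=> V' V _; rewrite inE => /and3P[-> ->].
Qed.

End StructureConstants.

(** * Multiplication by a step: row sums and the polynomial formula *)

Section Steps.

Variable n : nat.
Local Notation N := (n.*2.+1).
Implicit Types M A B Z lam : 'M[int]_N.

(* lam + dth b.-1 a.-1, that is lam + E^theta_(b,a), is the relative position  *)
(* of V1 and V if V1_a + V_a is V1_a plus a line of V1_b.                      *)
Definition is_step (a b : nat) : bool :=
  [&& b == a.+1, (0 < a < N)%N, a != n & a != n.+1] || (a == n) && (b == n.+2).

(* The relative position of V and V2, for such V1 and V, if V1 and V2 are in   *)
(* position M and the line is in V1_a + V2_(k+1) but not in V1_a + V2_k.       *)
Definition move (a b : nat) M (k : nat) := M - dth n b.-1 k + dth n a.-1 k.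

(** For M the position of V1 and V2 this is dim (V1_b :&: V2_k) - dim (V1_a :&: V2_k), the exponent
    in [card_covers_jump]; written in entries, it is also defined for matrices of K. *)
Definition pre (a b : nat) M (k : nat) : int := psum M b k - psum M a k.

Lemma move_mid M : (0 < n)%N -> move n n.+2 M n = M.
Proof.
by move=> n0; rewrite /move /= dth_mid // subrK.
Qed.

Lemma sum_row_delta (x y i : 'I_N) : \sum_j delta_mx x y i j = (i == x)%:Z.
Proof.
rewrite (bigD1 y) //= mxE eqxx andbT big1 ?addr0 ?natz // => j jy.
by rewrite mxE (negbTE jy) andbF.
Qed.

Lemma sum_row_dth x y (i : 'I_N) :
  \sum_j dth n x y i j = (i == inord x)%:Z + (i == inord (n.*2 - x)%N)%:Z.
Proof.
under eq_bigr do rewrite mxE.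
by rewrite big_split /= !sum_row_delta.
Qed.

Lemma sum_row_move a b M k (i : 'I_N) :
  \sum_j move a b M k i j = \sum_j M i j
    - ((i == inord b.-1)%:Z + (i == inord (n.*2 - b.-1)%N)%:Z)
    + ((i == inord a.-1)%:Z + (i == inord (n.*2 - a.-1)%N)%:Z).
Proof.
have addE (C E : 'M[int]_N) j : (M - C + E) i j = M i j - C i j + E i j by rewrite !mxE.
under eq_bigr do rewrite addE.
by rewrite big_split sumrB /= !sum_row_dth.
Qed.

Lemma sum_col_row_diag lam (i : 'I_N) : is_diag_mx lam ->
  \sum_j lam j i = \sum_j lam i j.
Proof.
move/is_diag_mxP => dl; apply: eq_bigr => j _.
by case: (eqVneq i j) => [->|ij] //; rewrite !dl // eq_sym.
Qed.

(** Composability fixes the diagonal of B through the row sums of A, and [move] undoes exactly the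
    difference between the row and column sums of the off-diagonal part. *)
Lemma row_sums_step a b lam A B Z k : is_diag_mx lam -> B = lam + dth n b.-1 a.-1 ->
    (forall j, \sum_i B i j = \sum_i A j i) -> A = move a b Z k ->
  forall i, \sum_j B i j = \sum_j Z i j.
Proof.
move=> dl -> comp eA i; have := comp i; rewrite eA sum_row_move.
have split_row : \sum_j (lam + dth n b.-1 a.-1) i j
    = \sum_j lam i j + \sum_j dth n b.-1 a.-1 i j.
  by rewrite -big_split; apply: eq_bigr => j _; rewrite mxE.
have split_col : \sum_j (lam + dth n b.-1 a.-1) j i
    = \sum_j lam j i + \sum_j dth n a.-1 b.-1 i j.
  rewrite -big_split; apply: eq_bigr => j _; rewrite mxE /=; congr (_ + _).
  by rewrite -tr_dth mxE.
rewrite split_row split_col sum_col_row_diag // !sum_row_dth.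
by move/addIr=> ->; rewrite subrK.
Qed.

End Steps.

Lemma two_neq0_Fp p : prime p -> odd p -> 2%:R != 0 :> 'F_p.
Proof.
move=> pp po; rewrite -(dvdn_pcharf (pchar_Fp pp)).
by apply/negP => /dvdn_leq -/(_ isT); case: p pp po => [|[|[|p]]].
Qed.

Section StepConstants.

Variables (n d : nat) (g : structure_constants n).
Hypotheses (n0 : (0 < n)%N) (d0 : (0 < d)%N) (schur : is_schur_constants g).
Local Notation N := (n.*2.+1).
Implicit Types A B C Z : Xi n d.

Lemma row_sums_witness p Z (w : witness Z p) (i : 'I_N) :
  \sum_j val Z i j = (\rank (fv (wit1 w) i.+1))%:Z - (\rank (fv (wit1 w) i))%:Z.
Proof. by rewrite -(wit_rel_pos w); apply: sum_row_rel_pos (wit1_flag w) (wit2_flag w). Qed.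

Lemma rank_half_middle (F : finFieldType) (J : 'M[F]_(d.*2.+1)) (V : mxflag n d F) : J \in unitmx ->
  is_flag J V -> (\rank (fv V n.+1))%:Z - (\rank (fv V n))%:Z = 1 -> \rank (fv V n) = d.
Proof.
move=> Ju fl; have nN : (n <= N)%N by lia.
have eN : (N - n)%N = n.+1 by lia.
have := rank_fv_perp Ju fl nN; rewrite eN; lia.
Qed.

Lemma sum_middle (M : 'M[int]_N) : middle_trivial M ->
  \sum_j M (middle n) j = 1 /\ \sum_i M i (middle n) = 1.
Proof.
move/forallP=> h.
have e j : M (middle n) j = (j == middle n)%:Z /\ M j (middle n) = (j == middle n)%:Z.
  by have /andP[/eqP-> /eqP->] := h j; rewrite !natz.
have s : \sum_(j < N) (j == middle n)%:Z = 1.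
  by rewrite (bigD1 (middle n)) //= eqxx big1 ?addr0 // => j /negbTE->.
by split; rewrite -[RHS]s; apply: eq_bigr => j _; have [e1 e2] := e j.
Qed.

(** The two flag counts, read as an identity at each odd prime. The triviality of the middle row of
    Z makes V1_n maximal isotropic, as the case a = n requires. *)
Lemma schur_step a b (lam : 'M[int]_N) A B Z : is_step n a b -> is_diag_mx lam ->
    val B = lam + dth n b.-1 a.-1 ->
    (forall j, \sum_i val B i j = \sum_i val A j i) -> middle_trivial (val Z) ->
  g B A Z * ('X - 1) =
    \sum_(k < N) (val A == move a b (val Z) k)%:Z *:
       ('X^(`|pre a b (val Z) k.+1|) - 'X^(`|pre a b (val Z) k|))
    - ((a == n) && (val A == val Z))%:Z *: ('X - 1).
Proof.
move=> st dl eB comp midZ.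
apply: eq_poly_odd_primes => p pp po; have w := ex_witness Z p.
have := row_sums_witness w; case: w => J V1 V2 Js Ju f1 f2 r /= rowZ.
have leab : (a <= b <= N)%N.
  case/orP: st => [/and4P[/eqP-> /andP[_ aN] _ _]|/andP[/eqP-> /eqP->]].
    by rewrite leqnSn.
  by clear -n0; lia.
have preE k : (k <= N)%N -> `|pre a b (val Z) k|%N = (rk V1 V2 b k - rk V1 V2 a k)%N.
  move=> kN; case/andP: leab => ab bN; have aN := leq_trans ab bN.
  rewrite /pre -r !(psum_rel_pos f1 f2) // subzn ?absz_nat //.
  by apply: mxrankS; apply: capmxS => //; apply: (fvS f1); rewrite ab.
have -> : (\sum_(k < N) (val A == move a b (val Z) k)%:Z *:
       ('X^(`|pre a b (val Z) k.+1|) - 'X^(`|pre a b (val Z) k|))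
    - ((a == n) && (val A == val Z))%:Z *: ('X - 1)).[p%:Z]
  = \sum_(k < N) (val A == move a b (val Z) k)%:Z *
       (p%:Z ^+ (rk V1 V2 b k.+1 - rk V1 V2 a k.+1) - p%:Z ^+ (rk V1 V2 b k - rk V1 V2 a k))
    - ((a == n) && (val A == val Z))%:Z * (p%:Z - 1).
  rewrite hornerD hornerN hornerZ hornerD hornerN hornerX hornerC horner_sum.
  congr (_ - _); apply: eq_bigr => k _; rewrite hornerZ hornerD hornerN !hornerXn.
  by rewrite !preE // ltnW.
rewrite hornerM -(schur_paths d0 schur B A pp po Js Ju f1 f2 r).
rewrite hornerD hornerN hornerX hornerC.
have F2 := two_neq0_Fp pp po.
have cF : #|'F_p| = p by rewrite card_Fp.
(* If B and Z have different row sums, no V exists, and by [row_sums_step] no term on the right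
   survives either. *)
case: (boolP [forall i, \sum_j val B i j == \sum_j val Z i j]) => [/forallP rowB|rowB].
  have rowB' i : \sum_j val B i j = (\rank (fv V1 i.+1))%:Z - (\rank (fv V1 i))%:Z.
    by rewrite (eqP (rowB i)) rowZ.
  case/orP: st => [/and4P[/eqP eb aN an an1]|/andP[/eqP ea /eqP eb]].
    rewrite eb /= in eB *.
    have := card_stepF Js Ju f1 aN an an1 dl eB rowB' (val A) f2.
    rewrite cF r -/(paths J V1 V2 (val B) (val A)) => ->.
    by rewrite (negbTE an) /= mul0r subr0.
  rewrite ea eb /= in eB *.
  have rn : \rank (fv V1 n) = d.
    apply: (rank_half_middle Ju f1); have [s1 _] := sum_middle midZ.
    by rewrite -s1 rowZ /middle inordK //; clear; lia.
  have := card_stepT F2 Js Ju n0 f1 rn dl eB rowB' (val A) f2.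
  by rewrite cF r -/(paths J V1 V2 (val B) (val A)) eqxx.
rewrite (_ : paths _ _ _ _ _ = set0) ?cards0 ?mul0r; last first.
  apply/setP=> V; rewrite !inE; apply/negbTE; apply: contra rowB.
  case/and3P=> f /eqP eV _; apply/forallP=> i; apply/eqP.
  by rewrite -eV (sum_row_rel_pos i f1 f) rowZ.
have nmove k : val A == move a b (val Z) k = false.
  apply/negbTE; apply: contra rowB => /eqP e; apply/forallP=> i; apply/eqP.
  exact: (row_sums_step dl eB comp e).
rewrite big1 ?add0r => [|k _]; last by rewrite nmove mul0r.
case: eqP => [ea|] /=; last by rewrite mul0r oppr0.
case: eqP => [e|] /=; last by rewrite mul0r oppr0.
have := nmove n; rewrite ea.
have eb : b = n.+2.
  by case/orP: st => [/and4P[_ _]|/andP[_ /eqP]] //; rewrite ea eqxx.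
by rewrite eb move_mid // => /eqP/(_ e).
Qed.

End StepConstants.

Section MoreConstants.

Variables (n d : nat) (g : structure_constants n).
Hypotheses (d0 : (0 < d)%N) (schur : is_schur_constants g).
Local Notation N := (n.*2.+1).
Implicit Types A B C Z : Xi n d.

Lemma schur_paths0 A B Z : (forall p (w : witness Z p),
    paths (gram w) (wit1 w) (wit2 w) (val B) (val A) = set0) -> g B A Z = 0.
Proof.
move=> P0; apply: eq_poly_odd_primes => p pp po; have w := ex_witness Z p.
have := P0 p w; case: w => J V1 V2 Js Ju f1 f2 r /= e.
by rewrite -(schur_paths d0 schur B A pp po Js Ju f1 f2 r) e cards0 horner0.
Qed.

Lemma schur_composable A B Z : g B A Z != 0 ->
  forall j, \sum_i val B i j = \sum_i val A j i.
Proof.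
move=> nz j; apply/eqP/negPn/negP => ne; case/eqP: nz.
apply: schur_paths0 => p [J V1 V2 Js Ju f1 f2 r] /=.
apply/setP=> V; rewrite !inE; apply/negbTE; apply: contra ne => /and3P[f /eqP e1 /eqP e2].
by rewrite -[val B]e1 -[val A]e2 (sum_col_rel_pos j f1 f) (sum_row_rel_pos j f f2).
Qed.

(** The off-centre entries of the middle row come in equal nonnegative pairs, so a total of 1 leaves
    only the central entry; similarly for the column. *)
Lemma middle_trivial_sums Z : \sum_j val Z (middle n) j = 1 ->
  \sum_i val Z i (middle n) = 1 -> middle_trivial (val Z).
Proof.
have revm : rev_ord (middle n) = middle n.
  by apply: val_inj; rewrite /= inordK; lia.
have revj (j : 'I_N) : j != middle n -> rev_ord j != j.
  by apply: contra => /eqP/(congr1 val) /= e; apply/eqP/val_inj; rewrite /= inordK; lia.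
have key (f : 'I_N -> int) : (forall j, 0 <= f j) -> (forall j, f (rev_ord j) = f j) ->
    \sum_j f j = 1 -> forall j, f j = (j == middle n)%:R.
  move=> f0 frev s.
  have off j : j != middle n -> f j = 0.
    move=> jm; apply/eqP/negPn/negP => nz; have fj : 1 <= f j by have := f0 j; lia.
    move: s; rewrite (bigD1 j) //= (bigD1 (rev_ord j)) ?revj //= frev.
    set S := \sum_(i | _) _ => s; have S0 : 0 <= S by apply: sumr_ge0.
    by move: (f j) fj s => x; clear -S0; lia.
  move=> j; case: (eqVneq j (middle n)) => [->|]; last exact: off.
  by rewrite -s (bigD1 (middle n)) //= big1 ?addr0 // => i /off.
move=> sr sc; apply/forallP=> i.
rewrite (key (fun j => val Z (middle n) j)) ?(key (fun j => val Z j (middle n))) ?eqxx //.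
- by move=> j; apply: Xi_ge0.
- by move=> j; rewrite -[in LHS]revm Xi_rev.
- by move=> j; apply: Xi_ge0.
- by move=> j; rewrite -[in LHS]revm Xi_rev.
Qed.

Lemma schur_middle A B Z : middle_trivial (val A) -> middle_trivial (val B) ->
  g B A Z != 0 -> middle_trivial (val Z).
Proof.
move=> mA mB nz; apply/negPn/negP => nZ; case/eqP: nz.
apply: schur_paths0 => p [J V1 V2 Js Ju f1 f2 r] /=.
apply/setP=> V; rewrite !inE; apply/negbTE; apply: contra nZ => /and3P[f /eqP eB /eqP eA].
have [sB _] := sum_middle mB; have [_ sA] := sum_middle mA.
apply: middle_trivial_sums; rewrite -r.
  by rewrite (sum_row_rel_pos _ f1 f2) -(sum_row_rel_pos _ f1 f) eB.
by rewrite (sum_col_rel_pos _ f1 f2) -(sum_col_rel_pos _ f f2) eA.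
Qed.

(** A diagonal position forces V = V1, so there is at most one flag to count. *)
Lemma schur_diag A B Z : is_diag_mx (val B) ->
    (forall j, \sum_i val B i j = \sum_i val A j i) ->
  g B A Z = (val A == val Z)%:Z%:P.
Proof.
move=> dB comp; apply: eq_poly_odd_primes => p pp po.
have [J V1 V2 Js Ju f1 f2 r] := ex_witness Z p.
rewrite -(schur_paths d0 schur B A pp po Js Ju f1 f2 r) hornerC.
have B0 V (a b : 'I_N) : rel_pos V1 V = val B -> a != b -> rel_pos V1 V a b = 0.
  by move=> -> ab; have /is_diag_mxP -> := dB.
have eV V : is_flag J V -> rel_pos V1 V = val B -> V = V1.
  move=> f eB; apply: mxflagP => i iN; apply: (fv_eqmx f f1).
    apply: (rel_pos_block f f1 iN) => a b ai ib; rewrite (rel_posC f1 f) mxE B0 //.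
    by apply/eqP=> e; move: ai; rewrite -e ltnNge ib.
  apply: (rel_pos_block f1 f iN) => a b ai ib; rewrite B0 //.
  by apply/eqP=> e; move: ai; rewrite e ltnNge ib.
congr Posz; case: eqP => [eA|nA] /=; last first.
  apply/eqP; rewrite cards_eq0; apply/eqP/setP => V; rewrite !inE.
  apply/negP => /and3P[f /eqP /(eV V f) -> /eqP e].
  by apply: nA; exact: (etrans (esym e) r).
rewrite -(cards1 V1); apply: eq_card => V; rewrite !inE.
apply/and3P/eqP => [[f /eqP /(eV V f)]|->] //; split=> //; last by rewrite r eA.
apply/eqP/eq_mx_row_sums => [i j ij|i].
  by rewrite (rel_pos_self f1 ij); have /is_diag_mxP -> := dB.
by rewrite (sum_row_rel_pos i f1 f1) -(sum_row_rel_pos i f1 f2) r -eA -comp sum_col_row_diag.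
Qed.

End MoreConstants.

(** * Laurent dependence on the shift *)

Section LaurentInV.

Lemma v_neq0 : v != 0.
Proof. by rewrite tofrac_eq0 polyX_eq0. Qed.

Lemma v_unit : v \is a GRing.unit.
Proof. by rewrite unitfE v_neq0. Qed.

Lemma vX_eq1 m : (0 < m)%N -> v ^+ m != 1.
Proof.
move=> m0; rewrite /v -tofracXn -tofrac1 tofrac_eq.
apply/eqP => /(congr1 (fun P : {poly int} => size P)).
by rewrite size_polyXn size_poly1 => -[] e; rewrite e in m0.
Qed.

Lemma v2_neq1 : v ^+ 2 - 1 != 0.
Proof. by rewrite subr_eq0 vX_eq1. Qed.

Lemma vX_inj : injective (fun p : nat => v ^+ p).
Proof.
have key p p' : (p <= p')%N -> v ^+ p = v ^+ p' -> p = p'.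
  move=> le e; apply/eqP; rewrite eqn_leq le /= leqNgt; apply/negP => lt.
  have := vX_eq1 (_ : 0 < p' - p)%N; rewrite subn_gt0 => /(_ lt) /eqP; apply.
  by apply: (mulIf (expf_neq0 p v_neq0)); rewrite -exprD subnK // mul1r.
move=> p p' e; case/orP: (leq_total p p') => le; first exact: key.
by apply: esym; apply: key.
Qed.

(* f p is a Laurent polynomial in v^p, evaluated at every p >= 0.             *)
Definition laurent_in (f : nat -> Qv) : Prop :=
  exists (P : {poly Qv}) (m : nat), forall p, f p * v ^+ (p * m) = P.[v ^+ p].

Lemma laurent_ext f f' : f =1 f' -> laurent_in f -> laurent_in f'.
Proof. by move=> e [P [m h]]; exists P, m => p; rewrite -e. Qed.

Lemma laurent_cst c : laurent_in (fun=> c).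
Proof. by exists c%:P, 0%N => p; rewrite muln0 expr0 mulr1 hornerC. Qed.

Lemma laurent_add f f' : laurent_in f -> laurent_in f' -> laurent_in (fun p => f p + f' p).
Proof.
move=> [P [m h]] [P' [m' h']]; exists (P * 'X^m' + P' * 'X^m), (m + m')%N => p.
rewrite hornerD !hornerM !hornerXn -h -h' -!exprM mulnDr exprD.
by rewrite mulrDl -!mulrA; congr (_ + _ * _); rewrite mulrC.
Qed.

Lemma laurent_mul f f' : laurent_in f -> laurent_in f' -> laurent_in (fun p => f p * f' p).
Proof.
move=> [P [m h]] [P' [m' h']]; exists (P * P'), (m + m')%N => p.
by rewrite hornerM -h -h' mulnDr exprD mulrACA.
Qed.

Lemma laurent_opp f : laurent_in f -> laurent_in (fun p => - f p).
Proof.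
move=> h; apply: laurent_ext (laurent_mul (laurent_cst (-1)) h) => p.
by rewrite mulN1r.
Qed.

Lemma laurent_sum (I : Type) (s : seq I) (P : pred I) (f : I -> nat -> Qv) :
  (forall i, laurent_in (f i)) -> laurent_in (fun p => \sum_(i <- s | P i) f i p).
Proof.
move=> h; elim: s => [|i s IH].
  by apply: laurent_ext (laurent_cst 0) => p; rewrite big_nil.
case Pi: (P i); last by apply: laurent_ext IH => p; rewrite big_cons Pi.
by apply: laurent_ext (laurent_add (h i) IH) => p; rewrite big_cons Pi.
Qed.

Lemma laurent_vX (a b : int) : laurent_in (fun p => v ^ (a + b * p%:Z)).
Proof.
exists ((v ^ a) *: 'X^(absz (b + Posz (absz b)))), (absz b) => p.
rewrite hornerZ hornerXn -exprM !exprnP -exprzDr ?v_unit // -exprzDr ?v_unit //.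
rewrite -addrA; congr (v ^ (a + _)).
have e : Posz (absz (b + Posz (absz b))) = b + Posz (absz b) by lia.
by rewrite !PoszM e; ring.
Qed.

Lemma laurent_eval (G : laurent') : laurent_in (fun p => laurent'_eval G (v ^ (- p%:Z))).
Proof.
apply: laurent_sum => k; apply: laurent_mul; first exact: laurent_cst.
apply: laurent_ext (laurent_vX 0 (- k)) => p.
by rewrite exprz_exp add0r; congr (v ^ _); ring.
Qed.

(** After clearing denominators the difference is a polynomial with roots v^p for infinitely many
    even p. These are distinct, so the polynomial is zero. *)
Lemma laurent_in_at0 f f' p0 : laurent_in f -> laurent_in f' ->
  (forall p, (p0 <= p)%N -> ~~ odd p -> f p = f' p) -> f 0 = f' 0.
Proof.
move=> lf lf' e; have [P [m h]] := laurent_add lf (laurent_opp lf').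
suff P0 : P = 0.
  by have := h 0%N; rewrite P0 horner0 mul0n expr0 mulr1 => /eqP; rewrite subr_eq0 => /eqP.
apply/eqP/negPn/negP => nz.
pose s := [seq v ^+ (p0 + i).*2 | i <- iota 0 (size P)].
have := max_poly_roots (rs := s) nz; rewrite size_map size_iota ltnn => k.
suff : false by [].
apply: k; last first.
  rewrite map_inj_uniq ?iota_uniq // => i j /vX_inj /double_inj /addnI.
  by [].
apply/allP=> _ /mapP[i _ ->]; rewrite rootE -h e ?subrr ?mul0r ?odd_double //.
by rewrite -addnn -addnA leq_addr.
Qed.

End LaurentInV.

Section DegreeShift.

Variable n : nat.
Local Notation N := (n.*2.+1).
Implicit Types M : 'M[int]_N.

Lemma Ibreve_diag (i j : 'I_N) : i != j -> Ibreve n i j = 0.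
Proof.
move=> ij; rewrite !mxE (negbTE ij) (_ : (_ == _) && _ = false) ?subrr //.
by apply/negP=> /andP[/eqP e1 /eqP e2]; rewrite e1 e2 eqxx in ij.
Qed.

(** A term in p^2 would need two diagonal entries in one product, and the index ranges of [dexp]
    never allow this; the last sum involves no diagonal entry at all. *)
Lemma dexp_shift M : exists c, forall p : nat, dexp (M + Ibreve n *+ p) = dexp M + c * p%:Z.
Proof.
pose I := Ibreve n.
have ME (p : nat) i j : (M + I *+ p) i j = M i j + I i j * p%:Z.
  by rewrite mxE mulmxnE -mulr_natr natz.
pose c1 := \sum_(i < N) \sum_(j < N) \sum_(k < N | (k < i)%N)
     \sum_(l < N | (j < l)%N && (i + k < n.*2)%N) (M i j * I k l + I i j * M k l).
pose c2 := \sum_(i < N) \sum_(j < N)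
     \sum_(l < N | (j < l)%N && ((i < n)%N || (j + l < n.*2)%N)) (M i j * I i l + I i j * M i l).
exists (c1 + c2) => p.
have expand (x y x' y' : int) : y * y' = 0 ->
    (x + y * p%:Z) * (x' + y' * p%:Z) = x * x' + (x * y' + y * x') * p%:Z.
  move=> z; rewrite -[RHS]addr0 -(mul0r (p%:Z * p%:Z)) -z; ring.
rewrite /dexp -/I mulrDl [RHS]addrAC; congr (_ + _); last first.
  apply: eq_bigr => i ni; apply: eq_bigr => j jn; rewrite ME /I Ibreve_diag ?mul0r ?addr0 //.
  by apply/eqP=> e; move: jn; rewrite -e ltnNge ni.
rewrite addrACA; congr (_ + _).
  rewrite /c1 mulr_suml -big_split; apply: eq_bigr => i _ /=.
  rewrite mulr_suml -big_split; apply: eq_bigr => j _ /=.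
  rewrite mulr_suml -big_split; apply: eq_bigr => k ki /=.
  rewrite mulr_suml -big_split; apply: eq_bigr => l /andP[jl _] /=.
  rewrite !ME expand //; case: (eqVneq i j) => [ij|ij]; last by rewrite /I Ibreve_diag ?mul0r.
  rewrite /I (@Ibreve_diag k l) ?mulr0 //; apply/eqP=> kl.
  by move: ki jl; rewrite kl ij; case: ltngtP.
rewrite /c2 mulr_suml -big_split; apply: eq_bigr => i _ /=.
rewrite mulr_suml -big_split; apply: eq_bigr => j _ /=.
rewrite mulr_suml -big_split; apply: eq_bigr => l /andP[jl _] /=.
rewrite !ME expand //; case: (eqVneq i j) => [ij|ij]; last by rewrite /I Ibreve_diag ?mul0r.
rewrite /I (@Ibreve_diag i l) ?mulr0 //; apply/eqP=> il.
by move: jl; rewrite -ij -il ltnn.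
Qed.

End DegreeShift.

(** * Coefficients of products *)

Section Evaluation.

Definition evq (P : {poly int}) : Qv := val (at_v2 P).

Lemma at_v2M P Q : at_v2 (P * Q) = at_v2 P * at_v2 Q.
Proof. by rewrite /at_v2 rmorphM hornerM. Qed.

Lemma at_v2_sum (I : Type) (r : seq I) (P : pred I) (F : I -> {poly int}) :
  at_v2 (\sum_(i <- r | P i) F i) = \sum_(i <- r | P i) at_v2 (F i).
Proof. by rewrite /at_v2 rmorph_sum horner_sum. Qed.

Lemma evqM P Q : evq (P * Q) = evq P * evq Q.
Proof. by rewrite /evq at_v2M rmorphM. Qed.

Lemma evq_sum (I : Type) (r : seq I) (P : pred I) (F : I -> {poly int}) :
  evq (\sum_(i <- r | P i) F i) = \sum_(i <- r | P i) evq (F i).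
Proof. by rewrite /evq at_v2_sum rmorph_sum. Qed.

Lemma evqB P Q : evq (P - Q) = evq P - evq Q.
Proof. by rewrite /evq /at_v2 rmorphB hornerD hornerN rmorphB. Qed.

Lemma evqZ c P : evq (c *: P) = c%:~R * evq P.
Proof.
rewrite /evq /at_v2 map_polyZ hornerZ rmorphM; congr (_ * _).
exact: (rmorph_int (val : Av -> Qv)).
Qed.

Lemma evqXn k : evq 'X^k = v ^ (2 * k%:Z).
Proof.
rewrite /evq /at_v2 map_polyXn hornerXn rmorphXn /=.
by rewrite exprnP exprz_exp.
Qed.

Lemma evqC c : evq c%:P = c%:~R.
Proof. by rewrite /evq /at_v2 map_polyC hornerC; exact: (rmorph_int (val : Av -> Qv)). Qed.

End Evaluation.

Lemma mcoeff_sum (K : choiceType) (R : zmodType) (I : Type) (r : seq I) (P : pred I)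
    (F : I -> {malg R[K]}) k :
  (\sum_(i <- r | P i) F i)@_k = \sum_(i <- r | P i) (F i)@_k.
Proof. exact: (raddf_sum (mcoeff k)). Qed.

Lemma mcoeffZU (K : choiceType) (R : nzRingType) (c : R) (E Z : K) :
  (c *: << E >>)@_Z = c * (E == Z)%:R.
Proof. by rewrite mcoeffZ mcoeffU. Qed.

Lemma mcoeffZD (K : choiceType) (R : nzRingType) (c : R) (x y : {malg R[K]}) (k : K) :
  (c *: x + y)@_k = c * x@_k + y@_k.
Proof. by rewrite mcoeffD mcoeffZ. Qed.

Section Convolution.

Variables (n d : nat) (g : structure_constants n).
Implicit Types x y z : Sj n d.

Lemma convolution_coef x y (Z : Xi n d) : (convolution g x y)@_Z
  = \sum_(A : Xi n d) \sum_(A' : Xi n d) x@_A * y@_A' * at_v2 (g A A' Z).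
Proof.
rewrite /convolution mcoeff_sum; apply: eq_bigr => A _.
rewrite mcoeff_sum; apply: eq_bigr => A' _.
rewrite mcoeff_sum (eq_bigr _ (fun E _ => mcoeffZU _ E Z)).
rewrite (bigD1 Z) //= eqxx mulr1 big1 ?addr0 // => E EZ.
by rewrite (negbTE EZ) mulr0.
Qed.

Lemma convolution_linl a x y z :
  convolution g (a *: x + y) z = a *: convolution g x z + convolution g y z.
Proof.
apply/malgP=> Z; apply: (etrans (convolution_coef _ _ _)).
apply/esym; apply: (etrans (mcoeffZD _ _ _ _)); apply/esym.
pose S (u : Sj n d) := \sum_(A : Xi n d) \sum_(A' : Xi n d) u@_A * z@_A' * at_v2 (g A A' Z).
transitivity (a * S x + S y); last by congr (a * _ + _); apply/esym/convolution_coef.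
rewrite /S mulr_sumr -big_split; apply: eq_bigr => A _ /=.
rewrite mulr_sumr -big_split; apply: eq_bigr => A' _ /=.
apply: (etrans (congr1 (fun t => t * _ * _) (mcoeffZD a x y A))).
by rewrite !mulrDl !mulrA.
Qed.

Lemma convolution_linr a x y z :
  convolution g z (a *: x + y) = a *: convolution g z x + convolution g z y.
Proof.
apply/malgP=> Z; apply: (etrans (convolution_coef _ _ _)).
apply/esym; apply: (etrans (mcoeffZD _ _ _ _)); apply/esym.
pose S (u : Sj n d) := \sum_(A : Xi n d) \sum_(A' : Xi n d) z@_A * u@_A' * at_v2 (g A A' Z).
transitivity (a * S x + S y); last by congr (a * _ + _); apply/esym/convolution_coef.
rewrite /S mulr_sumr -big_split; apply: eq_bigr => A _ /=.
rewrite mulr_sumr -big_split; apply: eq_bigr => A' _ /=.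
apply: (etrans (congr1 (fun t => _ * t * _) (mcoeffZD a x y A'))).
by rewrite mulrDr mulrDl !mulrA (mulrC a).
Qed.

Lemma convolutionA : (0 < d)%N -> is_schur_constants g ->
  associative (fun x y : Sj n d => convolution g x y).
Proof.
move=> d0 schur x y z; apply/malgP=> Z.
apply: (etrans (convolution_coef x (convolution g y z) Z)).
apply/esym; apply: (etrans (convolution_coef (convolution g x y) z Z)); apply/esym.
transitivity (\sum_(A : Xi n d) \sum_(B : Xi n d) \sum_(C : Xi n d)
    x@_A * y@_B * z@_C * at_v2 (\sum_(E : Xi n d) g B C E * g A E Z)).
  apply: eq_bigr => A _; transitivity (\sum_(E : Xi n d) \sum_(B : Xi n d)
      \sum_(C : Xi n d) x@_A * y@_B * z@_C * (at_v2 (g B C E) * at_v2 (g A E Z))).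
    apply: eq_bigr => E _.
    apply: (etrans (congr1 (fun t => _ * t * _) (convolution_coef y z E))).
    rewrite mulr_sumr mulr_suml; apply: eq_bigr => B _.
    rewrite mulr_sumr mulr_suml; apply: eq_bigr => C _.
    by rewrite !mulrA.
  rewrite exchange_big; apply: eq_bigr => B _; rewrite exchange_big; apply: eq_bigr => C _.
  rewrite at_v2_sum mulr_sumr; apply: eq_bigr => E _.
  by rewrite at_v2M.
transitivity (\sum_(A : Xi n d) \sum_(B : Xi n d) \sum_(C : Xi n d)
    x@_A * y@_B * z@_C * at_v2 (\sum_(E : Xi n d) g A B E * g E C Z)).
  apply: eq_bigr => A _; apply: eq_bigr => B _; apply: eq_bigr => C _.
  by rewrite (schur_assoc d0 schur).
apply/esym; transitivity (\sum_(E : Xi n d) \sum_(C : Xi n d) \sum_(A : Xi n d)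
      \sum_(B : Xi n d) x@_A * y@_B * z@_C * (at_v2 (g A B E) * at_v2 (g E C Z))).
  apply: eq_bigr => E _; apply: eq_bigr => C _.
  apply: (etrans (congr1 (fun t => t * _ * _) (convolution_coef x y E))).
  rewrite !mulr_suml; apply: eq_bigr => A _.
  rewrite !mulr_suml; apply: eq_bigr => B _.
  by rewrite -!mulrA; do 2 congr (_ * _); apply: mulrCA.
under eq_bigr => E _ do rewrite exchange_big.
rewrite exchange_big; apply: eq_bigr => A _.
under eq_bigr => E _ do rewrite exchange_big.
rewrite exchange_big; apply: eq_bigr => B _.
rewrite exchange_big; apply: eq_bigr => C _.
rewrite at_v2_sum mulr_sumr; apply: eq_bigr => E _.
by rewrite at_v2M.
Qed.

Lemma stdXi_coef (A B : Xi n d) : (stdXi A)@_B = vexp (- dexp (val A)) * (A == B)%:R.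
Proof. exact: mcoeffZU. Qed.

Lemma val_stdXi_coef (A B : Xi n d) : val (stdXi A)@_B = v ^ (- dexp (val A)) * (A == B)%:R.
Proof.
rewrite stdXi_coef; case: (A == B); last by rewrite !mulr0 rmorph0.
by rewrite !mulr1.
Qed.

Lemma std_val (A : Xi n d) : std d (val A) = stdXi A.
Proof. by rewrite /std valK. Qed.

Lemma convolution_std (B A Z : Xi n d) :
  val (convolution g (stdXi B) (stdXi A))@_Z
  = v ^ (- dexp (val B) - dexp (val A)) * evq (g B A Z).
Proof.
have -> : (convolution g (stdXi B) (stdXi A))@_Z
    = vexp (- dexp (val B)) * vexp (- dexp (val A)) * at_v2 (g B A Z).
  apply: (etrans (convolution_coef _ _ _)).
  transitivity (\sum_(E : Xi n d) \sum_(E' : Xi n d) vexp (- dexp (val B)) * (B == E)%:R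
      * (vexp (- dexp (val A)) * (A == E')%:R) * at_v2 (g E E' Z)).
    apply: eq_bigr => E _; apply: eq_bigr => E' _.
    exact: (congr2 (fun s t => s * t * _) (stdXi_coef B E) (stdXi_coef A E')).
  rewrite (bigD1 B) //= [X in _ + X]big1 ?addr0; last first.
    by move=> E EB; apply: big1 => E' _; rewrite eq_sym (negbTE EB) mulr0 !mul0r.
  rewrite (bigD1 A) //= [X in _ + X]big1 ?addr0; last first.
    by move=> E EB; rewrite [A == E]eq_sym (negbTE EB) !mulr0 mul0r.
  by rewrite !eqxx !mulr1.
rewrite /evq; set c := at_v2 _.
have e : val (vexp (- dexp (val B)) * vexp (- dexp (val A)))
   = v ^ (- dexp (val B)) * v ^ (- dexp (val A)) by rewrite rmorphM.
by rewrite exprzDr ?v_unit // -e rmorphM.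
Qed.

End Convolution.

(** * Shifting matrices of K into the Schur algebras *)

Section Shifts.

Variable n : nat.
Local Notation N := (n.*2.+1).
Implicit Types A B Z : iXit n.

Definition entry_sum (M : 'M[int]_N) : int := \sum_i \sum_j M i j.

Lemma shiftE (M : 'M[int]_N) (p : nat) i j :
  (M + Ibreve n *+ p) i j = M i j + ((i == j) && (i != middle n))%:Z * p%:Z.
Proof.
rewrite mxE mulmxnE -mulr_natr natz; congr (_ + _ * _); rewrite !mxE.
case: (eqVneq i j) => [<-|ij] /=; first by case: eqVneq.
rewrite (_ : (i == middle n) && _ = false) ?subrr //.
by apply/negP => /andP[/eqP e1 /eqP e2]; rewrite e1 e2 eqxx in ij.
Qed.

Lemma iXit_off_ge0 A i j : i != j -> 0 <= val A i j.
Proof.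
by move=> ij; case/and3P: (valP A) => /forallP/(_ i)/forallP/(_ j)/implyP -> .
Qed.

Lemma iXit_rev A i j : val A (rev_ord i) (rev_ord j) = val A i j.
Proof. by case/and3P: (valP A) => _ /forallP/(_ i)/forallP/(_ j)/eqP. Qed.

Lemma iXit_middle A : middle_trivial (val A).
Proof. by case/and3P: (valP A). Qed.

Lemma rev_middle : rev_ord (middle n) = middle n.
Proof. by apply: val_inj; rewrite /= inordK; lia. Qed.

Lemma middle_shift (M : 'M[int]_N) p : middle_trivial M -> middle_trivial (M + Ibreve n *+ p).
Proof.
move/forallP=> h; apply/forallP=> i; have /andP[/eqP e1 /eqP e2] := h i.
by rewrite !shiftE e1 e2 andbN eqxx andbF !mul0r !addr0 eqxx.
Qed.

Lemma entry_sum_shift (M : 'M[int]_N) (p : nat) :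
  entry_sum (M + Ibreve n *+ p) = entry_sum M + (n.*2 * p)%N%:Z.
Proof.
rewrite /entry_sum; under eq_bigr do under eq_bigr do rewrite shiftE.
under eq_bigr do rewrite big_split /=.
rewrite big_split /=; congr (_ + _).
transitivity (\sum_(i < N) (i != middle n)%:Z * p%:Z).
  apply: eq_bigr => i _; rewrite -mulr_suml; congr (_ * _).
  rewrite (bigD1 i) //= eqxx big1 ?addr0 // => j ji.
  by rewrite eq_sym (negbTE ji).
rewrite -mulr_suml PoszM; congr (_ * _).
rewrite (bigD1 (middle n)) //= eqxx add0r (eq_bigr (fun=> 1)); last by move=> i ->.
rewrite sumr_const natz; congr Posz.
by rewrite (eq_card (B := predC1 (middle n))) // cardC1 card_ord.
Qed.

(** Rows pair off under the half turn and the middle row sums to 1. So a large shift has an entry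
    sum of the form 2d + 1. *)
Lemma entry_sum_odd A : exists m : int, entry_sum (val A) = 2 * m + 1.
Proof.
pose r i := \sum_j val A i j.
have rr i : r (rev_ord i) = r i.
  rewrite /r (reindex_inj rev_ord_inj) /=; apply: eq_bigr => j _; exact: iXit_rev.
have [rm _] := sum_middle (iXit_middle A).
exists (\sum_(i < N | (i < n)%N) r i).
rewrite /entry_sum -/(r _) (bigID (fun i : 'I_N => (i < n)%N)) /=.
rewrite [X in _ + X](bigD1 (middle n)) /=; last by rewrite inordK; lia.
rewrite -/(r (middle n)) [r (middle n)]rm.
rewrite [X in _ + (_ + X)](reindex_inj rev_ord_inj) /=.
rewrite [X in _ + (_ + X)](_ : _ = \sum_(i < N | (i < n)%N) r i); first by rewrite /r; ring.
apply: eq_big => [i|i _]; last exact: rr.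
rewrite -val_eqE /= inordK; last by lia.
by have := ltn_ord i; lia.
Qed.

Definition diag_bound A : nat := (\sum_i `|val A i i|)%N.

Lemma shift_in_Xi A p d : (diag_bound A <= p)%N ->
  entry_sum (val A) + (n.*2 * p)%N%:Z = (d.*2.+1)%:Z -> in_Xi d (val A + Ibreve n *+ p).
Proof.
move=> pA es; apply/and3P; split.
- apply/forallP=> i; apply/forallP=> j; rewrite shiftE.
  case: (eqVneq i j) => [<-|ij] /=; last by rewrite mul0r addr0 iXit_off_ge0.
  case: (eqVneq i (middle n)) => [->|im] /=.
    have /forallP/(_ (middle n))/andP[/eqP-> _] := iXit_middle A.
    by rewrite mul0r addr0 eqxx.
  have : (`|val A i i| <= p)%N.
    by apply: leq_trans pA; rewrite /diag_bound (bigD1 i) //= leq_addr.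
  rewrite mul1r; move: (val A i i) => x; clear; lia.
- by rewrite -/(entry_sum _) entry_sum_shift es.
apply/forallP=> i; apply/forallP=> j; apply/eqP; rewrite !shiftE iXit_rev.
by rewrite (inj_eq rev_ord_inj) -{2}rev_middle (inj_eq rev_ord_inj).
Qed.

Lemma composable_sums A B : composable A B ->
  forall j, \sum_i val A i j = \sum_i val B j i.
Proof. by move/forallP=> h j; apply/eqP/h. Qed.

Lemma composable_entry_sum A B : composable A B -> entry_sum (val A) = entry_sum (val B).
Proof.
move/composable_sums => h; rewrite /entry_sum exchange_big.
by apply: eq_bigr => j _; rewrite h.
Qed.

Lemma large_shift A : (0 < n)%N -> exists b : nat, forall p, (b <= p)%N ->
  exists2 d, (0 < d)%N & entry_sum (val A) + (n.*2 * p)%N%:Z = (d.*2.+1)%:Z.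
Proof.
move=> n0; have [m e] := entry_sum_odd A; exists (absz m).+1 => p pb.
have [k ek] : exists k : nat, m + (n * p)%N%:Z = k%:Z /\ (0 < k)%N.
  have : (p <= n * p)%N by rewrite leq_pmull.
  move: (n * p)%N => x xp; exists (absz (m + x%:Z)); clear -pb xp; lia.
exists k; first by case: ek.
by case: ek => ek _; rewrite e -doubleMl; clear -ek; lia.
Qed.

End Shifts.

Section ProductInK.

Variables (n : nat) (g : structure_constants n) (mulK : Ki n -> Ki n -> Ki n).
Hypotheses (n0 : (0 < n)%N) (Kmul : is_Kmul g mulK).
Local Notation N := (n.*2.+1).
Implicit Types A B Z : iXit n.

(** The Laurent polynomials G of the product in K and the function f both compute the constants of
    the Schur algebras at all large even shifts p, so they agree at p = 0, where v^(-p) is 1. *)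
Lemma Kmul_coef B A Z (f : nat -> Qv) : composable B A -> laurent_in f ->
    (forall p d (B' A' Z' : Xi n d), (0 < d)%N -> val B' = val B + Ibreve n *+ p ->
       val A' = val A + Ibreve n *+ p -> val Z' = val Z + Ibreve n *+ p ->
       v ^ (dexp (val Z') - dexp (val B') - dexp (val A')) * evq (g B' A' Z') = f p) ->
    (entry_sum (val Z) <> entry_sum (val A) -> f 0%N = 0) ->
  val (mulK << B >> << A >>)@_Z = f 0%N.
Proof.
move=> cBA lf fE f0; case: Kmul => _ _ _ _ /(_ B [:: A]); rewrite /= cBA => /(_ isT).
case=> ZG [/(_ Z) -> [p0 e2]].
pose fG p := \sum_(zg <- ZG | zg.1 == Z) laurent'_eval zg.2 (v ^ (- p%:Z)).
have -> : \sum_(zg <- ZG | zg.1 == Z) laurent'_eval zg.2 1 = fG 0%N.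
  by apply: eq_bigr => zg _; rewrite oppr0 expr0z.
have [bA hA] := large_shift A n0.
have eBA := composable_entry_sum cBA.
(* With equal entry sums, Z shifted by p lies in the same Xi as the factors, and its coefficient
   there can be compared. *)
case: (eqVneq (entry_sum (val Z)) (entry_sum (val A))) => [eZ|nZ].
  apply: (laurent_in_at0 (p0 := p0 + bA + diag_bound A + diag_bound B + diag_bound Z)) => //.
    by apply: laurent_sum => zg; apply: laurent_eval.
  move=> p pb po; have [|d d0 es] := hA p; first by clear -pb; lia.
  have xB : in_Xi d (val B + Ibreve n *+ p).
    by apply: shift_in_Xi; rewrite ?eBA //; clear -pb; lia.
  have xA : in_Xi d (val A + Ibreve n *+ p).
    by apply: shift_in_Xi => //; clear -pb; lia.
  have xZ : in_Xi d (val Z + Ibreve n *+ p).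
    by apply: shift_in_Xi; rewrite ?eZ //; clear -pb; lia.
  have pp0 : (p0 <= p)%N by clear -pb; lia.
  have := e2 p d pp0 po; rewrite xB xA => /(_ isT) [allZG /(_ (MkXi xZ))].
  have -> : std d (val B + Ibreve n *+ p) = stdXi (MkXi xB) by exact: (std_val (MkXi xB)).
  have -> : std d (val A + Ibreve n *+ p) = stdXi (MkXi xA) by exact: (std_val (MkXi xA)).
  rewrite convolution_std => e.
  rewrite -(fE p d (MkXi xB) (MkXi xA) (MkXi xZ)) //=.
  have -> : dexp (val Z + Ibreve n *+ p) - dexp (val B + Ibreve n *+ p)
      - dexp (val A + Ibreve n *+ p) = dexp (val Z + Ibreve n *+ p)
      + (- dexp (val B + Ibreve n *+ p) - dexp (val A + Ibreve n *+ p)) by rewrite addrA.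
  rewrite exprzDr ?v_unit // -mulrA e mulr_sumr /fG big_mkcond.
  rewrite big_seq_cond [RHS]big_seq_cond; apply: eq_bigr => zg /andP[zgZ _].
  have xz := allP allZG _ zgZ.
  have -> : std d (val zg.1 + Ibreve n *+ p) = stdXi (MkXi xz) by exact: (std_val (MkXi xz)).
  rewrite val_stdXi_coef.
  rewrite (_ : (MkXi xz == MkXi xZ) = (zg.1 == Z)); last first.
    by rewrite -val_eqE /= (inj_eq (addIr _)) val_eqE.
  case: eqVneq => [zZ|_]; last by rewrite !mulr0.
  rewrite /= zZ mulr1 mulrCA -exprzDr ?v_unit // subrr expr0z mulr1.
  by [].
(* With different entry sums Z cannot occur in [ZG], whose members all shift into the Xi of the
   factors. *)
rewrite f0; last exact/eqP.
apply: big1_seq => zg /andP[/eqP zZ zgZ].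
pose p := (p0 + bA + diag_bound A + diag_bound B).*2.
have [|d d0 es] := hA p; first by rewrite /p; clear; lia.
have xB : in_Xi d (val B + Ibreve n *+ p).
  by apply: shift_in_Xi; rewrite ?eBA // /p; clear; lia.
have xA : in_Xi d (val A + Ibreve n *+ p).
  by apply: shift_in_Xi => //; rewrite /p; clear; lia.
have pp0 : (p0 <= p)%N by rewrite /p; clear; lia.
have po : ~~ odd p by rewrite odd_double.
have := e2 p d pp0 po; rewrite xB xA => /(_ isT) [allZG _].
have := allP allZG _ zgZ => /and3P[_ /eqP + _]; rewrite zZ.
rewrite -/(entry_sum _) entry_sum_shift -es => /addIr /eqP; rewrite (negbTE nZ).
by [].
Qed.

End ProductInK.

(** * The constants of a step as a formula in the entries *)

Section StepCoefficients.

Variable n : nat.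
Hypothesis n0 : (0 < n)%N.
Local Notation N := (n.*2.+1).
Implicit Types M A B Z lam : 'M[int]_N.

Lemma is_step_bounds a b : is_step n a b ->
  [/\ (0 < a)%N, (a < b)%N, (b <= N)%N, b.-1 != n & (b.-1 != n.*2 - b.-1)%N].
Proof.
case/orP=> [/and4P[/eqP-> /andP[a0 aN] an an1]|/andP[/eqP-> /eqP->]]; split=> //=; lia.
Qed.

Lemma moveE a b M k (i j : 'I_N) : is_step n a b -> (k < N)%N ->
  move a b M k i j = M i j
   - ((((i : nat) == b.-1) && ((j : nat) == k))%:Z
      + (((i : nat) == n.*2 - b.-1)%N && ((j : nat) == n.*2 - k)%N)%:Z)
   + ((((i : nat) == a.-1) && ((j : nat) == k))%:Z
      + (((i : nat) == n.*2 - a.-1)%N && ((j : nat) == n.*2 - k)%N)%:Z).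
Proof.
move=> st kN; have [a0 ab bN _ _] := is_step_bounds st.
have addE (C E F : 'M[int]_N) : (C - E + F) i j = C i j - E i j + F i j by rewrite !mxE.
by rewrite /move addE !dthE //; clear -a0 ab bN; lia.
Qed.

Lemma psum_shift M (p : nat) i j :
  psum (M + Ibreve n *+ p) i j = psum M i j + psum (Ibreve n) i j * p%:Z.
Proof.
rewrite /psum mulr_suml -big_split; apply: eq_bigr => a _ /=.
rewrite mulr_suml -big_split; apply: eq_bigr => b _ /=.
by rewrite mxE mulmxnE -mulr_natr natz.
Qed.

Lemma pre_shift a b M (p : nat) k :
  pre a b (M + Ibreve n *+ p) k = pre a b M k + pre a b (Ibreve n) k * p%:Z.
Proof. by rewrite /pre !psum_shift; ring. Qed.

Lemma move_shift a b M (p : nat) k :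
  move a b (M + Ibreve n *+ p) k = move a b M k + Ibreve n *+ p.
Proof. by rewrite /move (addrAC M) [LHS]addrAC. Qed.

Lemma preE a b M k : (a <= b)%N ->
  pre a b M k = \sum_(a <= r < b) \sum_(0 <= c < k) M (inord r) (inord c).
Proof.
by move=> ab; rewrite /pre /psum [X in X - _](big_cat_nat (n := a)) //= [LHS]addrC addKr.
Qed.

Lemma preS a b M (k : 'I_N) : (a <= b)%N ->
  pre a b M k.+1 = pre a b M k + \sum_(a <= r < b) M (inord r) k.
Proof.
move=> ab; rewrite !preE // -big_split; apply: eq_bigr => r _.
by rewrite big_nat_recr //= inord_val.
Qed.

Lemma pre0 a b M : pre a b M 0 = 0.
Proof. by rewrite /pre /psum !big1 ?subr0 // => i _; rewrite big_geq. Qed.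

(* The rows between a and b carry at most the middle row besides row b - 1. *)
Lemma sum_step_rows a b M (k : 'I_N) : is_step n a b -> middle_trivial M ->
  \sum_(a <= r < b) M (inord r) k = M (inord b.-1) k + ((a == n) && (k == middle n))%:Z.
Proof.
move=> st /forallP/(_ k)/andP[/eqP mk _].
case/orP: st => [/and4P[/eqP-> _ an _]|/andP[/eqP-> /eqP->]].
  by rewrite big_nat1 (negbTE an) addr0.
rewrite big_ltn // big_nat1 eqxx /= -/(middle n) mk natz addrC; by [].
Qed.

(* The entries of A and Z may be negative here, as they are in K. *)
Definition cstep a b A Z : Qv :=
  (\sum_(k < N) (A == move a b Z k)%:R * (v ^ (2 * pre a b Z k.+1) - v ^ (2 * pre a b Z k)))
    / (v ^+ 2 - 1) - ((a == n) && (A == Z))%:R.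

Lemma entry_sum_move a b M k : entry_sum (move a b M k) = entry_sum M.
Proof.
rewrite /entry_sum; under eq_bigr do rewrite sum_row_move.
have s (x : 'I_N) : \sum_i (i == x)%:Z = 1.
  by rewrite (bigD1 x) //= eqxx big1 ?addr0 // => i /negbTE->.
by rewrite big_split sumrB !big_split /= !s subrK.
Qed.

Lemma cstep_entry_sum a b A Z : entry_sum Z <> entry_sum A -> cstep a b A Z = 0.
Proof.
move=> ne; rewrite /cstep big1 ?mul0r ?sub0r => [|k _]; last first.
  case: eqP => [e|]; last by rewrite mul0r.
  by case: ne; rewrite e entry_sum_move.
case: (A =P Z) => [e|]; first by case: ne; rewrite e.
by rewrite andbF oppr0.
Qed.

Lemma cstep_laurent a b A Z :
  laurent_in (fun p => cstep a b (A + Ibreve n *+ p) (Z + Ibreve n *+ p)).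
Proof.
apply: laurent_ext (_ : laurent_in (fun p => (\sum_(k < N) (A == move a b Z k)%:R *
    (v ^ (2 * pre a b Z k.+1 + 2 * pre a b (Ibreve n) k.+1 * p%:Z)
     - v ^ (2 * pre a b Z k + 2 * pre a b (Ibreve n) k * p%:Z))) / (v ^+ 2 - 1)
     - ((a == n) && (A == Z))%:R)).
  move=> p; rewrite /cstep (inj_eq (addIr _)); congr (_ / _ - _).
  apply: eq_bigr => k _; rewrite move_shift (inj_eq (addIr _)) !pre_shift.
  by congr (_ * (v ^ _ - v ^ _)); ring.
apply: laurent_add (laurent_cst _); apply: laurent_mul (laurent_cst _).
apply: laurent_sum => k; apply: laurent_mul (laurent_cst _) _.
by apply: laurent_add (laurent_vX _ _) _; apply: laurent_opp; apply: laurent_vX.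
Qed.

Lemma evq_step d g a b lam (A B Z : Xi n d) : (0 < d)%N -> is_schur_constants g ->
    is_step n a b -> is_diag_mx lam -> val B = lam + dth n b.-1 a.-1 ->
    (forall j, \sum_i val B i j = \sum_i val A j i) -> middle_trivial (val Z) ->
  evq (g d B A Z) = cstep a b (val A) (val Z).
Proof.
move=> d0 schur st dl eB comp mZ.
have := congr1 evq (schur_step n0 d0 schur st dl eB comp mZ).
have eX : evq ('X - 1) = v ^+ 2 - 1.
  by rewrite evqB -[X in evq X]expr1 evqXn -[X in evq X]polyC1 evqC mulr1.
rewrite evqM eX evqB evq_sum evqZ eX => e.
rewrite -[LHS](mulfK v2_neq1) e /cstep mulrBl mulfK ?v2_neq1 //; congr (_ / _ - _).
have [_ ab _ _ _] := is_step_bounds st.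
apply: eq_bigr => k _; rewrite evqZ evqB !evqXn.
have pos m : Posz (absz (pre a b (val Z) m)) = pre a b (val Z) m.
  apply: gez0_abs; rewrite preE; last exact: ltnW.
  by apply: sumr_ge0 => r _; apply: sumr_ge0 => c _; apply: Xi_ge0.
by rewrite !pos; case: (_ == _).
Qed.

(** If row b - 1 vanishes, [pre] is constant except for the jump from 0 to 1 given by the middle row
    when a = n; that single summand is then cancelled by the correction term. *)
Lemma cstep_row0 a b A Z : is_step n a b -> middle_trivial Z ->
  (forall j, Z (inord b.-1) j = 0) -> cstep a b A Z = 0.
Proof.
move=> st mZ r0; have [_ ab _ _ _] := is_step_bounds st.
have ab' := ltnW ab.
have eS (k : 'I_N) : pre a b Z k.+1 = pre a b Z k + ((a == n) && (k == middle n))%:Z.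
  by rewrite preS // sum_step_rows // r0 add0r.
rewrite /cstep; case: (eqVneq a n) => [ea|an]; last first.
  rewrite big1 ?mul0r ?subr0 //= => k _.
  by rewrite eS (negbTE an) addr0 subrr mulr0.
have eb : b = n.+2.
  by case/orP: st => [/and4P[_ _]|/andP[_ /eqP]] //; rewrite ea eqxx.
have low m : (m <= n)%N -> pre a b Z m = 0.
  elim: m => [|m IH] mn; first exact: pre0.
  have mN : (m < N)%N by clear -mn; lia.
  rewrite (eS (Ordinal mN)) IH ?(ltnW mn) // ea eqxx add0r /=.
  by rewrite -val_eqE /= inordK; [clear -mn; lia | clear; lia].
have eM : pre a b Z (middle n) = 0 by apply: low; rewrite inordK; clear; lia.
rewrite (bigD1 (middle n)) //= big1 ?addr0; last first.
  by move=> k /negbTE km; rewrite eS km andbF addr0 subrr mulr0.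
rewrite eS eM ea eqxx eqxx /= mulr0 mulr1 expr0z.
have -> : move n b Z (middle n) = Z.
  by rewrite eb -[RHS](move_mid Z n0) /middle inordK //; clear; lia.
by rewrite mulfK ?v2_neq1 // subrr.
Qed.

(** A summand survives only where [pre] changes. This happens at a nonzero entry of row b - 1, or in
    the middle column, where the move is trivial and A = Z. *)
Lemma cstep_support a b A Z : is_step n a b -> middle_trivial Z -> cstep a b A Z != 0 ->
  A = Z \/ exists2 k : 'I_N, A = move a b Z k & Z (inord b.-1) k != 0.
Proof.
move=> st mZ nz; have [_ ab _ _ _] := is_step_bounds st.
have ab' := ltnW ab.
case: (eqVneq A Z) => [|AZ]; [by left | right].
case: (pickP (fun k : 'I_N => (A == move a b Z k) && (Z (inord b.-1) k != 0))) => [k|no].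
  by case/andP=> /eqP eA Zk; exists k.
case/negP: nz; apply/eqP; rewrite /cstep (negbTE AZ) andbF subr0 big1 ?mul0r // => k _.
have := no k; case: eqP => [eA|]; last by rewrite mul0r.
rewrite /= => /negbFE/eqP Z0; rewrite preS // sum_step_rows // Z0 add0r.
case: (eqVneq a n) => [ea|]; last by rewrite addr0 subrr mulr0.
case: (eqVneq k (middle n)) => [ek|]; last by rewrite addr0 subrr mulr0.
have eb : b = n.+2.
  by case/orP: st => [/and4P[_ _]|/andP[_ /eqP]] //; rewrite ea eqxx.
case/eqP: AZ; rewrite eA ek ea eb -[RHS](move_mid Z n0) /middle inordK //; clear; lia.
Qed.

(** A move lowers only the entry (b - 1, k) and its mirror image. These are distinct positions, and
    by [cstep_support] the entry there is positive. *)
Lemma cstep_nonneg a b A Z : is_step n a b -> middle_trivial Z -> (forall i j, 0 <= Z i j) ->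
  (forall i j, Z (rev_ord i) (rev_ord j) = Z i j) ->
  cstep a b A Z != 0 -> forall i j, 0 <= A i j.
Proof.
move=> st mZ Z0 Zr nz i j; case: (cstep_support st mZ nz) => [->|[k -> Zk]] //.
have [a0 ab bN bn bb] := is_step_bounds st.
have Zk1 : 1 <= Z (inord b.-1) k by have := Z0 (inord b.-1) k; move: Zk; clear; lia.
rewrite moveE //.
have bN' : (b.-1 < N)%N by clear -a0 ab bN; lia.
have iN := ltn_ord i; have jN := ltn_ord j; have kN := ltn_ord k.
have y0 (b1 b2 : bool) : 0 <= b1%:Z + b2%:Z by [].
apply: addr_ge0 => //; rewrite subr_ge0.
case: (boolP (((i : nat) == b.-1) && ((j : nat) == k))) => [/andP[/eqP ib /eqP jk]|_].
  have ei : i = inord b.-1 by apply: val_inj; rewrite /= inordK.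
  have ej : j = k by apply: val_inj.
  by rewrite ib (negbTE bb) addr0 ei ej.
case: (boolP (((i : nat) == _) && _)) => [/andP[/eqP ib /eqP jk]|_]; last exact: Z0.
have ei : rev_ord i = inord b.-1.
  by apply: val_inj; rewrite /= inordK // ib; move: bN'; clear; lia.
have ej : rev_ord j = k by apply: val_inj; rewrite /= jk; move: kN; clear; lia.
by rewrite add0r -Zr ei ej.
Qed.

End StepCoefficients.

Section ProductFormulas.

Variables (n : nat) (g : structure_constants n) (mulK : Ki n -> Ki n -> Ki n).
Hypotheses (n0 : (0 < n)%N) (schur : is_schur_constants g) (Kmul : is_Kmul g mulK).
Local Notation N := (n.*2.+1).
Implicit Types (A B Z : iXit n) (lam : 'M[int]_N).

Lemma shift_laurent (A B Z : 'M[int]_N) : laurent_in (fun p =>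
  v ^ (dexp (Z + Ibreve n *+ p) - dexp (B + Ibreve n *+ p) - dexp (A + Ibreve n *+ p))).
Proof.
have [cA eA] := dexp_shift A; have [cB eB] := dexp_shift B; have [cZ eZ] := dexp_shift Z.
apply: laurent_ext (laurent_vX (dexp Z - dexp B - dexp A) (cZ - cB - cA)) => p.
by rewrite eA eB eZ; congr (v ^ _); ring.
Qed.

Lemma is_diag_shift lam p : is_diag_mx lam -> is_diag_mx (lam + Ibreve n *+ p).
Proof.
move/is_diag_mxP => dl; apply/is_diag_mxP => i j ij; rewrite shiftE dl //.
by rewrite (_ : i == j = false) ?mul0r ?addr0 //; apply/negbTE.
Qed.

Lemma composable_shift d (B' A' : Xi n d) B A p : composable B A ->
    val B' = val B + Ibreve n *+ p -> val A' = val A + Ibreve n *+ p ->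
  forall j, \sum_i val B' i j = \sum_i val A' j i.
Proof.
move=> /composable_sums cBA -> -> j.
under eq_bigr do rewrite shiftE; under [RHS]eq_bigr do rewrite shiftE.
rewrite !big_split /= cBA; congr (_ + _); apply: eq_bigr => i _.
by rewrite eq_sym; case: (eqVneq j i) => [->|].
Qed.

Lemma Kmul_step B A Z a b lam : is_step n a b -> is_diag_mx lam ->
    val B = lam + dth n b.-1 a.-1 -> composable B A ->
  val (mulK << B >> << A >>)@_Z
  = v ^ (dexp (val Z) - dexp (val B) - dexp (val A)) * cstep a b (val A) (val Z).
Proof.
move=> st dl eB cBA.
pose f p := v ^ (dexp (val Z + Ibreve n *+ p) - dexp (val B + Ibreve n *+ p)
    - dexp (val A + Ibreve n *+ p)) * cstep a b (val A + Ibreve n *+ p) (val Z + Ibreve n *+ p).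
have f0 : f 0%N = v ^ (dexp (val Z) - dexp (val B) - dexp (val A)) * cstep a b (val A) (val Z).
  by rewrite /f !mulr0n !addr0.
rewrite -f0; apply: (Kmul_coef n0 Kmul cBA).
- by apply: laurent_mul; [exact: shift_laurent | exact: cstep_laurent].
- move=> p d B' A' Z' d0 eB' eA' eZ'; rewrite /f -eB' -eA' -eZ'; congr (_ * _).
  have dl' := is_diag_shift p dl.
  have eBl : val B' = (lam + Ibreve n *+ p) + dth n b.-1 a.-1 by rewrite eB' eB addrAC.
  apply: (evq_step n0 d0 schur st dl' eBl).
    exact: composable_shift eB' eA'.
  by rewrite eZ'; apply/middle_shift/iXit_middle.
by move=> ne; rewrite f0 cstep_entry_sum // mulr0.
Qed.

Lemma Kmul_diag B A Z : is_diag_mx (val B) -> composable B A ->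
  val (mulK << B >> << A >>)@_Z
  = v ^ (dexp (val Z) - dexp (val B) - dexp (val A)) * (val A == val Z)%:R.
Proof.
move=> dB cBA.
pose f p := v ^ (dexp (val Z + Ibreve n *+ p) - dexp (val B + Ibreve n *+ p)
    - dexp (val A + Ibreve n *+ p)) * (val A == val Z)%:R.
have f0 : f 0%N = v ^ (dexp (val Z) - dexp (val B) - dexp (val A)) * (val A == val Z)%:R.
  by rewrite /f !mulr0n !addr0.
rewrite -f0; apply: (Kmul_coef n0 Kmul cBA).
- by apply: laurent_mul; [exact: shift_laurent | exact: laurent_cst].
- move=> p d B' A' Z' d0 eB' eA' eZ'; rewrite /f -eB' -eA' -eZ'; congr (_ * _).
  rewrite (schur_diag d0 schur); first 1 last.
  + by rewrite eB'; exact: is_diag_shift.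
  + exact: composable_shift eB' eA'.
  rewrite evqC -(inj_eq (addIr (Ibreve n *+ p)) (val A)) -eA' -eZ'.
  by case: (_ == _).
by move=> ne; rewrite f0; case: eqP => [e|]; [case: ne; rewrite e | rewrite mulr0].
Qed.

End ProductFormulas.

Section KLinear.

Variable n : nat.

Lemma Ki_ind (P : Ki n -> Prop) : P 0 ->
  (forall (a : Av) A y, P y -> P (a *: << A >> + y)) -> forall y, P y.
Proof.
move=> P0 PD y; rewrite [y]monalgE.
elim: (X in \sum_(k <- X) _) => [|k s IH]; first by rewrite big_nil.
rewrite big_cons; have -> : << y@_k *g k >> = y@_k *: << k >> :> Ki n.
  by apply/malgP=> i; apply: (etrans (mcoeffU _ _ _)); rewrite mcoeffZU mulr_natr.
exact: PD.
Qed.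

End KLinear.

(** * Generation of K *)

Section Measure.

Variable n : nat.
Hypothesis n0 : (0 < n)%N.
Local Notation N := (n.*2.+1).
Implicit Types M : 'M[int]_N.

Definition meas M : int := \sum_i \sum_j M i j * ((i : nat)%:Z - (j : nat)%:Z) ^+ 2.

Lemma meas_delta (x y : 'I_N) : meas (delta_mx x y) = ((x : nat)%:Z - (y : nat)%:Z) ^+ 2.
Proof.
rewrite /meas (bigD1 x) //= (bigD1 y) //= mxE !eqxx mul1r big1 ?addr0; last first.
  by move=> j jy; rewrite mxE (negbTE jy) andbF mul0r.
by rewrite big1 ?addr0 // => i ix; apply: big1 => j _; rewrite mxE (negbTE ix) mul0r.
Qed.

Lemma measD M M' : meas (M + M') = meas M + meas M'.
Proof.
rewrite /meas -big_split; apply: eq_bigr => i _; rewrite -big_split; apply: eq_bigr => j _ /=.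
by rewrite mxE mulrDl.
Qed.

Lemma measN M : meas (- M) = - meas M.
Proof.
rewrite /meas -sumrN; apply: eq_bigr => i _; rewrite -sumrN; apply: eq_bigr => j _ /=.
by rewrite mxE mulNr.
Qed.

Lemma meas_dth x y : (x < N)%N -> (y < N)%N -> meas (dth n x y) = 2 * (x%:Z - y%:Z) ^+ 2.
Proof.
move=> xN yN; rewrite measD !meas_delta !inordK //; try by (clear; lia).
by rewrite -!subzn; clear -xN yN; lia.
Qed.

Lemma meas_move a b M k : is_step n a b -> (k < N)%N ->
  meas (move a b M k)
  = meas M - 2 * (b.-1%:Z - k%:Z) ^+ 2 + 2 * (a.-1%:Z - k%:Z) ^+ 2.
Proof.
move=> st kN; have [a0 ab bN _ _] := is_step_bounds n0 st.
by rewrite /move measD [X in X + _]measD measN !meas_dth //; clear -a0 ab bN; lia.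
Qed.

(** Moving an entry in a further column yields a larger [meas]. Hence moves in different columns
    differ, and the terms of a product by a step are ordered by their column. *)
Lemma meas_gap (a b k k' : nat) : (0 < a < b)%N -> (k < k')%N ->
  (b.-1%:Z - k'%:Z) ^+ 2 - (a.-1%:Z - k'%:Z) ^+ 2
  < (b.-1%:Z - k%:Z) ^+ 2 - (a.-1%:Z - k%:Z) ^+ 2.
Proof.
move=> /andP[a0 ab] kk; rewrite -subr_gt0.
have [x bx] : exists x, b.-1 = (a.-1 + x.+1)%N by exists (b - a).-1; clear -a0 ab; lia.
have [y ky] : exists y, k' = (k + y.+1)%N by exists (k' - k).-1; clear -kk; lia.
rewrite bx ky.
rewrite [X in 0 < X](_ : _ = 2 * x.+1%:Z * y.+1%:Z) ?mulr_gt0 //.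
by rewrite !PoszD; ring.
Qed.

Lemma meas_ge0 (A : iXit n) : 0 <= meas (val A).
Proof.
apply: sumr_ge0 => i _; apply: sumr_ge0 => j _.
case: (eqVneq i j) => [->|ij]; first by rewrite subrr expr0n mulr0.
by apply: mulr_ge0; [exact: iXit_off_ge0 | exact: sqr_ge0].
Qed.

Lemma dth_rev x y (i j : 'I_N) : (x < N)%N -> (y < N)%N ->
  dth n x y (rev_ord i) (rev_ord j) = dth n x y i j.
Proof.
move=> xN yN; rewrite !dthE //= !subSS addrC.
have rev1 (i' : 'I_N) z : (z < N)%N -> (n.*2 - i' == z)%N = ((i' : nat) == n.*2 - z)%N.
  by move=> zN; have := ltn_ord i'; move: (nat_of_ord i') => w wN; clear -zN wN; lia.
have rev2 (i' : 'I_N) z : (z < N)%N -> (n.*2 - i' == n.*2 - z)%N = ((i' : nat) == z).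
  by move=> zN; have := ltn_ord i'; move: (nat_of_ord i') => w wN; clear -zN wN; lia.
by rewrite !rev2 // !rev1.
Qed.

Lemma dth_middle_row x y (j : 'I_N) : (x < N)%N -> (y < N)%N -> x != n ->
  dth n x y (middle n) j = 0.
Proof.
move=> xN yN xn; rewrite dthE // /middle inordK; last by clear; lia.
have -> : (n == x) = false by apply/negbTE; rewrite eq_sym.
have -> : (n == n.*2 - x)%N = false by clear -xn xN n0; lia.
by [].
Qed.

Lemma dth_middle_col x y (i : 'I_N) : (x < N)%N -> (y < N)%N -> y != n ->
  dth n x y i (middle n) = 0.
Proof. by move=> xN yN yn; rewrite -tr_dth mxE dth_middle_row. Qed.

Lemma dth_ge0 x y (i j : 'I_N) : 0 <= dth n x y i j.
Proof. by rewrite !mxE addr_ge0 // ler0n. Qed.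

End Measure.

Section LeadingTerm.

Variable n : nat.
Hypothesis n0 : (0 < n)%N.
Local Notation N := (n.*2.+1).
Implicit Types A B Z : iXit n.

Lemma move_in_iXit A a b (k : 'I_N) : is_step n a b -> a.-1 != n -> (k : nat) != n ->
  (0 < val A (inord b.-1) k) -> in_iXit (move a b (val A) k).
Proof.
move=> st an kn Ak; have [a0 ab bN bn bb] := is_step_bounds n0 st.
have bN' : (b.-1 < N)%N by clear -a0 ab bN; lia.
have aN' : (a.-1 < N)%N by clear -a0 ab bN; lia.
have kN := ltn_ord k.
have addE (C E F : 'M[int]_N) i j : (C - E + F) i j = C i j - E i j + F i j by rewrite !mxE.
apply/and3P; split.
- apply/forallP=> i; apply/forallP=> j; apply/implyP=> ij.
  rewrite addE addr_ge0 ?dth_ge0 // dthE // subr_ge0.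
  case: (boolP (((i : nat) == b.-1) && ((j : nat) == k))) => [/andP[/eqP ib /eqP jk]|_].
    have ei : i = inord b.-1 by apply: val_inj; rewrite /= inordK.
    have ej : j = k by apply: val_inj.
    by rewrite ib (negbTE bb) addr0 ei ej.
  case: (boolP (((i : nat) == _) && _)) => [/andP[/eqP ib /eqP jk]|_].
    have ei : rev_ord i = inord b.-1.
      by apply: val_inj; rewrite /= inordK // ib; move: bN'; clear; lia.
    have ej : rev_ord j = k by apply: val_inj; rewrite /= jk; move: kN; clear; lia.
    by rewrite add0r -iXit_rev ei ej.
  exact: iXit_off_ge0.
- apply/forallP=> i; apply/forallP=> j; apply/eqP.
  by rewrite !addE !dth_rev // iXit_rev.
apply/forallP=> i; have /forallP/(_ i) := iXit_middle A.
by rewrite !addE !dth_middle_row // !dth_middle_col // !subr0 ?addr0.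
Qed.

(** Composability with A forces the diagonal of lam; its entries may be negative, which [in_iXit]
    permits. *)
Lemma ex_step_left A a b : is_step n a b -> a.-1 != n ->
  exists B lam : iXit n, [/\ is_diag_mx (val lam), val B = val lam + dth n b.-1 a.-1
    & composable B A].
Proof.
move=> st an; have [a0 ab bN bn bb] := is_step_bounds n0 st.
have bN' : (b.-1 < N)%N by clear -a0 ab bN; lia.
have aN' : (a.-1 < N)%N by clear -a0 ab bN; lia.
pose w (i : 'I_N) : int := \sum_j val A i j - \sum_j dth n a.-1 b.-1 i j.
have wr i : w (rev_ord i) = w i.
  rewrite /w (reindex_inj rev_ord_inj) /= [X in _ - X](reindex_inj rev_ord_inj) /=.
  by congr (_ - _); apply: eq_bigr => j _; rewrite ?iXit_rev ?dth_rev.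
have wm : w (middle n) = 1.
  have [s _] := sum_middle (iXit_middle A); rewrite /w s.
  by rewrite big1 ?subr0 // => j _; rewrite dth_middle_row.
pose L : 'M[int]_N := diag_mx (\row_i w i).
have LE i j : L i j = w i * (i == j)%:Z.
  by rewrite !mxE; case: eqVneq => [->|]; rewrite ?mulr1 ?mulr0.
have Ldiag : is_diag_mx L.
  by apply/is_diag_mxP => i j ij; rewrite LE (_ : i == j = false) ?mulr0 //; apply/negbTE.
have Lrev i j : L (rev_ord i) (rev_ord j) = L i j.
  by rewrite !LE wr (inj_eq rev_ord_inj).
have Lmid i : L (middle n) i = (i == middle n)%:R /\ L i (middle n) = (i == middle n)%:R.
  rewrite !LE wm mul1r eq_sym; split; first by rewrite natz.
  by case: (eqVneq i (middle n)) => [->|_]; rewrite ?wm ?mulr0.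
have Lx : in_iXit L.
  apply/and3P; split.
  - apply/forallP=> i; apply/forallP=> j; apply/implyP=> ij.
    by rewrite LE (negbTE ij) mulr0.
  - by apply/forallP=> i; apply/forallP=> j; rewrite Lrev.
  - by apply/forallP=> i; have [-> ->] := Lmid i; rewrite !eqxx.
have addE i j : (L + dth n b.-1 a.-1) i j = L i j + dth n b.-1 a.-1 i j by rewrite mxE.
have Bx : in_iXit (L + dth n b.-1 a.-1).
  apply/and3P; split.
  - apply/forallP=> i; apply/forallP=> j; apply/implyP=> ij.
    by rewrite addE LE (negbTE ij) mulr0 add0r dth_ge0.
  - by apply/forallP=> i; apply/forallP=> j; rewrite !addE Lrev dth_rev.
  - apply/forallP=> i; have [e1 e2] := Lmid i.
    by rewrite !addE e1 e2 dth_middle_row // dth_middle_col // !addr0 !eqxx.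
pose mk M (xM : in_iXit M) : iXit n := exist (fun M : 'M[int]_N => is_true (in_iXit M)) M xM.
exists (mk _ Bx), (mk _ Lx); split=> //=.
apply/forallP=> j; apply/eqP => /=.
under eq_bigr do rewrite addE LE.
rewrite big_split /= (bigD1 j) //= eqxx mulr1 big1 ?addr0; last first.
  by move=> i ij; rewrite (negbTE ij) mulr0.
rewrite (eq_bigr (fun i => dth n a.-1 b.-1 j i)); last by move=> i _; rewrite -tr_dth mxE.
by rewrite /w subrK.
Qed.

(** Measures separate the moves, so only the summand k remains; up to a power of v it is (v^(2m) -
    1) / (v^2 - 1), with m > 0 the moved entry of A. *)
Lemma cstep_lead A a b (k : 'I_N) : is_step n a b -> (k <= a.-1)%N ->
  (0 < val A (inord b.-1) k) -> (k : nat) != n ->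
  cstep a b (move a b (val A) k) (val A) != 0.
Proof.
move=> st ka Ak kn; have [a0 ab bN bn bb] := is_step_bounds n0 st.
have kN := ltn_ord k; have ab' := ltnW ab.
have inj (k' : 'I_N) : move a b (val A) k == move a b (val A) k' = (k' == k).
  apply/eqP/eqP => [e|-> //]; apply: val_inj => /=.
  have := congr1 (@meas n) e; rewrite !meas_move // => em.
  have aab : (0 < a < b)%N by rewrite a0.
  case: (ltngtP k' k) => // lt; have := meas_gap aab lt; move: em;
    move: (_ ^+ 2) (_ ^+ 2) (_ ^+ 2) (_ ^+ 2) (meas _) => x y z t m; clear; lia.
have ne : move a b (val A) k == val A = false.
  apply/negbTE/eqP => e; have := congr1 (@meas n) e; rewrite !meas_move //.
  have : (a.-1%:Z - k%:Z) ^+ 2 < (b.-1%:Z - k%:Z) ^+ 2.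
    rewrite ltr_pXn2r ?nnegrE //; by clear -ka ab a0; lia.
  set x := _ ^+ 2; set y := _ ^+ 2; clear; lia.
rewrite /cstep ne andbF subr0; apply: mulf_neq0; last exact: (invr_neq0 v2_neq1).
rewrite (bigD1 k) //= big1 ?addr0; last first.
  by move=> k' /negbTE kk; rewrite inj kk mul0r.
rewrite eqxx mul1r preS // sum_step_rows ?iXit_middle //.
rewrite (_ : k == middle n = false); last first.
  by apply: contraNF kn => /eqP->; rewrite inordK //; clear; lia.
rewrite andbF addr0 mulrDr exprzDr ?v_unit // -{2}(mulr1 (v ^ _)) -mulrBr.
apply: mulf_neq0; first exact: (expfz_neq0 _ v_neq0).
rewrite subr_eq0.
case: (val A _ _) Ak => // -[|m] // _.
by rewrite -exprnP vX_eq1.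
Qed.

End LeadingTerm.

Section Generation.

Variables (n : nat) (g : structure_constants n) (mulK : Ki n -> Ki n -> Ki n).
Hypotheses (n0 : (0 < n)%N) (schur : is_schur_constants g) (Kmul : is_Kmul g mulK).
Local Notation N := (n.*2.+1).
Implicit Types A B Z : iXit n.

(* The divided powers are not needed: over Q(v) the generators with R <= 1     *)
(* already generate, hence the closure of P under division by scalars. If      *)
(* A' = move a b A k, with k the least column of A with a positive entry below *)
(* the diagonal, A is the term of largest meas in the product of a step and A' *)
Lemma K_generated (P : Ki n -> Prop) :
    P 0 -> (forall (a : Av) x y, P x -> P y -> P (a *: x + y)) ->
    (forall x y, P x -> P y -> P (mulK x y)) ->
    (forall (c : Av) x, c != 0 -> P (c *: x) -> P x) ->
    (forall B, is_diag_mx (val B) -> P << B >>) ->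
    (forall B (lam : iXit n) a b, is_step n a b -> is_diag_mx (val lam) ->
       val B = val lam + dth n b.-1 a.-1 -> P << B >>) ->
  forall x, P x.
Proof.
move=> P0 PD PM PV Pdiag Pstep.
have PU (x : Ki n) : (forall Z, x@_Z != 0 -> P << Z >>) -> P x.
  move=> h; rewrite [x]monalgE.
  have {}h Z : Z \in (msupp x : seq _) -> P << Z >> by rewrite -mcoeff_neq0; apply: h.
  elim: (msupp x : seq _) h => [|k s IH] h; first by rewrite big_nil.
  rewrite big_cons; have -> : << x@_k *g k >> = x@_k *: << k >> :> Ki n.
    by apply/malgP=> i; apply: (etrans (mcoeffU _ _ _)); rewrite mcoeffZU mulr_natr.
  apply: PD; first by apply: h; rewrite mem_head.
  by apply: IH => Z Zs; apply: h; rewrite in_cons Zs orbT.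
suff PA A : P << A >> by move=> x; apply: PU => Z _; apply: PA.
have [m] := ubnP (absz (meas (val A))); elim: m A => // m IH A Am.
pose low (k : 'I_N) := [exists i : 'I_N, (k < i)%N && (0 < val A i k)].
(* Without positive entries below the diagonal there are none above it either, by central symmetry,
   and A is diagonal. *)
case: (pickP low) => [k0 lk0|no]; last first.
  apply: Pdiag; apply/is_diag_mxP => i j ij.
  have lowz (i' j' : 'I_N) : (j' < i')%N -> val A i' j' = 0.
    move=> lt; have ge : 0 <= val A i' j'.
      by apply: iXit_off_ge0; apply/eqP => e; move: lt; rewrite e ltnn.
    apply/eqP; have /existsP := negbT (no j'); case: eqVneq => // nz h; case: h.
    by exists i'; rewrite lt lt_def nz ge.
  case: (ltngtP i j) ij => // lt _; last exact: lowz.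
  rewrite -iXit_rev lowz //= ltn_sub2l // ltnS; by have := ltn_ord j; lia.
have [k /existsP[r /andP[kr Ark]] kmin] := @arg_minnP _ k0 low (fun k => k : nat) lk0.
have mid0 i : i != middle n -> val A (middle n) i = 0 /\ val A i (middle n) = 0.
  move=> im; have /forallP/(_ i)/andP[/eqP-> /eqP->] := iXit_middle A.
  by rewrite (negbTE im).
have mE : middle n = n :> nat by rewrite /middle inordK //; clear; lia.
have kn : (k : nat) != n.
  apply/eqP=> e; have em : k = middle n by apply: val_inj; rewrite /= mE.
  have rm : r != middle n by rewrite -em; apply/eqP=> e'; move: kr; rewrite e' ltnn.
  by move: Ark; rewrite em; have [_ ->] := mid0 r rm.
have rn : (r : nat) != n.
  apply/eqP=> e; have em : r = middle n by apply: val_inj; rewrite /= mE.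
  have km : k != middle n by rewrite -em; apply/eqP=> e'; move: kr; rewrite e' ltnn.
  by move: Ark; rewrite em; have [-> _] := mid0 k km.
have rN := ltn_ord r.
(* The step is chosen so that row b - 1 is the row r of the positive entry; for r = n + 1 the middle
   row has to be skipped. *)
have [a [b [st br ka an]]] : exists a b, [/\ is_step n a b, b.-1 = r :> nat, (k <= a.-1)%N
    & a.-1 != n].
  case: (eqVneq (r : nat) n.+1) => [r1|r1].
    by exists n, n.+2; split; rewrite /is_step ?eqxx ?orbT //; lia.
  exists r, r.+1; split=> //; last by lia.
    by rewrite /is_step eqxx rn r1 rN andbT; apply/orP; left; lia.
  by lia.
have [a0 ab bN bn bb] := is_step_bounds n0 st.
have er : inord b.-1 = r by rewrite br inord_val.
have Abk : 0 < val A (inord b.-1) k by rewrite er.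
have A'x := move_in_iXit n0 st an kn Abk.
pose A' : iXit n := exist (fun M : 'M[int]_N => is_true (in_iXit M)) _ A'x.
have [B [lam [dl eB cB]]] := ex_step_left n0 A' st an.
have aab : (0 < a < b)%N by rewrite a0.
have kN := ltn_ord k.
have measA := meas_move n0 (val A) st kN; have mA0 := meas_ge0 A.
have gap0 : (a.-1%:Z - k%:Z) ^+ 2 < (b.-1%:Z - k%:Z) ^+ 2.
  by rewrite ltr_pXn2r ?nnegrE //; clear -ka ab a0; lia.
have smaller Z : meas (val Z) < meas (val A) -> P << Z >>.
  move=> lt; apply: IH; have := meas_ge0 Z; move: lt Am mA0.
  by move: (meas (val Z)) (meas (val A)) => x y; clear; lia.
have PX : P (mulK << B >> << A' >>).
  apply: PM; first exact: (Pstep B lam a b).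
  apply: smaller; rewrite /= measA; move: gap0.
  by move: (_ ^+ 2) (_ ^+ 2) (meas _) => x y z; clear; lia.
set X := mulK _ _ in PX.
have XE Z : val X@_Z
    = v ^ (dexp (val Z) - dexp (val B) - dexp (val A')) * cstep a b (val A') (val Z).
  exact: (Kmul_step n0 schur Kmul Z st dl eB cB).
have XA : X@_A != 0.
  rewrite -(inj_eq val_inj) XE rmorph0; apply: mulf_neq0; first exact: (expfz_neq0 _ v_neq0).
  exact: cstep_lead.
apply: (PV _ _ XA).
have PY : P (X - X@_A *: << A >>).
  apply: PU => Z; have eY : (X - X@_A *: << A >>)@_Z = X@_Z - X@_A * (A == Z)%:R.
    by rewrite mcoeffB mcoeffZU.
  rewrite eY; case: (eqVneq A Z) => [<-|AZ]; first by rewrite mulr1 subrr eqxx.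
  rewrite mulr0 subr0 => XZ; apply: smaller.
  have cZ : cstep a b (val A') (val Z) != 0.
    apply: contraNneq XZ => c0; rewrite -(inj_eq val_inj) XE c0 mulr0.
    by rewrite rmorph0.
  have [eZ|[k' eA' Zk']] := cstep_support n0 st (iXit_middle Z) cZ.
    rewrite -eZ /= measA; move: gap0.
    by move: (_ ^+ 2) (_ ^+ 2) (meas _) => x y z; clear; lia.
  have measZ := meas_move n0 (val Z) st (ltn_ord k').
  have e : meas (val A') = meas (val A') by [].
  rewrite {2}eA' /= measA measZ in e.
  (* If k' < k, minimality of k makes the entry (a - 1, k') of A, hence of A', zero, whereas the
     move from Z gives at least 1 there. If k' > k, Z has smaller measure by [meas_gap]. If k' = k,
     then Z = A. *)
  case: (ltngtP k' k) => kk.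
  - have k'a : (k' < a.-1)%N by apply: leq_trans ka.
    have k'b : (k' < b.-1)%N by apply: leq_trans k'a _; clear -ab a0; lia.
    have bN' : (b.-1 < N)%N by clear -a0 ab bN; lia.
    have aN' : (a.-1 < N)%N by clear -a0 ab bN; lia.
    have off (Y : iXit n) c : (c < N)%N -> (k' < c)%N -> 0 <= val Y (inord c) k'.
      by move=> cN kc; apply: iXit_off_ge0; rewrite -val_eqE /= inordK // gtn_eqF.
    have Z1 : 0 <= val Z (inord a.-1) k' by apply: off.
    have A0 : val A (inord a.-1) k' = 0.
      apply/eqP; rewrite eq_le off // andbT leNgt; apply/negP => pos.
      have := kmin k'; rewrite leqNgt kk => /(_ _)/negP; apply=> //.
      by apply/existsP; exists (inord a.-1); rewrite inordK // k'a.
    have := congr1 (fun M : 'M[int]_N => M (inord a.-1) k') eA'.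
    rewrite /= !moveE // !inordK // A0 eqxx (ltn_eqF kk) eqxx.
    have -> : (a.-1 == b.-1) = false by clear -a0 ab; lia.
    rewrite !andbF !add0r /=.
    have -> : (a.-1 == n.*2 - a.-1)%N = false by clear -an; lia.
    have zero (q : nat) : (q <= k)%N ->
        (a.-1 == n.*2 - b.-1)%N && ((k' : nat) == n.*2 - q)%N = false.
      move: st ka kk; clear -n0; case/orP => [/and4P[/eqP-> _ _ _]|/andP[/eqP-> /eqP->]] /=.
        by move=> _ _ _; apply/negbTE; rewrite negb_and; apply/orP; left; lia.
      by move=> h1 h2 h3; apply/negbTE; rewrite negb_and; apply/orP; right; lia.
    rewrite (zero _ (leqnn _)) (zero _ (ltnW kk)).
    by move=> E; exfalso; move: E Z1 => /=; move: (sval Z _ _) => z; clear; lia.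
  - have := meas_gap aab kk; move: e; clear.
    move: (_ ^+ 2) (_ ^+ 2) (_ ^+ 2) (_ ^+ 2) (meas _) (meas _) => x y z t u w; lia.
  - have ek : k' = k by apply: val_inj.
    case/eqP: AZ; apply: val_inj; move: eA'; rewrite ek /= /move.
    by move=> /addIr /addIr.
have -> : X@_A *: << A >> = (-1) *: (X - X@_A *: << A >>) + X.
  by rewrite scaleN1r opprB subrK.
exact: PD.
Qed.

End Generation.

(** * The homomorphism *)

Lemma linear_fun0 (R : nzRingType) (V W : lmodType R) (f : V -> W) :
  (forall a x y, f (a *: x + y) = a *: f x + f y) -> f 0 = 0.
Proof. by move=> lf; have := lf (-1) 0 0; rewrite scaler0 addr0 scaleN1r addNr. Qed.

Lemma linear_funZ (R : nzRingType) (V W : lmodType R) (f : V -> W) :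
  (forall a x y, f (a *: x + y) = a *: f x + f y) -> forall a x, f (a *: x) = a *: f x.
Proof. by move=> lf a x; rewrite -[X in f X]addr0 lf (linear_fun0 lf) addr0. Qed.

Section Transfer.

Variables (n d : nat) (g : structure_constants n) (mulK : Ki n -> Ki n -> Ki n).
Hypothesis d0 : (0 < d)%N.
Hypotheses (schur : is_schur_constants g) (Kmul : is_Kmul g mulK).
Local Notation N := (n.*2.+1).

Lemma in_iXi_iXit (M : 'M[int]_N) : in_iXi d M -> in_iXit M.
Proof.
case/andP=> /and3P[/forallP M0 _ Mc] Mm; apply/and3P; split=> //.
by apply/forallP=> i; apply/forallP=> j; apply/implyP => _; have /forallP := M0 i.
Qed.

(** Looking coefficients up by matrix allows the index types [Xi n d] and [iXit n] to be compared;
    the default 0 covers matrices outside [iXit n]. *)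
Definition coefK (x : Ki n) (M : 'M[int]_N) : Av :=
  if (insub M : option (iXit n)) is Some A then x@_A else 0.

Lemma coefK_val x (A : iXit n) : coefK x (val A) = x@_A.
Proof. by rewrite /coefK valK. Qed.

Lemma coefKZD a x y M : coefK (a *: x + y) M = a * coefK x M + coefK y M.
Proof.
rewrite /coefK; case: insub => [A|]; last by rewrite mulr0 addr0.
exact: mcoeffZD.
Qed.

Definition transfer_val (x : Ki n) : Sj n d :=
  \sum_(A : Xi n d | in_iXi d (val A)) coefK x (val A) *: stdXi A.

Fact transfer_subproof x : transfer_val x \in @in_Si n d.
Proof. by apply/asboolP; exists (fun A => coefK x (val A)). Qed.

Definition transfer x : Si n d := MkSi (transfer_subproof x).

Lemma val_transfer_coef x Z : val (transfer_val x)@_Z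
  = if in_iXi d (val Z) then val (coefK x (val Z)) * v ^ (- dexp (val Z)) else 0.
Proof.
have -> : (transfer_val x)@_Z = if in_iXi d (val Z)
    then coefK x (val Z) * vexp (- dexp (val Z)) else 0.
  rewrite /transfer_val mcoeff_sum.
  rewrite (eq_bigr (fun A => coefK x (val A) * (vexp (- dexp (val A)) * (A == Z)%:R))); last first.
    move=> A _; apply: (etrans (mcoeffZ _ _ _)).
    by congr (_ * _); exact: stdXi_coef.
  case: ifP => [xZ|nZ].
    rewrite (bigD1 Z) //= eqxx mulr1 big1 ?addr0 // => A /andP[_ /negbTE->].
    by rewrite !mulr0.
  rewrite big1 // => A xA; rewrite (_ : A == Z = false) ?mulr0 //.
  by apply/negP => /eqP e; rewrite e nZ in xA.
by case: ifP => _; [rewrite rmorphM | rewrite rmorph0].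
Qed.

Lemma transfer_val_linear a x y :
  transfer_val (a *: x + y) = a *: transfer_val x + transfer_val y.
Proof.
apply/malgP=> Z; apply: val_inj.
apply: (etrans (val_transfer_coef _ _)); symmetry.
apply: (etrans (congr1 val (mcoeffZD a _ _ Z))).
transitivity (val a * val (transfer_val x)@_Z + val (transfer_val y)@_Z).
  by apply: (etrans (rmorphD _ _ _)); congr (_ + _); exact: rmorphM.
apply: (etrans (congr2 (fun s t => val a * s + t) (val_transfer_coef x Z)
  (val_transfer_coef y Z))).
case: ifP => _; last by rewrite mulr0 addr0.
rewrite coefKZD; move: (coefK x _) (coefK y _) (v ^ _) => s t u.
by rewrite [val (_ + _)]/(val a * val s + val t) mulrDl mulrA.
Qed.

Lemma transfer_linear a x y : transfer (a *: x + y) = a *: transfer x + transfer y.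
Proof. by apply: val_inj => /=; rewrite transfer_val_linear. Qed.

Lemma transfer_basis (A : iXit n) :
  transfer_val << A >> = if in_iXi d (val A) then std d (val A) else 0.
Proof.
apply/malgP=> Z; apply: val_inj; rewrite val_transfer_coef.
case: (boolP (in_iXi d (val A))) => [xA|nA].
  have xA' : in_Xi d (val A) by case/andP: xA.
  have -> : std d (val A) = stdXi (MkXi xA') by exact: (std_val (MkXi xA')).
  apply: (etrans _ (esym (val_stdXi_coef _ _))).
  case: (eqVneq (MkXi xA') Z) => [<-|AZ] /=.
    by rewrite xA coefK_val (mcoeffU _ _ _) eqxx rmorph1 mul1r mulr1.
  rewrite mulr0; case: ifP => // xZ.
  rewrite /coefK; case: insubP => [B _ eB|]; last by move=> _; exact: mul0r.
  rewrite (mcoeffU _ _ _) (_ : A == B = false) ?rmorph0 ?mul0r //.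
  by apply/negP => /eqP e; case/eqP: AZ; apply: val_inj; rewrite /= e eB.
rewrite mcoeff0 rmorph0; case: ifP => // xZ.
rewrite /coefK; case: insubP => [B _ eB|]; last by move=> _; exact: mul0r.
rewrite (mcoeffU _ _ _) (_ : A == B = false) ?rmorph0 ?mul0r //.
by apply/negP => /eqP e; rewrite e eB xZ in nA.
Qed.

(* F is the structure constant of B: in K it is read off at p = 0, where it   *)
(* agrees with the one of the Schur algebra and vanishes on negative entries. *)
Lemma transfer_mul_basis (B A : iXit n) (F : 'M[int]_N -> 'M[int]_N -> Qv) :
    (composable B A -> forall Z, val (mulK << B >> << A >>)@_Z
       = v ^ (dexp (val Z) - dexp (val B) - dexp (val A)) * F (val A) (val Z)) ->
    (forall B' A' Z' : Xi n d, val B' = val B ->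
       (forall j, \sum_i val B' i j = \sum_i val A' j i) -> middle_trivial (val Z') ->
       evq (g B' A' Z') = F (val A') (val Z')) ->
    (composable B A -> forall Z' : Xi n d, middle_trivial (val Z') ->
       F (val A) (val Z') != 0 -> in_Xi d (val A) && in_Xi d (val B)) ->
  transfer_val (mulK << B >> << A >>)
  = convolution g (transfer_val << B >>) (transfer_val << A >>).
Proof.
move=> KF SF F0; symmetry.
apply: (etrans (congr2 (@convolution n g d) (transfer_basis B) (transfer_basis A))).
symmetry.
have mA := iXit_middle A; have mB := iXit_middle B.
have conv0 y : convolution g 0 y = 0.
  exact: (linear_fun0 (fun a u w => convolution_linl g a u w y)).
have conv0' x : convolution g x 0 = 0.
  exact: (linear_fun0 (fun a u w => convolution_linr g a u w x)).
apply/malgP=> Z; apply: val_inj; rewrite val_transfer_coef.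
pose both := in_Xi d (val A) && in_Xi d (val B).
have -> : convolution g (if in_iXi d (val B) then std d (val B) else 0)
    (if in_iXi d (val A) then std d (val A) else 0)
  = if both then convolution g (std d (val B)) (std d (val A)) else 0.
  rewrite /both /in_iXi mA mB !andbT.
  case: (boolP (in_Xi d (val B))) => xB; last by rewrite andbF; exact: conv0.
  by rewrite andbT; case: ifP => // _; exact: conv0'.
case: (boolP both) => [/andP[xA xB]|nb]; last first.
  rewrite mcoeff0 rmorph0; case: ifP => // xZ.
  have xZt := in_iXi_iXit xZ.
  pose Zt : iXit n := exist (fun M : 'M[int]_N => is_true (in_iXit M)) _ xZt.
  rewrite -[val Z]/(val Zt) coefK_val.
  case: (boolP (composable B A)) => cBA; last first.
    case: Kmul => _ _ _ /(_ B [:: A]) /=; rewrite (negbTE cBA) => /(_ isT) -> _.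
    by rewrite mcoeff0; exact: mul0r.
  rewrite KF // (_ : F _ _ = 0) ?mulr0 ?mul0r //.
  apply/eqP/negPn/negP => nz; case/negP: nb.
  by apply: (F0 cBA Z) => //; case/andP: xZ.
have eB : std d (val B) = stdXi (MkXi xB) by exact: (std_val (MkXi xB)).
have eA : std d (val A) = stdXi (MkXi xA) by exact: (std_val (MkXi xA)).
rewrite eB eA convolution_std.
case: ifP => [xZ|nZ]; last first.
  have -> : g (MkXi xB) (MkXi xA) Z = 0.
    apply/eqP/negPn/negP => nz; move: nZ; rewrite /in_iXi (valP Z) /=.
    by rewrite (schur_middle d0 schur _ _ nz).
  by rewrite -polyC0 evqC mulr0.
have xZt := in_iXi_iXit xZ.
pose Zt : iXit n := exist (fun M : 'M[int]_N => is_true (in_iXit M)) _ xZt.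
have mZ : middle_trivial (val Z) by case/andP: xZ.
rewrite -[X in coefK _ X]/(val Zt) coefK_val.
case: (boolP (composable B A)) => cBA; last first.
  case: Kmul => _ _ _ /(_ B [:: A]) /=; rewrite (negbTE cBA) => /(_ isT) -> _.
  rewrite mcoeff0 [X in X * _]/(0 : Qv) mul0r.
  have -> : g (MkXi xB) (MkXi xA) Z = 0.
    apply/eqP/negPn/negP => nz; case/negP: cBA; apply/forallP => j; apply/eqP.
    exact: (schur_composable d0 schur nz).
  by rewrite -polyC0 evqC mulr0.
rewrite KF // (SF (MkXi xB) (MkXi xA) Z) //; last exact: composable_sums.
rewrite mulrAC -exprzDr ?v_unit //; congr (v ^ _ * _) => /=; ring.
Qed.

End Transfer.

Section GeneratorImages.

Variables (n d : nat).
Hypothesis n0 : (0 < n)%N.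
Local Notation N := (n.*2.+1).
Implicit Types (A B : iXit n) (Z : Xi n d).

Lemma cstep_move a b (A Z : 'M[int]_N) : is_step n a b -> cstep a b A Z != 0 ->
  exists k, A = move a b Z k.
Proof.
move=> st nz; case: (pickP (fun k : 'I_N => A == move a b Z k)) => [k /eqP eA|no].
  by exists k.
exists n; move: nz; rewrite /cstep big1 ?mul0r ?sub0r => [|k _]; last by rewrite no mul0r.
case: (eqVneq a n) => [ea|]; last by rewrite oppr0 eqxx.
have eb : b = n.+2.
  by case/orP: st => [/and4P[_ _]|/andP[_ /eqP]] //; rewrite ea eqxx.
by case: (A =P Z) => [->|]; rewrite ?oppr0 ?eqxx // ea eb move_mid.
Qed.

Lemma iXit_in_Xi A : (forall i, 0 <= val A i i) -> entry_sum (val A) = (d.*2.+1)%:Z ->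
  in_Xi d (val A).
Proof.
move=> A0 sA; have /and3P[_ Ac _] := valP A; apply/and3P; split=> //; last exact/eqP.
apply/forallP=> i; apply/forallP=> j; case: (eqVneq i j) => [<-|ij] //.
exact: iXit_off_ge0.
Qed.

(** A is nonnegative by [cstep_nonneg]. By [row_sums_step] a diagonal entry of B is a row sum of Z,
    lowered by 1 in row b - 1 and its mirror; those rows have positive sum, since otherwise
    [cstep_row0] would kill the constant. *)
Lemma in_Xi_step A B Z (lam : 'M[int]_N) a b : is_step n a b -> is_diag_mx lam ->
    val B = lam + dth n b.-1 a.-1 -> composable B A -> middle_trivial (val Z) ->
    cstep a b (val A) (val Z) != 0 ->
  in_Xi d (val A) && in_Xi d (val B).
Proof.
move=> st dl eB cBA mZ nz; have [a0 ab bN bn bb] := is_step_bounds n0 st.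
have sA : entry_sum (val A) = (d.*2.+1)%:Z.
  rewrite -(Xi_sum Z); case: (eqVneq (entry_sum (val Z)) (entry_sum (val A))) => [//|ne].
  by case/eqP: nz; apply: cstep_entry_sum; apply/eqP.
apply/andP; split.
  apply: iXit_in_Xi sA => i.
  exact: (cstep_nonneg n0 st mZ (Xi_ge0 Z) (Xi_rev Z) nz).
apply: iXit_in_Xi; last by rewrite (composable_entry_sum cBA).
have [k eA] := cstep_move st nz.
have rows := row_sums_step dl eB (composable_sums cBA) eA.
have rowb : 1 <= \sum_j val Z (inord b.-1) j.
  have [j Zj|Z0] := pickP (fun j => val Z (inord b.-1) j != 0); last first.
    case/eqP: nz; apply: (cstep_row0 n0 _ st mZ) => j; apply/eqP/negbFE/Z0.
  rewrite (bigD1 j) //=; have := Xi_ge0 Z (inord b.-1) j.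
  have : 0 <= \sum_(i | i != j) val Z (inord b.-1) i.
    by apply: sumr_ge0 => i _; apply: Xi_ge0.
  by move: Zj; move: (val Z _ _) (\sum_(_ | _) _) => x y; clear; lia.
have rowb' : 1 <= \sum_j val Z (inord (n.*2 - b.-1)) j.
  rewrite (_ : inord (n.*2 - b.-1) = rev_ord (inord b.-1)); last first.
    by apply: val_inj; rewrite /= !inordK; clear -a0 ab bN; lia.
  rewrite (reindex_inj rev_ord_inj) /=; under eq_bigr do rewrite Xi_rev.
  exact: rowb.
have row_ge0 i : 0 <= \sum_j val Z i j by apply: sumr_ge0 => j _; apply: Xi_ge0.
move=> i; have eBi : val B i i = lam i i.
  rewrite eB mxE dthE; [|clear -a0 ab bN; lia..].
  rewrite [X in _ + X](_ : _ = 0) ?addr0 //.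
  by have iN := ltn_ord i; move: iN; clear -a0 ab bN; lia.
have lamE : \sum_j lam i j = lam i i.
  rewrite (bigD1 i) //= big1 ?addr0 // => j ji.
  by move/is_diag_mxP: dl; apply; rewrite eq_sym.
have := rows i; rewrite eBi eB.
have -> : \sum_j (lam + dth n b.-1 a.-1) i j
    = lam i i + ((i == inord b.-1)%:Z + (i == inord (n.*2 - b.-1))%:Z).
  rewrite -lamE -(sum_row_dth _ a.-1) -big_split; apply: eq_bigr => j _; exact: mxE.
have Zi := row_ge0 i; have bb' : inord b.-1 != inord (n.*2 - b.-1) :> 'I_N.
  by rewrite -val_eqE /= !inordK //; clear -a0 ab bN; lia.
case: eqP => [ei|_]; case: eqP => [ei'|_] //.
- by rewrite -ei' ei eqxx in bb'.
- by rewrite ei; move: rowb; move: (\sum_j _) (lam _ _) => x y; clear; lia.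
- by rewrite ei'; move: rowb'; move: (\sum_j _) (lam _ _) => x y; clear; lia.
- by move: Zi; move: (\sum_j _) (lam _ _) => x y; clear; lia.
Qed.

Lemma in_Xi_diag A B Z : is_diag_mx (val B) -> composable B A -> val A = val Z ->
  in_Xi d (val A) && in_Xi d (val B).
Proof.
move=> dB cBA eA; have xA : in_Xi d (val A) by rewrite eA (valP Z).
rewrite xA /=; apply: iXit_in_Xi; last first.
  by rewrite (composable_entry_sum cBA) eA; exact: Xi_sum.
move=> i; have := composable_sums cBA i.
rewrite (bigD1 i) //= big1 ?addr0 => [->|j ji]; last by move/is_diag_mxP: dB; apply.
by apply: sumr_ge0 => j _; rewrite eA; apply: Xi_ge0.
Qed.

End GeneratorImages.

Lemma Sj_scaleI n d (c : Av) (x y : Sj n d) : c != 0 -> c *: x = c *: y -> x = y.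
Proof.
move=> c0 e; apply/malgP=> Z; apply: val_inj.
have {}e : c * x@_Z = c * y@_Z.
  by apply: (etrans (esym (mcoeffZ _ _ _))); rewrite e; exact: mcoeffZ.
have vc0 : val c != 0 by apply: contra c0 => /eqP vc; apply/eqP/val_inj.
by apply: (mulfI vc0); exact: (congr1 val e).
Qed.

Section Homomorphism.

Variables (n d : nat) (g : structure_constants n) (mulK : Ki n -> Ki n -> Ki n).
Hypotheses (n0 : (0 < n)%N) (d0 : (0 < d)%N).
Hypotheses (schur : is_schur_constants g) (Kmul : is_Kmul g mulK).
Local Notation T := (@transfer_val n d).

(** Generation is applied to the left factor with y arbitrary. On generators, linearity in y reduces
    the claim to [transfer_mul_basis], with F the equality indicator or [cstep]. *)
Lemma transfer_mul x y : T (mulK x y) = convolution g (T x) (T y).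
Proof.
have [KDl KDr KA _ _] := Kmul.
have TD := @transfer_val_linear n d.
have T0 : T 0 = 0 := linear_fun0 TD.
have CDl z a (u w : Sj n d) := convolution_linl g a u w z.
have CDr z a (u w : Sj n d) := convolution_linr g a u w z.
have KDl' z a u w := KDl a u w z.
have KDr' z a u w := KDr a u w z.
have basis B : (forall A : iXit n, T (mulK << B >> << A >>)
      = convolution g (T << B >>) (T << A >>)) ->
    forall z, T (mulK << B >> z) = convolution g (T << B >>) (T z).
  move=> hB; apply: Ki_ind => [|a A z hz].
    rewrite (linear_fun0 (KDr' << B >>)) T0; apply/esym.
    exact: (linear_fun0 (CDr (T << B >>))).
  by rewrite KDr' !TD CDr hB hz.
elim/(K_generated n0 schur Kmul): x y
  => [y|a x x' hx hx' y|x x' hx hx' y|c x c0 hx y|B dB|B lam a b st dl eB].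
- rewrite (linear_fun0 (KDl' y)) T0; apply/esym.
  exact: (linear_fun0 (CDl (T y))).
- by rewrite KDl' !TD CDl hx hx'.
- by rewrite -KA hx hx' hx (convolutionA d0 schur).
(* The scalar can be cancelled in the target, which is torsion free. *)
- apply: (Sj_scaleI c0); apply: (etrans (esym (linear_funZ TD c (mulK x y)))).
  apply: (etrans (congr1 T (esym (linear_funZ (KDl' y) c x)))).
  apply: (etrans (hx y)).
  apply: (etrans (congr1 (fun u => convolution g u (T y)) (linear_funZ TD c x))).
  exact: (linear_funZ (CDl (T y)) c (T x)).
- apply: basis => A; pose F (A Z : 'M[int]_(n.*2.+1)) : Qv := (A == Z)%:R.
  apply: (transfer_mul_basis d0 schur Kmul (F := F)).
  + by move=> cBA Z; exact: (Kmul_diag n0 schur Kmul Z dB cBA).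
  + move=> B' A' Z' eB' comp _; rewrite (schur_diag d0 schur) //; last by rewrite eB'.
    by rewrite evqC /F; case: (_ == _).
  + move=> cBA Z' _; rewrite /F; case: (eqVneq (val A) (val Z')) => [eA _|_]; last by rewrite eqxx.
    exact: (in_Xi_diag dB cBA eA).
- apply: basis => A.
  apply: (transfer_mul_basis d0 schur Kmul (F := cstep a b)).
  + by move=> cBA Z; exact: (Kmul_step n0 schur Kmul Z st dl eB cBA).
  + move=> B' A' Z' eB' comp mZ.
    by apply: (evq_step n0 d0 schur st dl _ comp mZ); rewrite eB'.
  + by move=> cBA Z' mZ nz; exact: (in_Xi_step n0 st dl eB cBA mZ nz).
Qed.

Lemma transfer_surj (y : Si n d) : exists x, transfer d x = y.
Proof.
have TD := @transfer_val_linear n d.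
pose emb (A : Xi n d) : Ki n :=
  if (insub (val A) : option (iXit n)) is Some B then << B >> else 0.
have embE (A : Xi n d) : in_iXi d (val A) -> T (emb A) = stdXi A.
  move=> xA; have xA' := in_iXi_iXit xA.
  have -> : emb A = << (Sub (val A) xA' : iXit n) >> by rewrite /emb insubT.
  by apply: (etrans (transfer_basis _ _)); rewrite /= xA; exact: std_val.
have [/asboolP[c ey]] : val y \in @in_Si n d by case: y.
exists (\sum_(A : Xi n d | in_iXi d (val A)) c A *: emb A).
apply: val_inj; rewrite ey /=.
elim/big_rec2: _ => [|A u w xA <-]; first exact: (linear_fun0 TD).
apply: (etrans (TD (c A) (emb A) w)).
apply: (congr1 (fun t => c A *: t + T w)).
exact: embE.
Qed.

End Homomorphism.

Section StepMatrices.

Variable n : nat.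
Hypothesis n0 : (0 < n)%N.

Lemma dth_Etheta (i j : nat) : (0 < i <= n.*2.+1)%N -> (0 < j <= n.*2.+1)%N ->
  dth n i.-1 j.-1 = Etheta n i j.
Proof. by case: i j => [|i] [|j] // _ _; rewrite /dth /Etheta /= !subSS. Qed.

Lemma dth_Etheta_rev (i j : nat) : (0 < i <= n.*2.+1)%N -> (0 < j <= n.*2.+1)%N ->
  dth n i.-1 j.-1 = Etheta n (n.*2.+2 - i) (n.*2.+2 - j).
Proof.
move=> iN jN; rewrite -dth_Etheta; [|clear -iN; lia|clear -jN; lia].
have e k : (0 < k <= n.*2.+1)%N -> (n.*2 - k.-1 = (n.*2.+2 - k).-1)%N.
  by move=> kN; clear -kN; lia.
have e' k : (0 < k <= n.*2.+1)%N -> (n.*2 - (n.*2.+2 - k).-1 = k.-1)%N.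
  by move=> kN; clear -kN; lia.
by rewrite /dth addrC (e i iN) (e j jN) (e' i iN) (e' j jN).
Qed.

(** [Etheta] is unchanged when both indices are mirrored: steps with a < n are of the third kind,
    those with a > n + 1 reflect to the second, and (n, n + 2) gives the first. *)
Lemma step_Etheta (M lam : 'M[int]_(n.*2.+1)) a b : is_step n a b -> M = lam + dth n b.-1 a.-1 ->
  [\/ M = lam + Etheta n n n.+2 *+ 1,
      exists2 i : nat, (1 <= i <= n.-1)%N & M = lam + Etheta n i i.+1 *+ 1
    | exists2 i : nat, (1 <= i <= n.-1)%N & M = lam + Etheta n i.+1 i *+ 1].
Proof.
rewrite mulr1n => st ->; case/orP: st => [/and4P[/eqP-> /andP[a0 aN] an an1]|/andP[/eqP-> /eqP->]].
  case: (ltnP a n) => [lt|ge].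
    apply: Or33; exists a; first by clear -lt a0; lia.
    by rewrite dth_Etheta //; clear -a0 aN; lia.
  apply: Or32; exists (n.*2.+1 - a)%N; first by clear -ge an an1 aN; lia.
  rewrite dth_Etheta_rev; [|clear -a0 aN; lia..].
  by congr (_ + Etheta _ _ _); clear -aN; lia.
apply: Or31; rewrite dth_Etheta_rev; [|clear -n0; lia..].
by congr (_ + Etheta _ _ _); clear; lia.
Qed.

End StepMatrices.

Theorem propositionA17 (n d : nat) (g : structure_constants n)
    (mulK : Ki n -> Ki n -> Ki n) :
  (0 < n)%N -> (0 < d)%N -> is_schur_constants g -> is_Kmul g mulK ->
  exists! phi : Ki n -> Si n d,
    [/\ forall (a : Av) (x y : Ki n), phi (a *: x + y) = a *: phi x + phi y,
        forall x y : Ki n,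
          val (phi (mulK x y)) = convolution g (val (phi x)) (val (phi y)),
        forall y : Si n d, exists x : Ki n, phi x = y &
        forall (R : nat) (lambda A : iXit n), is_diag_mx (val lambda) ->
          [\/ val A = val lambda + Etheta n n n.+2 *+ R,
              exists2 i : nat, (1 <= i <= n.-1)%N
                & val A = val lambda + Etheta n i i.+1 *+ R
            | exists2 i : nat, (1 <= i <= n.-1)%N
                & val A = val lambda + Etheta n i.+1 i *+ R] ->
          val (phi << A >>) = if in_iXi d (val A) then std d (val A) else 0].
Proof.
move=> n0 d0 schur Kmul; exists (transfer d); split.
  split; first exact: transfer_linear.
  - exact: (transfer_mul n0 d0 schur Kmul).
  - exact: transfer_surj.
  - by move=> R lam A _ _; exact: transfer_basis.
move=> phi [phiD phiM _ phiG]; apply: funext => x.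
have TD := @transfer_linear n d.
elim/(K_generated n0 schur Kmul): x => [|a x y hx hy|x y hx hy|c x c0 hx|B dB|B lam a b st dl eB].
- by apply: (etrans (linear_fun0 TD)); apply/esym; exact: (linear_fun0 phiD).
- by rewrite TD phiD hx hy.
- apply: val_inj; rewrite phiM -hx -hy; exact: (transfer_mul n0 d0 schur Kmul).
- apply: val_inj; apply: (Sj_scaleI c0).
  have {}hx : c *: transfer d x = c *: phi x.
    apply: (etrans (esym (linear_funZ TD c x))); apply: (etrans hx).
    exact: (linear_funZ phiD c x).
  exact: (congr1 val hx).
(* A diagonal matrix is a prescribed one with R = 0, a step one with R = 1; there phi and
   [transfer d] have the same value. *)
- apply: val_inj; apply: (etrans (transfer_basis d B)); apply/esym.
  by apply: (phiG 0%N B B dB); apply: Or31; rewrite mulr0n addr0.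
- apply: val_inj; apply: (etrans (transfer_basis d B)); apply/esym.
  by apply: (phiG 1%N lam B dl); exact: (step_Etheta n0 st eB).
Qed.
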